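(* Let $\gamma\subset\mathbb{CP}^2$ be a non-linear complex irreducible projective planar algebraic curve such that: (i) $\gamma$ has no inflection points, and at each its singular point (if any) all its local branches are quadratic; (ii) there exists at most a unique singular point of $\gamma$ where there exists at least one singular local branch. Then $\gamma$ is a conic.
   Context: Local branches of $\gamma$ at a point are the irreducible components of the germ of $\gamma$ there. For an irreducible non-linear germ $b$ of analytic curve at $O\in\mathbb{CP}^2$, an affine chart $(z,w)$ centered at $O$ is adapted to $b$ if the $z$-axis is tangent to $b$ at $O$; in such a chart $b$ has a holomorphic bijective local parametrization $t\mapsto(t^{q_b},c_bt^{p_b}(1+o(1)))$, as $t\to0$, with $q_b,p_b\in\mathbb N$, $1\le q_b<p_b$, $c_b\ne0$. The germ is regular (non-singular) iff $q_b=1$, and singular otherwise. Its projective Puiseux exponent is $r_b=p_b/q_b$; $b$ is called quadratic if $r_b=2$. An inflection point is a smooth point of $\gamma$ where the tangent line has contact (intersection index) at least $3$ with $\gamma$. *)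

(* Defs.v *)
From HB Require Import structures.
From mathcomp Require Import all_boot all_order all_algebra.
(* The notations of mpoly clash with those of MathComp-Analysis. *)
From mathcomp Require Export -(notations) mpoly.
From mathcomp Require Export complex.
From mathcomp Require Export boolp classical_sets reals topology normedtype
  derive.

Set Implicit Arguments.
Unset Strict Implicit.
Unset Printing Implicit Defensive.

Import Order.TTheory GRing.Theory Num.Theory.
Import numFieldNormedType.Exports.

Local Open Scope ring_scope.
Local Open Scope classical_set_scope.
Local Open Scope complex_scope.

(* * The complex projective plane and its affine charts *)

(* A point of CP^2 is a line through the origin of C^3. *)
Definition CP2 (R : realType) : Type :=
  {L : {vspace 'rV[R[i]]_3} | \dim L == 1%N}.

Definition Caff (R : realType) : normedModType R[i] :=
  (R[i]^o * R[i]^o)%type.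

Record affine_chart (R : realType) := AffineChart {
  frame : 'M[R[i]]_3;
  frame_unit : frame \in unitmx }.

(* Homogeneous coordinates of the point with affine coordinates (z, w). *)
Definition chart_vec (R : realType) (M : affine_chart R) (x : Caff R)
    : 'rV[R[i]]_3 :=
  (\row_(j < 3) [:: 1 : R[i]; (x.1 : R[i]); (x.2 : R[i])]`_j) *m frame M.

Lemma dim_chart_vec (R : realType) (M : affine_chart R) (x : Caff R) :
  \dim <[chart_vec M x]>%VS == 1%N.
Proof.
rewrite dim_vline; have [v0|//] := eqVneq (chart_vec M x) 0.
have /rowP/(_ 0) := congr1 (mulmx^~ (invmx (frame M))) v0.
rewrite /chart_vec mulmxK ?frame_unit // mul0mx !mxE /= => /eqP.
by rewrite oner_eq0.
Qed.

Definition chart (R : realType) (M : affine_chart R) (x : Caff R) : CP2 R :=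
  exist _ <[chart_vec M x]>%VS (dim_chart_vec M x).

Definition centered (R : realType) (M : affine_chart R) (O : CP2 R) : Prop :=
  chart M (0 : Caff R) = O.

(* * Plane projective curves *)

Definition mpoly_irreducible (R : realType) (F : mpoly 3 R[i]) : Prop :=
  F \isn't a GRing.unit /\
  (forall G H : mpoly 3 R[i],
     F = G * H -> G \is a GRing.unit \/ H \is a GRing.unit).

Definition zero_locus (R : realType) (F : mpoly 3 R[i]) : set (CP2 R) :=
  [set O : CP2 R | forall u : 'rV[R[i]]_3, u \in sval O -> meval (u 0) F = 0].

(* gamma is the irreducible curve with (reduced) equation F = 0; by the
   Nullstellensatz gamma determines F up to a scalar factor. *)
Definition irreducible_curve (R : realType) (F : mpoly 3 R[i])
    (gamma : set (CP2 R)) : Prop :=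
  [/\ exists d : nat, F \is ishomog1 d mdeg,
      mpoly_irreducible F & gamma = zero_locus F].

Definition is_line (R : realType) (gamma : set (CP2 R)) : Prop :=
  exists L : mpoly 3 R[i],
    [/\ L != 0, L \is ishomog1 1 mdeg & gamma = zero_locus L].

Definition is_conic (R : realType) (gamma : set (CP2 R)) : Prop :=
  exists Q : mpoly 3 R[i],
    [/\ mpoly_irreducible Q, Q \is ishomog1 2 mdeg & gamma = zero_locus Q].

Definition singular_point (R : realType) (F : mpoly 3 R[i]) (O : CP2 R)
    : Prop :=
  zero_locus F O /\
  (forall u : 'rV[R[i]]_3, u \in sval O ->
     forall j : 'I_3, meval (u 0) (mderiv j F) = 0).

Definition smooth_point (R : realType) (F : mpoly 3 R[i]) (O : CP2 R) : Prop :=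
  zero_locus F O /\ ~ singular_point F O.

(* The vector v spans a point of the projective tangent line at the smooth
   point spanned by u. *)
Definition in_tangent_line (R : realType) (F : mpoly 3 R[i])
    (u v : 'rV[R[i]]_3) : Prop :=
  \sum_(j < 3) meval (u 0) (mderiv j F) * v 0 j = 0.

(* F (u + X v): its order at X = 0 is the intersection index, at the point
   spanned by u, of the curve F = 0 with the line through u and v. *)
Definition restrict_to_line (R : realType) (F : mpoly 3 R[i])
    (u v : 'rV[R[i]]_3) : {poly R[i]} :=
  mmap (@polyC R[i]) (fun j : 'I_3 => (u 0 j)%:P + (v 0 j) *: 'X) F.

Definition inflection_point (R : realType) (F : mpoly 3 R[i]) (O : CP2 R)
    : Prop :=
  smooth_point F O /\
  (exists u v : 'rV[R[i]]_3,
     [/\ sval O = <[u]>%VS, v \notin sval O, in_tangent_line F u v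
       & ('X^3 %| restrict_to_line F u v)%R]).

(* * Germs of analytic subsets of C^2 at the origin *)

(* A germ at the origin is given by any set representing it. *)
Definition germ_sub (R : realType) (A B : set (Caff R)) : Prop :=
  \forall x \near (0 : Caff R), A x -> B x.

Definition germ_eq (R : realType) (A B : set (Caff R)) : Prop :=
  \forall x \near (0 : Caff R), A x <-> B x.

Definition holomorphic_at0 (R : realType) (f : Caff R -> R[i]^o) : Prop :=
  \forall x \near (0 : Caff R), differentiable f x.

Definition analytic_germ (R : realType) (A : set (Caff R)) : Prop :=
  exists (n : nat) (f : 'I_n -> Caff R -> R[i]^o),
    (forall k, holomorphic_at0 (f k)) /\
    germ_eq A [set x | forall k, f k x = 0].

Definition irreducible_germ (R : realType) (A : set (Caff R)) : Prop :=
  [/\ analytic_germ A, ~ germ_eq A set0 &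
      forall A1 A2 : set (Caff R), analytic_germ A1 -> analytic_germ A2 ->
        germ_eq A (A1 `|` A2) -> germ_eq A A1 \/ germ_eq A A2].

(* Irreducible components are the maximal irreducible analytic subgerms. *)
Definition germ_component (R : realType) (A B : set (Caff R)) : Prop :=
  [/\ irreducible_germ B, germ_sub B A &
      forall B' : set (Caff R), irreducible_germ B' -> germ_sub B' A ->
        germ_sub B B' -> germ_eq B B'].

(* * Local branches and their projective Puiseux exponents *)

(* The germ at O of b, a subset of CP^2, is a local branch of gamma at O.  The
   choice of the chart is irrelevant, as transition maps are biholomorphic. *)
Definition local_branch (R : realType) (gamma : set (CP2 R)) (O : CP2 R)
    (b : set (CP2 R)) : Prop :=
  exists M : affine_chart R,
    centered M O /\ germ_component (chart M @^-1` gamma) (chart M @^-1` b).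

(* The z-axis is the limit at the origin of the secants of B through it. *)
Definition tangent_to_z_axis (R : realType) (B : set (Caff R)) : Prop :=
  forall e : R[i], 0 < e ->
    \forall x \near (0 : Caff R), B x -> `|x.2| <= e * `|x.1|.

Definition adapted_chart (R : realType) (b : set (CP2 R)) (O : CP2 R)
    (M : affine_chart R) : Prop :=
  centered M O /\ tangent_to_z_axis (chart M @^-1` b).

(* t |-> (t^q, g t), with g t = c t^p (1 + o(1)) and c <> 0, is a holomorphic
   bijection of a neighborhood U of 0 onto a representative of the germ B. *)
Definition puiseux_parametrization (R : realType) (B : set (Caff R))
    (q p : nat) : Prop :=
  exists (c : R[i]^o) (g : R[i]^o -> R[i]^o) (U : set R[i]^o),
    let phi : R[i]^o -> Caff R := fun t => (t ^+ q, g t) in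
    [/\ c != 0,
        nbhs (0 : R[i]^o) U,
        forall t, U t -> differentiable g t,
        (fun t : R[i]^o => g t / t ^+ p) @ (0 : R[i]^o)^' --> c &
        {in U &, injective phi} /\ germ_eq B (phi @` U)].

Definition puiseux_degrees (R : realType) (b : set (CP2 R)) (O : CP2 R)
    (q p : nat) : Prop :=
  (1 <= q < p)%N /\
  (exists M : affine_chart R,
     adapted_chart b O M /\ puiseux_parametrization (chart M @^-1` b) q p).

Definition puiseux_exponent (R : realType) (b : set (CP2 R)) (O : CP2 R)
    (r : rat) : Prop :=
  exists q p : nat, puiseux_degrees b O q p /\ r = p%:R / q%:R.

Definition quadratic_branch (R : realType) (b : set (CP2 R)) (O : CP2 R)
    : Prop :=
  puiseux_exponent b O 2.

Definition singular_branch (R : realType) (b : set (CP2 R)) (O : CP2 R)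
    : Prop :=
  exists q p : nat, puiseux_degrees b O q p /\ q <> 1%N.

(* Main.v *)
(** Osculating conics.  Along a parametrized arc of the curve let [w3] and [w6]
    be the Wronskians of the three homogeneous coordinates and of their six
    quadratic monomials; [w3] vanishes at inflection points, [w6] at sextactic
    points.  The quotient [w6 / w3 ^ 5] does not depend on the parametrization
    and is homogeneous of degree -3 in the coordinates, so that multiplying it
    by the cube of a linear form gives a function [psi] on the curve.  Since
    there are no inflection points, [psi] is bounded near smooth points.  On a
    branch [t |-> (t ^ q, c t ^ (2 q) + ...)] the quotient has a pole of order at
    most [3 q], and none if [q = 1]; the pole is killed if the line passes
    through the point.  By (ii) one line can be taken through the only point
    with branches [q > 1] and through a further smooth point [p].  The
    symmetric functions of [psi] over the fibers of a projection are then
    bounded and holomorphic off a finite set, hence constant, and [psi] vanishes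
    on the curve because it vanishes at [p].  So [w6 = 0] everywhere: the
    osculating conic at a smooth point has contact of infinite order, and the
    curve is that conic. *)

Require Import Defs.
From HB Require Import structures.
From mathcomp Require Import all_boot all_order all_algebra.
From mathcomp Require Import ring lra zify.

Set Implicit Arguments.
Unset Strict Implicit.
Unset Printing Implicit Defensive.

Import Order.TTheory GRing.Theory Num.Theory.
Import numFieldNormedType.Exports.

Local Open Scope ring_scope.
Local Open Scope classical_set_scope.
Local Open Scope complex_scope.

(** * Complex analysis *)

Section ComplexModulus.
Variable R : realType.
Local Notation C := R[i].
Implicit Types z w : C.

(** The quotient [w6 / w3 ^ 5] is forced by two weights. Multiplying the coordinates by a function
    [u] multiplies [w3] by [u ^ 3] and [w6] by [u ^ 12]; a change of parameter with derivative [r]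
    contributes [r ^ 3] and [r ^ 15], where 3 = 0 + 1 + 2 and 15 = 0 + ... + 5. The fifth power
    cancels the parameter and leaves weight 12 - 15 = -3. On a branch with exponents [q] and [2 q],
    [w3] has order exactly [3 q - 3] and [w6] order at least [12 q - 15], whence the pole of order
    [3 q]; for [q = 1], [w3] does not vanish and [w6] is bounded. Local branches are defined through
    analytic germs, so bounds branch by branch prove nothing until finitely many branches are known
    to cover the curve near the point; the decomposition of germs is there for this. Derivatives
    along the curve are taken along the Hamiltonian field of its equation, which makes both
    Wronskians polynomials in the affine coordinates. Constancy of the symmetric functions only
    yields one zero of [psi] in almost every fiber; irreducibility of the equation turns this into
    divisibility. *)

Definition cabs z : R := Normc.normc z.

(** The norm takes its values in [R[i]]; [cabs] is the same number in [R], where order reasoning is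
    linear arithmetic. *)
Lemma cabsE z : `|z| = (cabs z)%:C.
Proof. by case: z => a b; rewrite normc_def. Qed.

Lemma cabs_ge0 z : 0 <= cabs z.
Proof. by rewrite -ler0c -cabsE. Qed.

Lemma cabsD z w : cabs (z + w) <= cabs z + cabs w.
Proof. exact: le_normcD. Qed.

Lemma cabsN z : cabs (- z) = cabs z.
Proof. exact: normcN. Qed.

Lemma cabsM z w : cabs (z * w) = cabs z * cabs w.
Proof. exact: Normc.normcM. Qed.

Lemma cabsV z : cabs z^-1 = (cabs z)^-1.
Proof. exact: Normc.normcV. Qed.

Lemma cabs0 : cabs 0 = 0. Proof. exact: Normc.normc0. Qed.

Lemma cabs1 : cabs 1 = 1. Proof. exact: Normc.normc1. Qed.

Lemma cabsX z n : cabs (z ^+ n) = cabs z ^+ n.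
Proof. by elim: n => [|n IH]; rewrite ?expr0 ?cabs1 // !exprS cabsM IH. Qed.

Lemma cabs_eq0 z : (cabs z == 0) = (z == 0).
Proof.
apply/eqP/eqP => [/Normc.eq0_normc|->] //; exact: cabs0.
Qed.

Lemma cabs_gt0 z : (0 < cabs z) = (z != 0).
Proof. by rewrite lt_neqAle cabs_ge0 andbT eq_sym cabs_eq0. Qed.

Lemma cabsBC z w : cabs (z - w) = cabs (w - z).
Proof. by rewrite -cabsN opprB. Qed.

Lemma cabsR (x : R) : cabs x%:C = `|x|.
Proof. by rewrite /cabs /= expr0n addr0 sqrtr_sqr. Qed.

Lemma cabsi : cabs 'i = 1.
Proof. by rewrite /cabs /= expr0n add0r expr1n sqrtr1. Qed.

Lemma cabs_Re z : `|complex.Re z| <= cabs z.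
Proof. by rewrite -lecR -cabsE normc_ge_Re. Qed.

Lemma cabs_Im z : `|complex.Im z| <= cabs z.
Proof.
have := cabs_Re (z * 'i); rewrite cabsM cabsi mulr1.
by rewrite complex.ReiNIm normrN.
Qed.

Lemma cabs_ReIm z : cabs z <= `|complex.Re z| + `|complex.Im z|.
Proof.
rewrite {1}[z]complexE; apply: le_trans (cabsD _ _) _.
by rewrite cabsM cabsi mul1r !cabsR.
Qed.

Lemma cabs_triangle z w u : cabs (z - u) <= cabs (z - w) + cabs (w - u).
Proof. by apply: le_trans (cabsD _ _); rewrite subrKA. Qed.

Lemma cabs_lowerB z w : cabs z - cabs w <= cabs (z - w).
Proof. by have := cabsD (z - w) w; rewrite subrK; lra. Qed.

Lemma cabs_sum (I : Type) (s : seq I) (P : pred I) (F : I -> C) :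
  cabs (\sum_(i <- s | P i) F i) <= \sum_(i <- s | P i) cabs (F i).
Proof.
elim/big_ind2: _ => [|x a y b xa yb|//]; first by rewrite cabs0.
by apply: le_trans (cabsD _ _) (lerD xa yb).
Qed.

Lemma cabs_prod (I : Type) (s : seq I) (P : pred I) (F : I -> C) :
  cabs (\prod_(i <- s | P i) F i) = \prod_(i <- s | P i) cabs (F i).
Proof. by apply: (big_morph cabs cabsM cabs1). Qed.

End ComplexModulus.

(** * Continuity and complex differentiability in epsilon-delta form *)

Section Continuity.
Variable R : realType.
Local Notation C := R[i].
Implicit Types (f g h k : C -> C) (z : C).

Definition ccont f z := forall e : R, 0 < e ->
  exists2 d : R, 0 < d & forall w, cabs (w - z) < d -> cabs (f w - f z) < e.

Lemma ccont_cst (c : C) z : ccont (fun=> c) z.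
Proof. by move=> e e0; exists 1 => // w _; rewrite subrr cabs0. Qed.

Lemma ccont_id z : ccont id z.
Proof. by move=> e e0; exists e. Qed.

Lemma ccontD f g z : ccont f z -> ccont g z -> ccont (fun w => f w + g w) z.
Proof.
move=> cf cg e e0.
have e2 : 0 < e / 2 by lra.
have [d d0 Hd] := cf _ e2; have [d' d'0 Hd'] := cg _ e2.
exists (Num.min d d'); first by rewrite lt_min d0.
move=> w; rewrite lt_min => /andP[/Hd wd /Hd' wd'].
have -> : f w + g w - (f z + g z) = (f w - f z) + (g w - g z) by ring.
by have := cabsD (f w - f z) (g w - g z); lra.
Qed.

Lemma ccontN f z : ccont f z -> ccont (fun w => - f w) z.
Proof.
move=> cf e /cf[d d0 H]; exists d => // w /H.
by rewrite -opprD cabsN.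
Qed.

Lemma ccont_bounded f z : ccont f z ->
  exists2 d : R, 0 < d & forall w, cabs (w - z) < d -> cabs (f w) < cabs (f z) + 1.
Proof.
move=> /(_ 1 ltr01)[d d0 H]; exists d => // w /H.
by have := cabs_lowerB (f w) (f z); lra.
Qed.

Lemma ccontM f g z : ccont f z -> ccont g z -> ccont (fun w => f w * g w) z.
Proof.
move=> cf cg e e0.
have [d1 d10 H1] := ccont_bounded cf.
set A := cabs (f z) + 1 in H1; set B := cabs (g z) + 1.
have A0 : 0 < A by rewrite /A; have := cabs_ge0 (f z); lra.
have B0 : 0 < B by rewrite /B; have := cabs_ge0 (g z); lra.
have [d d0 Hd] := cf (e / 2 / B) ltac:(by rewrite divr_gt0 //; lra).
have [d' d'0 Hd'] := cg (e / 2 / A) ltac:(by rewrite divr_gt0 //; lra).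
exists (Num.min d1 (Num.min d d')); first by rewrite !lt_min d10 d0.
move=> w; rewrite !lt_min => /and3P[/H1 w1 /Hd wd /Hd' wd'].
have -> : f w * g w - f z * g z = f w * (g w - g z) + (f w - f z) * g z by ring.
apply: le_lt_trans (cabsD _ _) _; rewrite !cabsM.
have -> : e = A * (e / 2 / A) + (e / 2 / B) * B.
  by rewrite mulrC divfK ?divfK ?gt_eqF //; lra.
apply: ltr_leD.
  by apply: ltr_pM; rewrite ?cabs_ge0.
by apply: ler_pM; rewrite ?cabs_ge0 ?ltW // /B ltrDl.
Qed.

Lemma ccontX f z n : ccont f z -> ccont (fun w => f w ^+ n) z.
Proof.
move=> cf; elim: n => [|n IH].
  by under eq_fun do rewrite expr0; exact: ccont_cst.
by under eq_fun do rewrite exprS; exact: ccontM.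
Qed.

Lemma ccont_sum n (F : 'I_n -> C -> C) z : (forall i, ccont (F i) z) ->
  ccont (fun w => \sum_(i < n) F i w) z.
Proof.
elim: n F => [|n IH] F cF.
  by under eq_fun do rewrite big_ord0; exact: ccont_cst.
under eq_fun do rewrite big_ord_recr /=.
by apply: ccontD => //; apply: IH.
Qed.

Lemma ccont_neq0 f z : ccont f z -> f z != 0 ->
  exists2 d : R, 0 < d & forall w, cabs (w - z) < d -> cabs (f z) / 2 < cabs (f w).
Proof.
rewrite -cabs_gt0 => cf fz0.
have [d d0 H] := cf (cabs (f z) / 2) ltac:(lra).
exists d => // w /H; have := cabs_lowerB (f z) (f w).
by rewrite (cabsBC (f z)); lra.
Qed.

Lemma ccontV f z : f z != 0 -> ccont f z -> ccont (fun w => (f w)^-1) z.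
Proof.
move=> fz0 cf e e0.
have [d1 d10 H1] := ccont_neq0 cf fz0.
have m0 : 0 < cabs (f z) by rewrite cabs_gt0.
set m := cabs (f z) in H1 m0.
have [d d0 Hd] := cf (e * (m * m / 2)) ltac:(by rewrite !mulr_gt0 ?invr_gt0).
exists (Num.min d1 d); first by rewrite lt_min d10.
move=> w; rewrite lt_min => /andP[/H1 w1 /Hd wd].
have fw0 : f w != 0 by rewrite -cabs_gt0; lra.
have -> : (f w)^-1 - (f z)^-1 = (f z - f w) / (f w * f z) by field; rewrite ?fz0 ?fw0.
rewrite cabsM cabsV cabsM cabsBC -/m ltr_pdivrMr; last by rewrite mulr_gt0 // cabs_gt0.
by apply: lt_le_trans wd _; rewrite ler_pM2l //; nra.
Qed.

Lemma ccont_ext f g z : f =1 g -> ccont f z -> ccont g z.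
Proof. by move=> /funext ->. Qed.

Lemma ccont_near f g z (d : R) : 0 < d ->
  (forall w, cabs (w - z) < d -> f w = g w) -> ccont f z -> ccont g z.
Proof.
move=> d0 fg cf e /cf[d' d'0 H].
exists (Num.min d d'); first by rewrite lt_min d0.
move=> w; rewrite lt_min => /andP[wd /H].
by rewrite !fg // subrr cabs0.
Qed.

Lemma ccont_horner (p : {poly C}) f z : ccont f z -> ccont (fun w => p.[f w]) z.
Proof.
move=> cf; elim/poly_ind: p => [|p c IH].
  by under eq_fun do rewrite horner0; exact: ccont_cst.
under eq_fun do rewrite hornerMXaddC.
by apply: ccontD (ccont_cst _ _); apply: ccontM.
Qed.

(* Caratheodory's form of differentiability. *)
Definition cdiff f z := exists2 k : C -> C,
  forall w, f w = f z + k w * (w - z) & ccont k z.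

Lemma cdiff_cont f z : cdiff f z -> ccont f z.
Proof.
case=> k fk ck; apply: (ccont_ext (f := fun w => f z + k w * (w - z))).
  by move=> w; rewrite -fk.
apply: ccontD (ccont_cst _ _) _; apply: ccontM => //.
exact: ccontD (ccont_id _) (ccont_cst _ _).
Qed.

Lemma cdiff_cst (c : C) z : cdiff (fun=> c) z.
Proof. by exists (fun=> 0) => [w|]; [rewrite mul0r addr0|exact: ccont_cst]. Qed.

Lemma cdiff_id z : cdiff id z.
Proof. by exists (fun=> 1) => [w|]; [rewrite mul1r addrC subrK|exact: ccont_cst]. Qed.

Lemma cdiffD f g z : cdiff f z -> cdiff g z -> cdiff (fun w => f w + g w) z.
Proof.
case=> k fk ck [l gl cl]; exists (fun w => k w + l w); last exact: ccontD.
by move=> w; rewrite fk gl; ring.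
Qed.

Lemma cdiffM f g z : cdiff f z -> cdiff g z -> cdiff (fun w => f w * g w) z.
Proof.
move=> df dg; have cg := cdiff_cont dg.
case: df => k fk ck; case: dg => l gl cl.
exists (fun w => k w * g w + f z * l w).
  by move=> w; rewrite fk gl; ring.
by apply: ccontD; apply: ccontM => //; exact: ccont_cst.
Qed.

Lemma cdiffN f z : cdiff f z -> cdiff (fun w => - f w) z.
Proof.
case=> k fk ck; exists (fun w => - k w); last exact: ccontN.
by move=> w; rewrite fk; ring.
Qed.

Lemma cdiffB f g z : cdiff f z -> cdiff g z -> cdiff (fun w => f w - g w) z.
Proof. by move=> df /cdiffN; exact: cdiffD. Qed.

Lemma cdiffX f z n : cdiff f z -> cdiff (fun w => f w ^+ n) z.
Proof.
move=> cf; elim: n => [|n IH].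
  by under eq_fun do rewrite expr0; exact: cdiff_cst.
by under eq_fun do rewrite exprS; exact: cdiffM.
Qed.

(** The quotient [k] is a global function although only its germ at [z] matters: off [z] it is
    replaced by the difference quotient of [g]. *)
Lemma cdiff_near f g z (d : R) : 0 < d ->
  (forall w, cabs (w - z) < d -> f w = g w) -> cdiff f z -> cdiff g z.
Proof.
move=> d0 fg [k fk ck].
have fgz : f z = g z by apply: fg; rewrite subrr cabs0.
exists (fun w => if w == z then k z else (g w - g z) / (w - z)).
  move=> w; case: eqP => [->|/eqP wz]; first by rewrite subrr mulr0 addr0.
  by rewrite divfK ?subr_eq0 // addrC subrK.
apply: ccont_near d0 _ ck => w wd; case: eqP => [->//|/eqP wz].
rewrite -fg // -fgz fk [f z + _]addrC addrK mulfK // subr_eq0 //.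
Qed.

Lemma cdiffV f z : f z != 0 -> cdiff f z -> cdiff (fun w => (f w)^-1) z.
Proof.
move=> fz0 df; have cf := cdiff_cont df.
have [d d0 H] := ccont_neq0 cf fz0.
have [k fk ck] := df.
(* Where [f w = 0] the inverse is 0 by convention, and the quotient has to follow that value; near
   [z] only the other case occurs. *)
exists (fun w => if f w == 0 then - (f z)^-1 / (w - z) else - k w / (f w * f z)).
  move=> w; case: eqP => [fw0|/eqP fw0].
    have wz : w != z by apply: contraNneq fz0 => <-; rewrite fw0.
    by rewrite fw0 invr0 divfK ?subr_eq0 // subrr.
  have E : k w * (w - z) = f w - f z by rewrite (fk w); ring.
  rewrite mulrAC mulNr E; field; by rewrite ?fz0 ?fw0.
apply: (ccont_near (d := d) (f := fun w => - k w / (f w * f z))) => //.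
  move=> w /H; case: eqP => // ->; rewrite cabs0; have := cabs_ge0 (f z) => h1 h2; exfalso; lra.
apply: ccontM; first exact: ccontN.
apply: ccontV; first by rewrite mulf_neq0.
by apply: ccontM => //; exact: ccont_cst.
Qed.

End Continuity.

(** * Discrete contour integrals over squares *)

Section Goursat.
Variable R : realType.
Local Notation C := R[i].
Local Notation Re := (@complex.Re R).
Local Notation Im := (@complex.Im R).
Implicit Types (h k : C -> C) (c d z w : C) (s : R).

(* Midpoint sums of [h dz] along the segment from [c] to [c + s d], cut into
   [2 ^ n] equal pieces. *)
Fixpoint edge_sum d n h c s : C :=
  if n is n'.+1 then
    edge_sum d n' h c (s / 2) + edge_sum d n' h (c + (s / 2)%:C * d) (s / 2)
  else s%:C * h (c + (s / 2)%:C * d).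

(** The boundary is run counterclockwise. [edge_sum] contains no factor [d], hence the ['i] on the
    vertical edges. *)
Definition square_sum n h c s : C :=
  edge_sum 1 n h c s + 'i * edge_sum 'i n h (c + s%:C) s
  - edge_sum 1 n h (c + s%:C * 'i) s - 'i * edge_sum 'i n h c s.

Definition in_square c s z : Prop :=
  [/\ Re c <= Re z, Re z <= Re c + s, Im c <= Im z & Im z <= Im c + s].

Definition on_square c s z : Prop :=
  in_square c s z /\
  [\/ Re z = Re c, Re z = Re c + s, Im z = Im c | Im z = Im c + s].

Lemma half_double s : s%:C = (s / 2)%:C + (s / 2)%:C :> C.
Proof. by rewrite -rmorphD /= -splitr. Qed.

(** The inner edges of the four quarters are run twice in opposite directions. The equality is exact
    because halving the square uses up one level of subdivision. *)
Lemma square_sumS n h c s :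
  square_sum n.+1 h c s =
  square_sum n h c (s / 2) + square_sum n h (c + (s / 2)%:C) (s / 2)
  + square_sum n h (c + (s / 2)%:C * 'i) (s / 2)
  + square_sum n h (c + (s / 2)%:C + (s / 2)%:C * 'i) (s / 2).
Proof.
rewrite /square_sum /= !mulr1 (half_double s) mulrDl.
set a := (s / 2)%:C.
have -> : c + (a + a) + a * 'i = c + a + a * 'i + a by ring.
have -> : c + (a * 'i + a * 'i) + a = c + a + a * 'i + a * 'i by ring.
have -> : c + a + a * 'i = c + a * 'i + a by ring.
have -> : c + (a + a) = c + a + a by ring.
have -> : c + (a * 'i + a * 'i) = c + a * 'i + a * 'i by ring.
by ring.
Qed.

Lemma edge_sumD d n h k c s :
  edge_sum d n (fun z => h z + k z) c s = edge_sum d n h c s + edge_sum d n k c s.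
Proof.
elim: n c s => [|n IH] c s /=; first by rewrite mulrDr.
by rewrite !IH; ring.
Qed.

Lemma edge_sumZ d n h (u : C) c s :
  edge_sum d n (fun z => u * h z) c s = u * edge_sum d n h c s.
Proof.
elim: n c s => [|n IH] c s /=; first by rewrite mulrCA.
by rewrite !IH; ring.
Qed.

Lemma square_sumD n h k c s :
  square_sum n (fun z => h z + k z) c s = square_sum n h c s + square_sum n k c s.
Proof. by rewrite /square_sum !edge_sumD; ring. Qed.

Lemma square_sumZ n h (u : C) c s :
  square_sum n (fun z => u * h z) c s = u * square_sum n h c s.
Proof. by rewrite /square_sum !edge_sumZ; ring. Qed.

Lemma edge_sum_cst d n (u : C) c s : edge_sum d n (fun=> u) c s = s%:C * u.
Proof.
by elim: n c s => [|n IH] c s //=; rewrite !IH -mulrDl -half_double.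
Qed.

Lemma edge_sum_id d n c s :
  edge_sum d n id c s = s%:C * c + s%:C ^+ 2 / 2 * d.
Proof.
elim: n c s => [|n IH] c s.
  by rewrite [LHS]/= (half_double s); field.
by rewrite [LHS]/= !IH (half_double s); field.
Qed.

(** The midpoint rule is exact on affine functions, so their sums vanish as the integrals would. *)
Lemma square_sum_affine n (u v : C) c s :
  square_sum n (fun z => u + v * z) c s = 0.
Proof.
rewrite square_sumD square_sumZ /square_sum !edge_sum_cst !edge_sum_id.
have ii : 'i ^+ 2 = -1 :> C by rewrite sqr_i.
by field: ii.
Qed.

Lemma edge_sum_Re d n h c s (u : C) (m : R) : 0 <= s ->
  (forall t : R, 0 <= t <= s -> m <= Re (u * h (c + t%:C * d))) ->
  s * m <= Re (u * edge_sum d n h c s).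
Proof.
elim: n c s => [|n IH] c s s0 H /=.
  have := H (s / 2) ltac:(lra).
  by rewrite mulrCA; case: (u * _) => a b /=; rewrite mul0r subr0 => ?; apply: ler_wpM2l.
rewrite mulrDr raddfD /=.
have -> : s * m = s / 2 * m + s / 2 * m by field.
apply: lerD; apply: IH; rewrite ?divr_ge0 // => t t2.
  by apply: H; lra.
rewrite -addrA -mulrDl -rmorphD /=.
by apply: H; lra.
Qed.

Lemma edge_sum_bound d n h c s (m : R) : 0 <= s ->
  (forall t : R, 0 <= t <= s -> cabs (h (c + t%:C * d)) <= m) ->
  cabs (edge_sum d n h c s) <= s * m.
Proof.
elim: n c s => [|n IH] c s s0 H /=.
  rewrite cabsM cabsR ger0_norm //; apply: ler_wpM2l => //; apply: H; lra.
apply: le_trans (cabsD _ _) _.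
have -> : s * m = s / 2 * m + s / 2 * m by field.
apply: lerD; apply: IH; rewrite ?divr_ge0 // => t t2.
  by apply: H; lra.
rewrite -addrA -mulrDl -rmorphD /=.
by apply: H; lra.
Qed.

Lemma ReD z w : Re (z + w) = Re z + Re w.
Proof. exact: (raddfD (@complex.Re R)). Qed.

Lemma ImD z w : Im (z + w) = Im z + Im w.
Proof. exact: (raddfD (@complex.Im R)). Qed.

Lemma ReN z : Re (- z) = - Re z.
Proof. exact: (raddfN (@complex.Re R)). Qed.

Lemma ImN z : Im (- z) = - Im z.
Proof. exact: (raddfN (@complex.Im R)). Qed.

Lemma ReRi s : Re (s%:C * 'i) = 0.
Proof. by rewrite /= mulr0 mul0r subr0. Qed.

Lemma ImRi s : Im (s%:C * 'i) = s.
Proof. by rewrite /= mulr1 mul0r addr0. Qed.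

Definition ReImE := (ReD, ImD, ReN, ImN, ReRi, ImRi).

Lemma on_square_edges c s (P : C -> Prop) : 0 <= s ->
  (forall z, on_square c s z -> P z) ->
  forall t, 0 <= t <= s ->
  [/\ P (c + t%:C * 1), P (c + s%:C + t%:C * 'i),
      P (c + s%:C * 'i + t%:C * 1) & P (c + t%:C * 'i)].
Proof.
move=> s0 H t ts; split; apply: H; rewrite /on_square /in_square ?mulr1 !ReImE /=.
all: split; [by split; lra|].
- by apply: Or43; lra.
- by apply: Or42; lra.
- by apply: Or44; lra.
- by apply: Or41; lra.
Qed.

Lemma square_sum_bound n h c s (m : R) : 0 <= s ->
  (forall z, on_square c s z -> cabs (h z) <= m) ->
  cabs (square_sum n h c s) <= 4 * s * m.
Proof.
move=> s0 /(on_square_edges s0) H.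
have b1 : cabs (edge_sum 1 n h c s) <= s * m.
  by apply: edge_sum_bound => // t /H[].
have b2 : cabs (edge_sum 'i n h (c + s%:C) s) <= s * m.
  by apply: edge_sum_bound => // t /H[].
have b3 : cabs (edge_sum 1 n h (c + s%:C * 'i) s) <= s * m.
  by apply: edge_sum_bound => // t /H[].
have b4 : cabs (edge_sum 'i n h c s) <= s * m.
  by apply: edge_sum_bound => // t /H[].
rewrite /square_sum; move: b1 b2 b3 b4.
set e1 := edge_sum _ _ _ _ _; set e2 := edge_sum _ _ _ _ _.
set e3 := edge_sum _ _ _ _ _; set e4 := edge_sum _ _ _ _ _ => b1 b2 b3 b4.
have := cabsD (e1 + 'i * e2 - e3) (- ('i * e4)).
have := cabsD (e1 + 'i * e2) (- e3).
have := cabsD e1 ('i * e2).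
by rewrite !cabsN !cabsM cabsi; lra.
Qed.

End Goursat.

(** * Goursat's lemma by bisection *)

Section GoursatLemma.
Variable R : realType.
Local Notation C := R[i].
Local Notation Re := (@complex.Re R).
Local Notation Im := (@complex.Im R).
Implicit Types (h k : C -> C) (c d z w : C) (s e : R).

Lemma exp2_small s e : 0 < e -> exists K, s / 2 ^+ K < e.
Proof.
move=> e0; have [s0|s0] := ltrP 0 s; last first.
  by exists 0%N; rewrite expr0 divr1; lra.
exists (Num.bound (s / e)); rewrite ltr_pdivrMr ?exprn_gt0 //.
have := archi_boundP (divr_ge0 (ltW s0) (ltW e0)).
set K := Num.bound _ => sK.
have : (K%:R : R) < 2 ^+ K by rewrite -natrX ltr_nat ltn_expl.
by move: sK; rewrite ltr_pdivrMr // => sK K2; nra.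
Qed.

Lemma nested_intervals (a l : nat -> R) : (forall n, 0 <= l n) ->
  (forall n, a n <= a n.+1 /\ a n.+1 + l n.+1 <= a n + l n) ->
  exists x, forall n, a n <= x <= a n + l n.
Proof.
move=> l0 al.
have amono m n : (m <= n)%N -> a m <= a n.
  move=> /subnKC <-; elim: (n - m)%N => [|j IH]; first by rewrite addn0.
  by rewrite addnS; apply: le_trans IH (al _).1.
have bmono m n : (m <= n)%N -> a n + l n <= a m + l m.
  move=> /subnKC <-; elim: (n - m)%N => [|j IH]; first by rewrite addn0.
  by rewrite addnS; apply: le_trans (al _).2 IH.
have ub m n : a m <= a n + l n.
  have [mn|nm] := leqP m n; first by apply: le_trans (amono _ _ mn) _; rewrite lerDl.
  by apply: le_trans (bmono _ _ (ltnW nm)); rewrite lerDl.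
exists (sup (range a)) => n; apply/andP; split.
  apply: ub_le_sup; last by exists n.
  by exists (a 0%N + l 0%N) => _ [m _ <-].
by apply: ge_sup; [exists (a 0%N); exists 0%N|move=> _ [m _ <-]].
Qed.

(** Stands for an integral of modulus at most [e], without a limit of the sums. *)
Definition small_sum h c s e :=
  exists N, forall n, (N <= n)%N -> cabs (square_sum n h c s) <= e.

(** With a negative side, [quarter a (- s) b] is the lower left corner of one of the four squares of
    side [s] that have [a] as a vertex. *)
Definition quarter c s (b : bool * bool) : C :=
  c + (b.1%:R * s)%:C + (b.2%:R * s)%:C * 'i.

Lemma small_sum_split h c s (e : bool * bool -> R) :
  (forall b, small_sum h (quarter c (s / 2) b) (s / 2) (e b)) ->
  small_sum h c s
    (e (false, false) + e (true, false) + e (false, true) + e (true, true)).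
Proof.
move=> H; have [N HN] := choice H.
exists (N (false, false) + N (true, false) + N (false, true) + N (true, true)).+1%N.
case=> // n; rewrite ltnS => nN; rewrite square_sumS.
have H1 := HN (false, false) n ltac:(lia).
have H2 := HN (true, false) n ltac:(lia).
have H3 := HN (false, true) n ltac:(lia).
have H4 := HN (true, true) n ltac:(lia).
move: H1 H2 H3 H4; rewrite /quarter /= !mul1r !mul0r !addr0.
set t1 := square_sum _ _ _ _; set t2 := square_sum _ _ _ _.
set t3 := square_sum _ _ _ _; set t4 := square_sum _ _ _ _ => H1 H2 H3 H4.
have := cabsD (t1 + t2 + t3) t4; have := cabsD (t1 + t2) t3; have := cabsD t1 t2.
lra.
Qed.

Lemma in_square_dist c s z w : in_square c s z -> in_square c s w ->
  cabs (w - z) <= 2 * s.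
Proof.
move=> [z1 z2 z3 z4] [w1 w2 w3 w4]; apply: le_trans (cabs_ReIm _) _.
rewrite !ReImE.
have : `|Re w - Re z| <= s by rewrite ler_norml; apply/andP; split; lra.
have : `|Im w - Im z| <= s by rewrite ler_norml; apply/andP; split; lra.
lra.
Qed.

(* Bisect towards a point where the sums would stay large, and compare there
   with the first order expansion, whose sums vanish. *)
Lemma goursat h c s e : 0 < s -> 0 < e ->
  (forall z, in_square c s z -> cdiff h z) -> small_sum h c s (e * s ^+ 2).
Proof.
move=> s0 e0 dh; apply: contrapT => bad0.
pose bad (p : C * R) := ~ small_sum h p.1 p.2 (e * p.2 ^+ 2).
(* The bound [e * s ^ 2] is four times its value at half the side, so one quarter of a bad square is
   bad. *)
have next p : exists b, bad p -> bad (quarter p.1 (p.2 / 2) b, p.2 / 2).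
  have [bp|nbp] := pselect (bad p); last by exists (true, true).
  apply: contrapT => nb; apply: bp.
  have := @small_sum_split h p.1 p.2 (fun=> e * (p.2 / 2) ^+ 2).
  have -> : e * (p.2 / 2) ^+ 2 + e * (p.2 / 2) ^+ 2 + e * (p.2 / 2) ^+ 2
    + e * (p.2 / 2) ^+ 2 = e * p.2 ^+ 2 by field.
  apply=> b; apply: contrapT => nb'; apply: nb; exists b => _; exact: nb'.
have [f Hf] := choice next.
pose P := fix P n := if n is n'.+1 then
  let p := P n' in (quarter p.1 (p.2 / 2) (f p), p.2 / 2) else (c, s).
have badP n : bad (P n) by elim: n => [|n IH]; [exact: bad0|exact: Hf].
have P2 n : (P n).2 = s / 2 ^+ n.
  elim: n => [|n IH] /=; first by rewrite expr0 divr1.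
  by rewrite IH exprSr invfM mulrA.
have P20 n : 0 < (P n).2 by rewrite P2 divr_gt0 // exprn_gt0.
have bb (b : bool) (t : R) : 0 < t -> 0 <= b%:R * t <= t.
  by move=> t0; case: b; rewrite /= ?mul1r ?mul0r; lra.
have [x Hx] : exists x, forall n, Re (P n).1 <= x <= Re (P n).1 + (P n).2.
  apply: nested_intervals => n; first exact: ltW.
  have := bb (f (P n)).1 ((P n).2 / 2) ltac:(by rewrite divr_gt0).
  rewrite [P n.+1]/= /quarter !ReImE /=; lra.
have [y Hy] : exists y, forall n, Im (P n).1 <= y <= Im (P n).1 + (P n).2.
  apply: nested_intervals => n; first exact: ltW.
  have := bb (f (P n)).2 ((P n).2 / 2) ltac:(by rewrite divr_gt0).
  rewrite [P n.+1]/= /quarter !ReImE /=; lra.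
have inP n : in_square (P n).1 (P n).2 (x +i* y).
  by split=> /=; have := Hx n; have := Hy n; lra.
have [k hk ck] := dh _ (inP 0%N).
(* The perimeter is [4 s] and the distance to [z] at most [2 s], which accounts for the 8. *)
have [d d0 Hd] := ck (e / 8) ltac:(lra).
have [K HK] := @exp2_small (2 * s) d d0.
apply: (badP K); exists 0%N => n _.
set z := x +i* y in hk ck Hd inP.
have -> : square_sum n h (P K).1 (P K).2 =
  square_sum n (fun w => (k w - k z) * (w - z)) (P K).1 (P K).2.
  rewrite -[RHS]add0r -(square_sum_affine n (h z - k z * z) (k z) (P K).1 (P K).2).
  rewrite -square_sumD; congr square_sum; apply/funext => w.
  by rewrite [LHS]hk; ring.
have -> : e * (P K).2 ^+ 2 = 4 * (P K).2 * (e / 8 * (2 * (P K).2)) by field.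
apply: square_sum_bound => [|w [wK _]]; first exact: ltW.
have wz := in_square_dist (inP K) wK.
rewrite cabsM; apply: ler_pM; rewrite ?cabs_ge0 //.
by apply/ltW/Hd; apply: le_lt_trans wz _; rewrite P2 mulrA.
Qed.

End GoursatLemma.

(** * Cauchy's estimate at the centre of a square *)

Section MaximumPrinciple.
Variable R : realType.
Local Notation C := R[i].
Local Notation Re := (@complex.Re R).
Local Notation Im := (@complex.Im R).
Implicit Types (h k : C -> C) (a c d z w : C) (s e r m : R).

Lemma in_quarter c s b w : 0 < s ->
  in_square (quarter c (s / 2) b) (s / 2) w -> in_square c s w.
Proof.
move=> s0; have bb (b' : bool) : 0 <= b'%:R * (s / 2) <= s / 2.
  by case: b'; rewrite /= ?mul1r ?mul0r; lra.
have := bb b.1; have := bb b.2; rewrite /in_square /quarter !ReImE /=.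
by move=> b1 b2 [*]; split; lra.
Qed.

Lemma corner_in_quarter a s (b b' : bool * bool) : 0 < s ->
  in_square (quarter (quarter a (- s) b) (s / 2) b') (s / 2) a -> b' = b.
Proof.
move=> s0; have bb (c c' : bool) (x : R) :
    x + c%:R * - s + c'%:R * (s / 2) <= x ->
    x <= x + c%:R * - s + c'%:R * (s / 2) + s / 2 -> c' = c.
  by case: c; case: c' => //= *; exfalso; lra.
rewrite /in_square /quarter !ReImE /= ?addr0 ?add0r => -[h1 h2 h3 h4].
by rewrite [b]surjective_pairing [b']surjective_pairing (bb _ _ _ h1 h2) (bb _ _ _ h3 h4).
Qed.

(** Bisect [J] times towards the corner [a], where [k] is only bounded. At each level Goursat's
    lemma disposes of the three quarters away from [a], and the last square has a small
    perimeter. *)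
Lemma small_sum_corner k a (b : bool * bool) (K dl : R) : 0 <= K ->
  (forall w, cabs (w - a) < dl -> cabs (k w) <= K) ->
  forall J s e, 0 < s -> 2 * s / 2 ^+ J < dl -> 4 * s / 2 ^+ J * K < e ->
  (forall w, in_square (quarter a (- s) b) s w -> w <> a -> cdiff k w) ->
  small_sum k (quarter a (- s) b) s e.
Proof.
move=> K0 kK; elim=> [|J IH] s e s0; rewrite ?expr0 ?divr1 => sd se dk.
  exists 0%N => n _; apply: le_trans (ltW se).
  apply: square_sum_bound => [|w [ws _]]; first exact: ltW.
  apply: kK; apply: le_lt_trans sd; apply: in_square_dist ws.
  by rewrite /in_square /quarter !ReImE /=; case: (b) => -[] []; split=> /=; lra.
have qb : quarter (quarter a (- s) b) (s / 2) b = quarter a (- (s / 2)) b.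
  rewrite /quarter {1 2}(splitr s); set t := s / 2.
  by rewrite !(rmorphM, rmorphN, rmorphD) /=; ring.
have Jp : 0 < 2 ^+ J :> R by rewrite exprn_gt0.
have E2 t : t * (s / 2) / 2 ^+ J = t * s / 2 ^+ J.+1.
  by rewrite exprS invfM; ring.
(* [e1] lies strictly between the bound for the last square and [e]; the rest of [e] is shared by
   the other three quarters. *)
pose e1 := (4 * s / 2 ^+ J.+1 * K + e) / 2; pose e2 := (e - e1) / 3.
have e20 : 0 < e2 by rewrite /e2 /e1; lra.
pose g (b' : bool * bool) := if b' == b then e1 else e2.
have -> : e = g (false, false) + g (true, false) + g (false, true) + g (true, true).
  by rewrite /g; case: (b) => -[] []; rewrite /= /e2; lra.
apply: small_sum_split => b'; rewrite /g; case: eqP => [->|/eqP b'b].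
  rewrite qb; apply: IH; rewrite ?E2 //; first by rewrite divr_gt0.
    by rewrite /e1; lra.
  by move=> w ws; apply: dk; apply: (in_quarter (b := b) s0); rewrite qb.
have -> : e2 = (e2 / (s / 2) ^+ 2) * (s / 2) ^+ 2.
  by rewrite divfK // expf_neq0 // gt_eqF // divr_gt0.
apply: goursat; first by rewrite divr_gt0.
  by rewrite divr_gt0 // exprn_gt0 // divr_gt0.
move=> w ws; apply: dk; first exact: in_quarter ws.
by move=> wa; move: ws b'b; rewrite wa => /(corner_in_quarter s0) ->; rewrite eqxx.
Qed.

Lemma ReV (x y : R) : Re (x +i* y)^-1 = x / (x ^+ 2 + y ^+ 2).
Proof. by []. Qed.

Lemma ImV (x y : R) : Im (x +i* y)^-1 = - (y / (x ^+ 2 + y ^+ 2)).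
Proof. by []. Qed.

Lemma cplxE (x y : R) : x +i* y = x%:C + y%:C * 'i.
Proof. by rewrite [LHS]complexE mulrC. Qed.

(** The integral is [2 i pi]; the bound comes from each of the four edges contributing at least 1 to
    the imaginary part. On every edge the relevant part of the integrand is
    [r / (r ^ 2 + (t - r) ^ 2)], at least [1 / (2 r)], and the edge has length [2 r]. *)
Lemma square_sum_inv a r n : 0 < r ->
  4 <= cabs (square_sum n (fun w => (w - a)^-1) (a - r%:C - r%:C * 'i) (2 * r)).
Proof.
move=> r0; set c := a - _ - _.
have r2 : 0 <= 2 * r by lra.
have sq (t : R) : 0 <= t <= 2 * r -> (2 * r)^-1 <= r / (r ^+ 2 + (t - r) ^+ 2).
  move=> /andP[t0 tr]; rewrite ler_pdivlMr; last by have := mulr_gt0 r0 r0; nra.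
  rewrite mulrC ler_pdivrMr; last by lra.
  by have := mulr_ge0 t0 (y := 2 * r - t) ltac:(lra); nra.
have E1 : 2 * r * (2 * r)^-1 = 1 by rewrite divff // gt_eqF //; lra.
have B1 : 1 <= Re (- 'i * edge_sum 1 n (fun w => (w - a)^-1) c (2 * r)).
  rewrite -[leLHS]E1.
  apply: edge_sum_Re => // t tr.
  have -> : c + t%:C * 1 - a = (t - r) +i* (- r).
    by rewrite cplxE /c rmorphB rmorphN; ring.
  rewrite mulNr ReN ['i * _]mulrC complex.ReiNIm ImV !opprK mulNr opprK sqrrN [X in r / X]addrC; exact: sq.
have B2 : 1 <= Re (1 * edge_sum 'i n (fun w => (w - a)^-1) (c + (2 * r)%:C) (2 * r)).
  rewrite -[leLHS]E1.
  apply: edge_sum_Re => // t tr.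
  have -> : c + (2 * r)%:C + t%:C * 'i - a = r +i* (t - r).
    by rewrite cplxE /c rmorphB rmorphM rmorph_nat; ring.
  by rewrite mul1r ReV; exact: sq.
have B3 : 1 <= Re ('i * edge_sum 1 n (fun w => (w - a)^-1) (c + (2 * r)%:C * 'i) (2 * r)).
  rewrite -[leLHS]E1.
  apply: edge_sum_Re => // t tr.
  have -> : c + (2 * r)%:C * 'i + t%:C * 1 - a = (t - r) +i* r.
    by rewrite cplxE /c rmorphB rmorphM rmorph_nat; ring.
  rewrite ['i * _]mulrC complex.ReiNIm ImV opprK addrC; exact: sq.
have B4 : 1 <= Re (-1 * edge_sum 'i n (fun w => (w - a)^-1) c (2 * r)).
  rewrite -[leLHS]E1.
  apply: edge_sum_Re => // t tr.
  have -> : c + t%:C * 'i - a = (- r) +i* (t - r).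
    by rewrite cplxE /c rmorphB rmorphN; ring.
  by rewrite mulN1r ReN ReV mulNr opprK sqrrN; exact: sq.
have := cabs_Re (- 'i * square_sum n (fun w => (w - a)^-1) c (2 * r)).
rewrite cabsM cabsN cabsi mul1r; apply: le_trans.
apply: le_trans (ler_norm _).
have ii : 'i * 'i = -1 :> C by rewrite -expr2 sqr_i.
rewrite /square_sum; move: B1 B2 B3 B4.
set e1 := edge_sum _ _ _ _ _; set e2 := edge_sum _ _ _ _ _.
set e3 := edge_sum _ _ _ _ _; set e4 := edge_sum _ _ _ _ _ => b1 b2 b3 b4.
have -> : - 'i * (e1 + 'i * e2 - e3 - 'i * e4) = - 'i * e1 + 1 * e2 + 'i * e3 + -1 * e4.
  by ring: ii.
by rewrite !ReD; lra.
Qed.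

(** Cauchy's formula: the sums of [h w / (w - a)] and of [h a / (w - a)] differ by sums of the
    difference quotient, which become arbitrarily small. The former are at most [8 m], and the sums
    of [1 / (w - a)] at least 4, hence the factor 2. *)
Lemma center_bound h a r m : 0 < r ->
  (forall w, in_square (a - r%:C - r%:C * 'i) (2 * r) w -> cdiff h w) ->
  (forall w, on_square (a - r%:C - r%:C * 'i) (2 * r) w -> cabs (h w) <= m) ->
  cabs (h a) <= 2 * m.
Proof.
move=> r0; set c := a - _ - _ => dh hm.
pose k w := (h w - h a) / (w - a).
have ain : in_square c (2 * r) a by rewrite /in_square /c !ReImE /=; split; lra.
have [l hl cl] := dh _ ain.
have [dl dl0 Hl] := ccont_bounded cl.
have kb w : cabs (w - a) < dl -> cabs (k w) <= cabs (l a) + 1.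
  move=> /Hl lw; rewrite /k; have [->|wa] := eqVneq w a.
    by rewrite subrr mul0r cabs0; have := cabs_ge0 (l a); lra.
  rewrite (hl w) [h a + _]addrC addrK mulfK ?subr_eq0 //; exact: ltW.
have K0 : 0 <= cabs (l a) + 1 by have := cabs_ge0 (l a); lra.
have ksmall e : 0 < e -> small_sum k c (2 * r) e.
  move=> e0.
  have -> : e = e / 4 + e / 4 + e / 4 + e / 4 by field.
  (* The four quarters meet at [a], the only point where [k] may fail to be differentiable. *)
  apply: (@small_sum_split _ k c (2 * r) (fun=> e / 4)) => b.
  have r2 : 2 * r / 2 = r by field.
  have qb : quarter c r b = quarter a (- r) (~~ b.1, ~~ b.2).
    by rewrite /quarter /c; case: b => -[] [] /=; rewrite ?mul1r ?mul0r ?rmorph0 ?rmorphN /=; ring.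
  rewrite r2 qb.
  have [J1 HJ1] := exp2_small (2 * r) dl0.
  have [J2 HJ2] := exp2_small (4 * r * (cabs (l a) + 1)) (e := e / 4) ltac:(lra).
  have p2 i j : 0 < i -> i / 2 ^+ (j + J2) <= i / 2 ^+ J2 :> R.
    move=> i0; rewrite ler_pM2l // lef_pV2 ?posrE ?exprn_gt0 //.
    by rewrite ler_weXn2l ?ler1n // leq_addl.
  have p1 i j : 0 < i -> i / 2 ^+ (J1 + j) <= i / 2 ^+ J1 :> R.
    move=> i0; rewrite ler_pM2l // lef_pV2 ?posrE ?exprn_gt0 //.
    by rewrite ler_weXn2l ?ler1n // leq_addr.
  apply: (small_sum_corner K0 kb (J := (J1 + J2)%N)) => //.
  - by apply: le_lt_trans HJ1; apply: p1; lra.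
  - rewrite mulrAC; apply: le_lt_trans HJ2; apply: p2.
    by have := cabs_ge0 (l a) => ?; rewrite mulr_gt0 //; lra.
  move=> w ws wa; rewrite /k; apply: cdiffM.
    apply: cdiffB (cdiff_cst _ _); apply: dh; apply: (in_quarter (b := b)).
      lra.
    by rewrite r2 qb.
  apply: cdiffV; first by rewrite subr_eq0; apply/eqP.
  exact: cdiffB (cdiff_id _) (cdiff_cst _ _).
apply/ler_addgt0Pr => e e0.
have [N /(_ N (leqnn N)) HN] := ksmall e e0.
have G4 := square_sum_inv a N r0; rewrite -/c in G4.
have Hb : cabs (square_sum N (fun w => h w / (w - a)) c (2 * r)) <= 4 * (2 * r) * (m / r).
  apply: square_sum_bound => [|w wb]; first by lra.
  have rw : r <= cabs (w - a).
    have [_] := wb; rewrite /c !ReImE /= => wb'.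
    have := cabs_Re (w - a); have := cabs_Im (w - a); rewrite !ReImE.
    have := ler_norm (Re w - Re a); have := ler_norm (- (Re w - Re a)).
    have := ler_norm (Im w - Im a); have := ler_norm (- (Im w - Im a)).
    by rewrite !normrN; case: wb' => ->; lra.
  rewrite cabsM cabsV; apply: ler_pM; rewrite ?invr_ge0 ?cabs_ge0 //; first exact: hm.
  by rewrite lef_pV2 ?posrE //; lra.
have E : h a * square_sum N (fun w => (w - a)^-1) c (2 * r) =
   square_sum N (fun w => h w / (w - a)) c (2 * r) - square_sum N k c (2 * r).
  rewrite -square_sumZ -[square_sum N k _ _]mul1r -mulNr -square_sumZ -square_sumD.
  by congr square_sum; apply/funext => w; rewrite /k; ring.
have := cabsD (square_sum N (fun w => h w / (w - a)) c (2 * r)) (- square_sum N k c (2 * r)).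
rewrite -E cabsN cabsM => E2.
have E3 : 4 * (2 * r) * (m / r) = 8 * m by field; lra.
have := cabs_ge0 (h a); nra.
Qed.

End MaximumPrinciple.

(** * The maximum principle with exceptional points, and Liouville's theorem *)

Section MaximumModulus.
Variable R : realType.
Local Notation C := R[i].
Implicit Types (h k : C -> C) (a c d z w u : C) (s r m : R) (E : seq C).

(** Nothing is asked at [a] itself: this is the condition on a removable singularity. *)
Definition lbounded h a := exists2 d : R, 0 < d &
  exists K : R, forall w, 0 < cabs (w - a) < d -> cabs (h w) <= K.

Lemma lboundedM h k a : lbounded h a -> lbounded k a ->
  lbounded (fun w => h w * k w) a.
Proof.
move=> [d d0 [K HK]] [d' d'0 [K' HK']].
exists (Num.min d d'); first by rewrite lt_min d0.
exists (K * K') => w; rewrite lt_min => /and3P[w0 wd wd'].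
rewrite cabsM; apply: ler_pM; rewrite ?cabs_ge0 //.
  by apply: HK; rewrite w0.
by apply: HK'; rewrite w0.
Qed.

Lemma lboundedD h k a : lbounded h a -> lbounded k a ->
  lbounded (fun w => h w + k w) a.
Proof.
move=> [d d0 [K HK]] [d' d'0 [K' HK']].
exists (Num.min d d'); first by rewrite lt_min d0.
exists (K + K') => w; rewrite lt_min => /and3P[w0 wd wd'].
apply: le_trans (cabsD _ _) _; apply: lerD.
  by apply: HK; rewrite w0.
by apply: HK'; rewrite w0.
Qed.

Lemma ccont_lbounded h a : ccont h a -> lbounded h a.
Proof.
move=> /ccont_bounded[d d0 H]; exists d => //; exists (cabs (h a) + 1).
by move=> w /andP[_ /H /ltW].
Qed.

Lemma lboundedX h a n : lbounded h a -> lbounded (fun w => h w ^+ n) a.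
Proof.
move=> hb; elim: n => [|n IH].
  by under eq_fun do rewrite expr0; exact/ccont_lbounded/ccont_cst.
by under eq_fun do rewrite exprS; exact: lboundedM.
Qed.

(** Riemann's device: a factor [(w - a) ^ 2] turns a bounded singularity into a point of
    differentiability, with derivative 0. *)
Lemma cdiff_mul_lbounded h a : lbounded h a ->
  cdiff (fun w => h w * (w - a) ^+ 2) a.
Proof.
move=> [d d0 [K HK]]; exists (fun w => h w * (w - a)) => [w|].
  by rewrite subrr expr0n mulr0 add0r expr2 mulrA.
move=> e e0; rewrite subrr mulr0.
have K1 : 0 < `|K| + 1 by rewrite ltr_wpDl.
exists (Num.min d (e / (`|K| + 1))); first by rewrite lt_min d0 divr_gt0.
move=> w; rewrite lt_min subr0 => /andP[wd we].
have [->|wa] := eqVneq w a; first by rewrite subrr mulr0 cabs0.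
have hw : cabs (h w) <= `|K|.
  by apply: le_trans (ler_norm _); apply: HK; rewrite cabs_gt0 subr_eq0 wa.
rewrite cabsM; move: we; rewrite ltr_pdivlMr // => we.
have : 0 < cabs (w - a) by rewrite cabs_gt0 subr_eq0.
by nra.
Qed.

(** If [m < x], Bernoulli's inequality lets [(x / m) ^ N] exceed every constant. Applied to [N]-th
    powers, this removes a multiplicative constant from an estimate. *)
Lemma pow_growth (x m c B : R) : 0 <= x -> 0 <= m -> 0 < c ->
  (forall N, x ^+ N * c <= B * m ^+ N) -> x <= m.
Proof.
move=> x0 m0 c0 H; rewrite leNgt; apply/negP => mx.
have [m0'|m0'] := eqVneq m 0.
  have := H 1%N; rewrite !expr1 m0' mulr0 => h.
  have : 0 < x * c by rewrite mulr_gt0 // -m0'. 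
  lra.
have mp : 0 < m by rewrite lt_neqAle eq_sym m0'.
have bern N : N%:R * (x - m) * m ^+ N <= x ^+ N * m.
  elim: N => [|N IH]; first by rewrite mul0r mul0r expr0 mul1r.
  rewrite !exprS -natr1.
  have xN : m ^+ N <= x ^+ N by rewrite lerXn2r // ltW.
  have mN : 0 <= m ^+ N by rewrite exprn_ge0.
  have A : 0 <= m * (x ^+ N * m - N%:R * (x - m) * m ^+ N) by rewrite mulr_ge0 // subr_ge0.
  have B' : 0 <= (x - m) * m * (x ^+ N - m ^+ N).
    by rewrite !mulr_ge0 // subr_ge0 // ltW.
  by nra.
have H0 : 0 <= `|B| * m / c / (x - m).
  by rewrite !mulr_ge0 ?invr_ge0 ?subr_ge0 // ltW.
have := archi_boundP H0.
set M := Num.bound _.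
rewrite ltr_pdivrMr ?subr_gt0 // ltr_pdivrMr // => HM.
have mM : 0 < m ^+ M by rewrite exprn_gt0.
have h1 := bern M; have h2 := H M.
have B1 := ler_norm B.
have : x ^+ M * c * m <= B * m ^+ M * m by rewrite ler_pM2r.
have : M%:R * (x - m) * m ^+ M * c <= x ^+ M * m * c by rewrite ler_pM2r.
have : `|B| * m * m ^+ M < M%:R * (x - m) * c * m ^+ M by rewrite ltr_pM2r.
have : B * (m ^+ M * m) <= `|B| * (m ^+ M * m) by rewrite ler_pM2r // mulr_gt0.
lra.
Qed.

(* The bound on the centre holds up to a factor 2; it is removed by applying it
   to [h ^ N] times a polynomial vanishing doubly on [E], and letting N grow. *)
Lemma max_modulus h a r m E : 0 < r -> 0 <= m -> a \notin E ->
  (forall w, cabs (w - a) <= 2 * r -> w \notin E -> cdiff h w) ->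
  (forall e, e \in E -> lbounded h e) ->
  (forall w, r <= cabs (w - a) <= 2 * r -> w \notin E -> cabs (h w) <= m) ->
  cabs (h a) <= m.
Proof.
move=> r0 m0 aE dh bh hm.
pose p w := \prod_(e <- E) (w - e) ^+ 2.
have pa : p a != 0.
  rewrite /p prodf_seq_neq0; apply/allP => e eE /=.
  by rewrite expf_neq0 // subr_eq0; apply: contraNneq aE => ->.
pose B := \prod_(e <- E) (2 * r + cabs (a - e)) ^+ 2.
have pB w : cabs (w - a) <= 2 * r -> cabs (p w) <= B.
  move=> wr; rewrite cabs_prod; apply: ler_prod => e _.
  rewrite cabs_ge0 cabsX lerXn2r ?nnegrE ?cabs_ge0 //.
    by have := cabs_ge0 (a - e); lra.
  by have := cabs_triangle w a e; lra.
have p0 w : w \in E -> p w = 0.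
  move=> wE; apply/eqP; rewrite prodf_seq_eq0; apply/hasP; exists w => //=.
  by rewrite subrr expr0n.
apply: (@pow_growth _ _ (cabs (p a)) (2 * B)); rewrite ?cabs_ge0 ?cabs_gt0 //.
move=> N; rewrite -cabsX -cabsM -mulrA.
(* The square lies in the disc of radius [2 r], and its boundary outside the open disc of radius
   [r], hence in the ring where [h] is bounded by [m]. *)
have sq w : in_square (a - r%:C - r%:C * 'i) (2 * r) w -> cabs (w - a) <= 2 * r.
  rewrite /in_square !ReImE /= => -[h1 h2 h3 h4].
  apply: le_trans (cabs_ReIm _) _; rewrite !ReImE.
  have : `|complex.Re w - complex.Re a| <= r by rewrite ler_norml; apply/andP; split; lra.
  have : `|complex.Im w - complex.Im a| <= r by rewrite ler_norml; apply/andP; split; lra.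
  lra.
have dp w : cdiff p w.
  rewrite /p; elim: (E) => [|e E' IH].
    by under eq_fun do rewrite big_nil; exact: cdiff_cst.
  under eq_fun do rewrite big_cons; apply: cdiffM IH.
  by apply: cdiffX; exact: cdiffB (cdiff_id _) (cdiff_cst _ _).
have cp w : ccont p w by exact: cdiff_cont.
apply: (center_bound (h := fun w => h w ^+ N * p w) r0) => w.
  move=> /sq wr; have [wE|wE] := boolP (w \in E); last first.
    by apply: cdiffM (dp _); apply: cdiffX; exact: dh.
  pose p' u := \prod_(e <- rem w E) (u - e) ^+ 2.
  have -> : (fun u => h u ^+ N * p u) = (fun u => (h u ^+ N * p' u) * (u - w) ^+ 2).
    by apply/funext => u; rewrite /p (big_rem _ wE) /= mulrA mulrAC -mulrA.
  apply: cdiff_mul_lbounded; apply: lboundedM.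
    by apply: lboundedX; exact: bh.
  apply: ccont_lbounded; rewrite /p'; elim: (rem w E) => [|e E' IH].
    by under eq_fun do rewrite big_nil; exact: ccont_cst.
  under eq_fun do rewrite big_cons; apply: ccontM IH.
  apply/ccontX/cdiff_cont; exact: cdiffB (cdiff_id _) (cdiff_cst _ _).
move=> [/[dup] wsq /sq wr wb].
have rw : r <= cabs (w - a).
  move: wb; rewrite !ReImE /= => wb.
  have := cabs_Re (w - a); have := cabs_Im (w - a); rewrite !ReImE.
  have := ler_norm (complex.Re w - complex.Re a).
  have := ler_norm (- (complex.Re w - complex.Re a)).
  have := ler_norm (complex.Im w - complex.Im a).
  have := ler_norm (- (complex.Im w - complex.Im a)).
  by rewrite !normrN; case: wb => ->; lra.
have [wE|wE] := boolP (w \in E).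
  rewrite p0 // mulr0 cabs0 mulr_ge0 ?exprn_ge0 //.
  exact: le_trans (cabs_ge0 _) (pB _ wr).
rewrite cabsM cabsX mulrC; apply: ler_pM; rewrite ?exprn_ge0 ?cabs_ge0 //.
  exact: pB.
by apply: lerXn2r; rewrite ?nnegrE ?cabs_ge0 //; apply: hm; rewrite ?rw.
Qed.

(** The maximum principle for the difference quotient of [h] at [w], with [w] as a further
    exceptional point, on the ring of radii [3 r] and [6 r] about [z]. There [u] is at distance at
    least [r] from [w] and at most [7 r] from [a]. *)
Lemma lipschitz_of_bounded h a r m E : 0 < r -> 0 <= m ->
  (forall w, cabs (w - a) <= 8 * r -> w \notin E -> cdiff h w) ->
  (forall e, e \in E -> lbounded h e) ->
  (forall w, cabs (w - a) <= 8 * r -> w \notin E -> cabs (h w) <= m) ->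
  forall z w, cabs (z - a) <= r -> z \notin E -> cabs (w - a) <= r -> w \notin E ->
  cabs (h z - h w) <= 2 * m / r * cabs (z - w).
Proof.
move=> r0 m0 dh bh hm z w zr zE wr wE.
have [->|zw] := eqVneq z w; first by rewrite subrr cabs0 mulr_ge0 ?divr_ge0 ?cabs_ge0 ?mulr_ge0 // ltW.
pose q u := (h u - h w) / (u - w).
have dhw : cdiff h w by apply: dh => //; lra.
have : cabs (q z) <= 2 * m / r.
  apply: (@max_modulus _ _ (3 * r) _ (w :: E)); first by lra.
  - by rewrite divr_ge0 ?mulr_ge0 // ltW.
  - by rewrite inE negb_or zw.
  - move=> u uz; rewrite inE negb_or => /andP[uw uE].
    apply: cdiffM.
      apply: cdiffB (cdiff_cst _ _); apply: dh => //.
      by have := cabs_triangle u z a; lra.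
    apply: cdiffV; first by rewrite subr_eq0.
    exact: cdiffB (cdiff_id _) (cdiff_cst _ _).
  - move=> e; rewrite inE; have [->|ew] := eqVneq e w => /= [_|eE].
      case: dhw => k hk /ccont_bounded[d d0 Hd].
      exists d => //; exists (cabs (k w) + 1) => u /andP[u0 /Hd ud].
      rewrite /q (hk u) [h w + _]addrC addrK mulfK ?ltW //.
      by rewrite -cabs_gt0.
    apply: lboundedM.
      by apply: lboundedD; [exact: bh|exact/ccont_lbounded/ccont_cst].
    apply/ccont_lbounded/cdiff_cont/cdiffV; first by rewrite subr_eq0.
    exact: cdiffB (cdiff_id _) (cdiff_cst _ _).
  - move=> u /andP[u1 u2]; rewrite inE negb_or => /andP[uw uE].
    rewrite cabsM cabsV; apply: ler_pM; rewrite ?invr_ge0 ?cabs_ge0 //.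
      apply: le_trans (cabsD _ _) _; rewrite cabsN mulr2n mulrDl mul1r.
      apply: lerD; apply: hm => //; last by lra.
      by have := cabs_triangle u z a; lra.
    rewrite lef_pV2 ?posrE ?cabs_gt0 ?subr_eq0 //.
    have := cabs_triangle u w z; have := cabs_triangle w a z.
    by rewrite (cabsBC a z); lra.
rewrite /q cabsM cabsV ler_pdivrMr // cabs_gt0 subr_eq0 //.
Qed.

Lemma small_pos_le0 (x A : R) : (forall e, 0 < e -> x <= A * e) -> x <= 0.
Proof.
move=> H; rewrite leNgt; apply/negP => x0.
have A0 : 0 < `|A| + 1 by rewrite ltr_wpDl.
have := H (x / 2 / (`|A| + 1)) ltac:(by rewrite !divr_gt0).
have := ler_norm A.
have : x / 2 / (`|A| + 1) * (`|A| + 1) = x / 2 by rewrite divfK // gt_eqF.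
have : 0 < x / 2 / (`|A| + 1) by rewrite !divr_gt0.
set y := x / 2 / _; nra.
Qed.

(** The maximum principle on large rings carries the bound near infinity to all points off [E]; the
    Lipschitz constant [2 m / r] then tends to 0 as [r] grows. *)
Lemma liouville h (rho m : R) E : 0 <= m ->
  (forall w, w \notin E -> cdiff h w) ->
  (forall e, e \in E -> lbounded h e) ->
  (forall w, rho <= cabs w -> w \notin E -> cabs (h w) <= m) ->
  forall z w, z \notin E -> w \notin E -> h z = h w.
Proof.
move=> m0 dh bh hm z w zE wE.
have hbd u : u \notin E -> cabs (h u) <= m.
  move=> uE; apply: (@max_modulus h u (`|rho| + cabs u + 1) m E) => //.
  - by have := cabs_ge0 u; have := normr_ge0 rho; lra.
  - by move=> v _; exact: dh.
  move=> v /andP[uv _]; apply: hm.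
  have := cabsD (v - u) u; have := cabs_lowerB v u.
  have := cabs_triangle v 0 u; rewrite !(subr0, sub0r) cabsN.
  by have := ler_norm rho; lra.
apply/eqP; rewrite -subr_eq0 -cabs_eq0 eq_le cabs_ge0 andbT.
apply: (@small_pos_le0 _ (2 * m * cabs (z - w))) => e e0.
pose r := e^-1 + cabs (z - w).
have e1 : 0 < e^-1 by rewrite invr_gt0.
have r0 : 0 < r by rewrite /r; have := cabs_ge0 (z - w); lra.
have := @lipschitz_of_bounded h w r m E r0 m0 _ bh _ z w.
move=> /(_ _ _ _ _ _ _)/wrap[||||||].
- by move=> u _; exact: dh.
- by move=> u _; exact: hbd.
- by rewrite /r; lra.
- by [].
- by rewrite subrr cabs0 ltW.
- by [].
move=> /le_trans; apply.
rewrite mulrAC; apply: ler_wpM2l; first by rewrite !mulr_ge0 ?cabs_ge0.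
by rewrite -[leRHS]invrK lef_pV2 ?posrE // /r lerDl cabs_ge0.
Qed.

End MaximumModulus.

(** * Removable singularities, Taylor expansions and isolated zeros *)

Section TaylorExpansion.
Variable R : realType.
Local Notation C := R[i].
Implicit Types (h : C -> C) (a z w u : C) (r m d : R).

Definition holo_punctured h a r m :=
  forall w, 0 < cabs (w - a) <= r -> cdiff h w /\ cabs (h w) <= m.

Lemma holo_punctured_lip h a r m : 0 < r -> 0 <= m -> holo_punctured h a r m ->
  forall z w, 0 < cabs (z - a) <= r / 8 -> 0 < cabs (w - a) <= r / 8 ->
  cabs (h z - h w) <= 16 * m / r * cabs (z - w).
Proof.
move=> r0 m0 H z w /andP[z0 zr] /andP[w0 wr].
have -> : 16 * m / r = 2 * m / (r / 8) by field; lra.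
have nin u : (u \notin [:: a]) = (0 < cabs (u - a)).
  by rewrite inE cabs_gt0 subr_eq0.
have E8 : 8 * (r / 8) = r by field.
apply: (@lipschitz_of_bounded _ h a (r / 8) m [:: a]); rewrite ?nin //.
- lra.
- by move=> u; rewrite E8 nin => ur u0; apply: (H u _).1; rewrite u0.
- move=> e; rewrite inE => /eqP ->; exists r => //; exists m => u /andP[u0 ur].
  by apply: (H u _).2; rewrite u0 ltW.
- by move=> u; rewrite E8 nin => ur u0; apply: (H u _).2; rewrite u0.
Qed.

Lemma cabs_ReIm_le (z : C) (x : R) :
  `|complex.Re z| <= x -> `|complex.Im z| <= x -> cabs z <= 2 * x.
Proof. by have := cabs_ReIm z; lra. Qed.

(** The Lipschitz bound makes the values at [a + r0 / 8 / 2 ^ n] converge to [l]. As [l] is chosen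
    before [r] and [m], it serves at every radius; the 3 comes from [m] plus [16 m / r] times
    [r / 8]. *)
Lemma removable h a r0 m0 : 0 < r0 -> 0 <= m0 -> holo_punctured h a r0 m0 ->
  exists l, forall r m, 0 < r -> 0 <= m -> holo_punctured h a r m ->
    (forall w, 0 < cabs (w - a) <= r / 8 ->
      cabs (h w - l) <= 16 * m / r * cabs (w - a)) /\ cabs l <= 3 * m.
Proof.
move=> r00 m00 H0.
have [L LE] : exists L, L = 16 * m0 / r0 by exists (16 * m0 / r0).
have L0 : 0 <= L by rewrite LE divr_ge0 ?mulr_ge0 // ltW.
pose s n : R := r0 / 8 / 2 ^+ n.
have s0 n : 0 < s n by rewrite !divr_gt0 // exprn_gt0.
have sS n : s n = s n.+1 + s n.+1.
  by rewrite /s exprSr invfM mulrA -splitr.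
have s1 n : s n <= r0 / 8.
  elim: n => [|n IH]; first by rewrite /s expr0 divr1.
  by have := sS n; have := s0 n.+1; lra.
pose zs n := a + (s n)%:C.
have zsa n : cabs (zs n - a) = s n by rewrite /zs addrC addKr cabsR gtr0_norm.
have step n : cabs (h (zs n.+1) - h (zs n)) <= L * s n.+1.
  apply: le_trans (holo_punctured_lip r00 m00 H0 _ _) _; rewrite ?zsa ?s0 ?s1 //.
  have -> : zs n.+1 - zs n = - (s n.+1)%:C by rewrite /zs (sS n) rmorphD /=; ring.
  by rewrite cabsN cabsR gtr0_norm // -LE.
have nest (p : C -> R) : (forall z w, p (z - w) = p z - p w) ->
    (forall z, `|p z| <= cabs z) ->
    exists x, forall n, `|p (h (zs n)) - x| <= L * s n.
  move=> pB pc.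
  have [||x Hx] := @nested_intervals R (fun n => p (h (zs n)) - L * s n)
      (fun n => 2 * (L * s n)).
  - by move=> n /=; apply: mulr_ge0 => //; apply: mulr_ge0 => //; exact: ltW.
  - move=> n /=; have := le_trans (pc _) (step n); rewrite pB ler_norml => /andP[p1 p2].
    by rewrite (sS n); split; lra.
  by exists x => n; have := Hx n; rewrite ler_norml => /andP[? ?]; apply/andP; split; lra.
have [x Hx] := nest (@complex.Re R) (fun z w => raddfB (@complex.Re R) z w) (@cabs_Re R).
have [y Hy] := nest (@complex.Im R) (fun z w => raddfB (@complex.Im R) z w) (@cabs_Im R).
have lim n : cabs (h (zs n) - (x +i* y)) <= 2 * (L * s n).
  apply: cabs_ReIm_le; first by have := Hx n; rewrite raddfB.
  by have := Hy n; rewrite raddfB.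
have small e : 0 < e -> exists n, s n < e.
  by move=> e0; have [n] := exp2_small (r0 / 8) e0; exists n.
exists (x +i* y) => r m rp mp H.
have key w : 0 < cabs (w - a) <= r / 8 ->
    cabs (h w - (x +i* y)) <= 16 * m / r * cabs (w - a).
  move=> wr; rewrite -subr_le0.
  pose L' := 16 * m / r; have L'0 : 0 <= L' by rewrite divr_ge0 ?mulr_ge0 // ltW.
  apply: (@small_pos_le0 _ _ (L' + 2 * L)) => e e0.
  have [n Hn] := small (Num.min e (r / 8)) ltac:(by rewrite lt_min e0 divr_gt0).
  move: Hn; rewrite lt_min => /andP[ne nr].
  have h1 := holo_punctured_lip rp mp H wr (w := zs n).
  move: h1; rewrite zsa s0 (ltW nr) => /(_ isT) h1.
  have h2 := lim n; have h3 := cabs_triangle (h w) (h (zs n)) (x +i* y).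
  have h4 := cabs_triangle w a (zs n).
  rewrite (cabsBC a) zsa in h4.
  have h5 : L' * cabs (w - zs n) <= L' * (cabs (w - a) + s n) by apply: ler_wpM2l.
  have h6 : (L' + 2 * L) * s n <= (L' + 2 * L) * e.
    by apply: ler_wpM2l (ltW ne); lra.
  by rewrite -/L' in h1 *; lra.
split=> //.
pose w := a + (r / 8)%:C.
have wa : cabs (w - a) = r / 8 by rewrite /w addrC addKr cabsR gtr0_norm //; lra.
have := key w; rewrite wa lexx divr_gt0 // => /(_ isT) k1.
have := (H w) ltac:(by rewrite wa divr_gt0 //=; lra) => -[_ k2].
have -> : (3 * m) = m + 16 * m / r * (r / 8) by field; lra.
have := cabs_triangle (x +i* y) (h w) 0; rewrite !subr0 cabsBC; lra.
Qed.

(** Induction through the divided difference [(h w - l) / (w - a)], each step dividing the radius by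
    8. The factor [A] depends on [N] only and the coefficients are chosen before [r] and [m], so
    that one expansion satisfies Cauchy's estimates at all radii. *)
Lemma taylor N : exists2 A : R, 0 <= A & forall h a r0 m0,
  0 < r0 -> 0 <= m0 -> holo_punctured h a r0 m0 ->
  exists c : nat -> C,
  (forall r m, 0 < r -> 0 <= m -> holo_punctured h a r m ->
        forall j, (j < N)%N -> cabs (c j) * r ^+ j <= A * m) /\
  (exists2 d : R, 0 < d & exists M : R, forall w, 0 < cabs (w - a) <= d ->
        cabs (h w - \sum_(j < N) c j * (w - a) ^+ j) <= M * cabs (w - a) ^+ N).
Proof.
elim: N => [|N [A A0 IH]].
  exists 0 => // h a r0 m0 r00 m00 H0; exists (fun=> 0); split=> //.
  exists r0 => //; exists m0 => w /H0[_].
  by rewrite big_ord0 subr0 expr0 mulr1.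
(* 3 serves the constant term; 16 comes from the bound on the divided difference and [8 ^ N] from
   the smaller radius. *)
exists (3 + 8 ^+ N * (16 * A)).
  by rewrite addr_ge0 // !mulr_ge0 // exprn_ge0.
move=> h a r0 m0 r00 m00 H0.
have [l Hl] := removable r00 m00 H0.
pose h1 w := (h w - l) / (w - a).
have H1 r m : 0 < r -> 0 <= m -> holo_punctured h a r m ->
    holo_punctured h1 a (r / 8) (16 * m / r).
  move=> rp mp H w wr; have [h1b _] := Hl r m rp mp H.
  have /andP[w0 w8] := wr; split.
    apply: cdiffM.
      apply: cdiffB (cdiff_cst _ _); apply: (H w _).1; rewrite w0; lra.
    apply: cdiffV; first by rewrite -cabs_gt0.
    exact: cdiffB (cdiff_id _) (cdiff_cst _ _).
  by rewrite cabsM cabsV ler_pdivrMr //; exact: h1b.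
have [|||c [Hc [d d0 [M HM]]]] := IH h1 a (r0 / 8) (16 * m0 / r0).
- by rewrite divr_gt0.
- by rewrite divr_ge0 ?mulr_ge0 // ltW.
- exact: H1.
exists (fun j => if j is j'.+1 then c j' else l); split.
  move=> r m rp mp H [_|j]; rewrite ?ltnS.
    have [_ l3] := Hl r m rp mp H; rewrite expr0 mulr1.
    have : 0 <= 8 ^+ N * (16 * A) * m by rewrite !mulr_ge0 // exprn_ge0.
    by lra.
  move=> jN; have := Hc _ _ _ _ (H1 r m rp mp H) j jN.
  move=> /(_ _ _)/wrap[||]; rewrite ?divr_gt0 ?divr_ge0 ?mulr_ge0 ?(ltW rp) //.
  have -> : cabs (c j) * (r / 8) ^+ j = cabs (c j) * r ^+ j / 8 ^+ j.
    by rewrite expr_div_n mulrA.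
  rewrite ler_pdivrMr ?exprn_gt0 // => le8.
  have e8 : 8 ^+ j <= 8 ^+ N :> R by apply: ler_weXn2l; [lra|exact: ltnW].
  have : A * (16 * m / r) * 8 ^+ j * r <= A * (16 * m / r) * 8 ^+ N * r.
    rewrite ler_wpM2r ?(ltW rp) // ler_wpM2l //.
    by rewrite !mulr_ge0 // ?invr_ge0 ltW.
  have -> : A * (16 * m / r) * 8 ^+ N * r = 8 ^+ N * (16 * A) * m by field; lra.
  have : cabs (c j) * r ^+ j * r <= A * (16 * m / r) * 8 ^+ j * r by rewrite ler_pM2r.
  rewrite exprS; lra.
exists d => //; exists M => w wd; have HMw := HM w wd.
have w0 : 0 < cabs (w - a) by case/andP: wd.
rewrite big_ord_recl expr0 mulr1.
under eq_bigr do rewrite lift0 exprS mulrCA.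
rewrite -mulr_sumr exprS mulrCA.
have -> : h w - (l + (w - a) * \sum_(i < N) c i * (w - a) ^+ i)
  = (w - a) * (h1 w - \sum_(i < N) c i * (w - a) ^+ i).
  rewrite /h1 mulrBr mulrCA mulfV ?mulr1 ?opprD ?addrA //.
  by rewrite -cabs_gt0.
by rewrite cabsM; apply: ler_wpM2l => //; exact: cabs_ge0.
Qed.

Lemma lbounded_holo h a r : 0 < r ->
  (forall w, 0 < cabs (w - a) <= r -> cdiff h w) -> lbounded h a ->
  exists r' m, [/\ 0 < r', r' <= r, 0 <= m & holo_punctured h a r' m].
Proof.
move=> r0 dh [d d0 [K HK]]; exists (Num.min r (d / 2)), `|K|; split=> //.
- by rewrite lt_min r0 divr_gt0.
- by rewrite ge_min lexx.
move=> w /andP[w0]; rewrite le_min => /andP[wr wd]; split.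
  by apply: dh; rewrite w0.
by apply: le_trans (ler_norm _); apply: HK; rewrite w0 /=; lra.
Qed.

(* Otherwise [h / (z - a) ^ k] is bounded for every [k], and the maximum
   principle makes [h] smaller than every power of [2]. *)
Lemma isolated_zeros h a r m : 0 < r -> 0 <= m -> holo_punctured h a r m ->
  (exists2 d : R, 0 < d & forall w, 0 < cabs (w - a) < d -> h w = 0) \/
  (exists2 d : R, 0 < d & forall w, 0 < cabs (w - a) < d -> h w != 0).
Proof.
move=> r0 m0 H; have [iso|acc] := pselect
  (exists2 d : R, 0 < d & forall w, 0 < cabs (w - a) < d -> h w != 0); [by right|left].
have {}acc d : 0 < d -> exists2 w, 0 < cabs (w - a) < d & h w = 0.
  move=> d0; apply: contrapT => nz; apply: acc; exists d => // w wd.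
  by apply/eqP => hw; apply: nz; exists w.
pose q k w := h w / (w - a) ^+ k.
have dq k w : 0 < cabs (w - a) <= r -> cdiff (q k) w.
  move=> wr; apply: cdiffM; first exact: (H w wr).1.
  apply: cdiffV.
    by apply: expf_neq0; rewrite -cabs_gt0; case/andP: wr.
  by apply: cdiffX; exact: cdiffB (cdiff_id _) (cdiff_cst _ _).
have bq k : lbounded (q k) a.
  elim: k => [|k IH].
    exists r => //; exists m => w /andP[w0 wr]; rewrite /q expr0 divr1.
    by apply: (H w _).2; rewrite w0 ltW.
  have [r' [m' [r'0 r'r m'0 H']]] := lbounded_holo r0 (dq k) IH.
  have [l Hl] := removable r'0 m'0 H'.
  have [Hl1 _] := Hl _ _ r'0 m'0 H'.
  have l0 : l = 0.
    apply/eqP; rewrite -cabs_eq0 eq_le cabs_ge0 andbT.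
    apply: (@small_pos_le0 _ _ (16 * m' / r')) => e e0.
    have [|w wd hw] := acc (Num.min e (r' / 8)); first by rewrite lt_min e0 divr_gt0.
    move: wd; rewrite lt_min => /and3P[w0 we wr].
    have := Hl1 w; rewrite w0 (ltW wr) /q hw mul0r sub0r cabsN => /(_ isT).
    move=> /le_trans; apply; apply: ler_wpM2l (ltW we).
    by rewrite !mulr_ge0 // invr_ge0 ltW.
  exists (r' / 8); first by rewrite divr_gt0.
  exists (16 * m' / r') => w /andP[w0 wr].
  rewrite /q exprSr invfM mulrA cabsM cabsV ler_pdivrMr //.
  by have := Hl1 w; rewrite l0 subr0 w0 (ltW wr); apply.
exists (r / 16); first by rewrite divr_gt0.
move=> z /andP[z0 zr]; apply/eqP; rewrite -cabs_eq0 eq_le cabs_ge0 andbT.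
have key k : cabs (h z) <= m / 2 ^+ k.
  (* On the ring of radii [r / 4] and [r / 2] about [z], the distance from [w] to [a] is at least
     twice that from [z] to [a], so each division gains a factor 2. *)
  have : cabs (q k z) <= m / (2 * cabs (z - a)) ^+ k.
    apply: (@max_modulus _ (q k) z (r / 4) _ [:: a]).
    - by rewrite divr_gt0.
    - by rewrite divr_ge0 // exprn_ge0 // mulr_ge0 ?cabs_ge0.
    - by rewrite inE -subr_eq0 -cabs_gt0.
    - move=> w wr; rewrite inE -subr_eq0 -cabs_gt0 => w0; apply: dq.
      by rewrite w0; have := cabs_triangle w z a; lra.
    - by move=> e; rewrite inE => /eqP ->.
    move=> w /andP[w1 w2]; rewrite inE -subr_eq0 -cabs_gt0 => w0.
    have wa : cabs (w - a) <= r by have := cabs_triangle w z a; lra.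
    rewrite /q cabsM cabsV cabsX; apply: ler_pM; rewrite ?cabs_ge0 ?invr_ge0 ?exprn_ge0 ?cabs_ge0 //.
      by apply: (H w _).2; rewrite w0.
    rewrite lef_pV2 ?posrE ?exprn_gt0 ?mulr_gt0 //.
    apply: lerXn2r; rewrite ?nnegrE ?mulr_ge0 ?cabs_ge0 //.
    by have := cabs_triangle w a z; rewrite (cabsBC a); lra.
  rewrite /q cabsM cabsV cabsX exprMn invfM mulrA ler_pM2r //.
  by rewrite invr_gt0 exprn_gt0.
rewrite leNgt; apply/negP => hz; have [k] := exp2_small m hz.
by have := key k; lra.
Qed.

End TaylorExpansion.

(** * Bivariate polynomials and their roots *)

Section BivariatePolynomials.
Variable K : numClosedFieldType.
Implicit Types (P Q A B : {poly {poly K}}) (x y : K) (r c : {poly K}).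

(* An element of [{poly {poly K}}] is a polynomial in [y] whose coefficients
   are polynomials in [x]. *)
Definition ev2 P x y : K := P.[y%:P].[x].

Definition ev1 P x : {poly K} := map_poly (horner_eval x) P.

Lemma ev1E P x y : (ev1 P x).[y] = ev2 P x y.
Proof.
rewrite /ev1 /ev2 -{1}[y](hornerC y x) -[y%:P.[x]]/(horner_eval x y%:P).
by rewrite horner_map.
Qed.

Lemma ev2D P Q x y : ev2 (P + Q) x y = ev2 P x y + ev2 Q x y.
Proof. by rewrite /ev2 !hornerD. Qed.

Lemma ev2B P Q x y : ev2 (P - Q) x y = ev2 P x y - ev2 Q x y.
Proof. by rewrite /ev2 !hornerE. Qed.

Lemma ev2M P Q x y : ev2 (P * Q) x y = ev2 P x y * ev2 Q x y.
Proof. by rewrite /ev2 !hornerM. Qed.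

Lemma ev2C r x y : ev2 r%:P x y = r.[x].
Proof. by rewrite /ev2 hornerC. Qed.

Lemma ev2Z r P x y : ev2 (r *: P) x y = r.[x] * ev2 P x y.
Proof. by rewrite /ev2 !hornerZ hornerM. Qed.

Lemma ev2_0 x y : ev2 0 x y = 0.
Proof. by rewrite /ev2 !horner0. Qed.

Lemma ev2X x y : ev2 'X x y = y.
Proof. by rewrite /ev2 !hornerE. Qed.

Lemma ev1_monic P x : P \is monic -> ev1 P x \is monic.
Proof. exact: monic_map. Qed.

Lemma size_ev1 P x : P \is monic -> size (ev1 P x) = size P.
Proof.
move=> Pm; rewrite size_map_poly_id0 // (monicP Pm) horner_evalE hornerC.
exact: oner_neq0.
Qed.

Lemma ev1_eq0 P x : ev1 P x = 0 -> exists Q, P = ('X - x%:P) *: Q.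
Proof.
move=> P0; exists (\poly_(i < size P) (P`_i %/ ('X - x%:P))).
apply/polyP => i; rewrite coefZ coef_poly.
have : root P`_i x.
  by have := congr1 (fun p : {poly K} => p`_i) P0; rewrite coef_map coef0 => /eqP.
rewrite -dvdp_XsubCl => dv; case: ltnP => [_|/leq_sizeP->//].
  by rewrite mulrC divpK.
by rewrite mulr0.
Qed.

Definition birreducible P := P \isn't a GRing.unit /\
  forall A B, P = A * B -> A \is a GRing.unit \/ B \is a GRing.unit.

(* Gauss's lemma: the linear factors of the scalar [c] are cancelled one at a
   time. *)
Lemma gauss_cancel n c P A B : (size c <= n)%N -> c != 0 -> c *: P = A * B ->
  exists a b A1 B1, [/\ a != 0, b != 0, A = a *: A1, B = b *: B1 & P = A1 * B1].
Proof.
elim: n c A B => [|n IH] c A B sc c0 E.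
  by move: sc; rewrite leqn0 size_poly_eq0 (negbTE c0).
have [|sc1] := eqVneq (size c) 1%N.
  move=> /eqP/size_poly1P[c' c'0 cE]; exists c, 1, (c'^-1%:P *: A), B.
  rewrite oner_eq0 scale1r scalerA cE -polyCM mulfV // scale1r; split=> //.
    by rewrite polyC_eq0.
  by rewrite -scalerAl -E cE scalerA -polyCM mulVf // scale1r.
have [x /factor_theorem[c1 cE]] := closed_rootP _ sc1.
have c10 : c1 != 0 by apply: contraNneq c0 => c10; rewrite cE c10 mul0r.
have sc1n : (size c1 <= n)%N.
  by move: sc; rewrite cE size_Mmonic ?monicXsubC // size_XsubC addn2.
have x0 : 'X - x%:P != 0 :> {poly K} by rewrite polyXsubC_eq0.
have cancelX (U V : {poly {poly K}}) :
    ('X - x%:P) *: U = ('X - x%:P) *: V -> U = V.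
  by rewrite -!mul_polyC => /mulfI; apply; rewrite polyC_eq0.
have : ev1 A x * ev1 B x = 0.
  rewrite /ev1 -rmorphM -E cE mulrC -scalerA -mul_polyC rmorphM /=.
  by rewrite map_polyC /= horner_evalE !hornerE subrr mul0r.
move=> /eqP; rewrite mulf_eq0 => /orP[|] /eqP/ev1_eq0[U UE].
  have [|a [b [A1 [B1 [a0 b0 UA BB PE]]]]] := IH c1 U B sc1n c10.
    by apply: cancelX; rewrite scalerA mulrC -cE E UE scalerAl.
  exists (('X - x%:P) * a), b, A1, B1; split=> //; first by rewrite mulf_neq0.
  by rewrite -scalerA -UA.
have [|a [b [A1 [B1 [a0 b0 AA UB PE]]]]] := IH c1 A U sc1n c10.
  by apply: cancelX; rewrite scalerA mulrC -cE E UE scalerAr.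
exists a, (('X - x%:P) * b), A1, B1; split=> //; first by rewrite mulf_neq0.
by rewrite -scalerA -UB.
Qed.

(** Division by the monic [P] takes place over [{poly K}] itself. The remainder multiplied by [c] is
    a multiple of [P] of smaller size, hence zero. *)
Lemma monic_dvd_scale P Q c A : P \is monic -> c != 0 -> c *: Q = A * P ->
  exists B, Q = B * P.
Proof.
move=> Pm c0 E; have := Pdiv.RingMonic.rdivp_eq Pm Q.
set S := Pdiv.CommonRing.rdivp _ _; set T := Pdiv.CommonRing.rmodp _ _ => QE.
have T0 : T = 0.
  have sT : (size T < size P)%N by apply: Pdiv.CommonRing.ltn_rmodpN0; exact: monic_neq0.
  have TE : c *: T = (A - c *: S) * P.
    rewrite mulrBl -E -scalerAl -scalerBr; congr (_ *: _).
    by rewrite [X in _ = X - _]QE addrAC subrr add0r.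
  have [AS0|AS0] := eqVneq (A - c *: S) 0.
    move: TE; rewrite AS0 mul0r => /eqP.
    by rewrite -mul_polyC mulf_eq0 polyC_eq0 (negbTE c0) /= => /eqP.
  have := congr1 (fun p : {poly {poly K}} => size p) TE.
  rewrite size_scale // size_Mmonic // => sTE.
  by have := size_poly_gt0 (A - c *: S); rewrite AS0 => + ; move: sT; rewrite sTE; lia.
by exists S; rewrite {1}QE T0 addr0.
Qed.

(** If [P] and [Q] are coprime, Bezout's identity with cleared denominators leaves a polynomial in
    [x] alone. Otherwise Gauss's lemma makes the common divisor, up to a factor in [x], a factor of
    [P]; irreducibility identifies it with [P] up to a unit. *)
Lemma elimination P Q : birreducible P -> P \is monic ->
  (exists A, Q = A * P) \/
  exists A B r, r != 0 /\ r%:P = A * P + B * Q.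
Proof.
move=> [Pnu Pirr] Pm; have P0 := monic_neq0 Pm.
have [cop|ncop] := boolP (coprimep P Q).
  right; have [[u v] /eqpP[[c1 c2] /= /andP[c10 c20] E]] := Bezout_coprimepP _ _ cop.
  exists (c1 *: u), (c1 *: v), c2; split=> //.
  by rewrite -!scalerAl -scalerDr E -[1]/(1%:P) -mul_polyC mulr1.
left.
have [[c1 A] /= c10 PE] := Pdiv.Idomain.dvdpP _ _ (dvdp_gcdl P Q).
have [[c2 B] /= c20 QE] := Pdiv.Idomain.dvdpP _ _ (dvdp_gcdr P Q).
have [a [b [A1 [B1 [a0 b0 _ NB P1]]]]] := gauss_cancel (leqnn _) c10 PE.
have sB1 : size B1 != 1%N.
  by move: ncop; rewrite coprimep_def NB size_scale.
have [uA|uB] := Pirr _ _ P1; last first.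
  by move: uB; rewrite poly_unitE (negbTE sB1).
have B1E : B1 = A1^-1 * P by rewrite P1 mulKr.
apply: (monic_dvd_scale Pm c20 (A := B * (b *: A1^-1))).
by rewrite QE NB B1E -[RHS]mulrA -scalerAl.
Qed.

Lemma finite_roots r : r != 0 -> exists s : seq K, forall x, r.[x] = 0 -> x \in s.
Proof.
move=> r0; have [s sE] := closed_field_poly_normal r; exists s => x /eqP.
rewrite sE hornerZ mulf_eq0 lead_coef_eq0 (negbTE r0) /= horner_prod.
rewrite prodf_seq_eq0 => /hasP[z zs] /=.
by rewrite !hornerE subr_eq0 => /eqP ->.
Qed.

(** This turns vanishing at points into divisibility: common zeros with infinitely many abscissae
    rule out a nonzero eliminant [r]. *)
Lemma dvd_of_common_zeros P Q : birreducible P -> P \is monic ->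
  (forall s : seq K, exists x y, [/\ x \notin s, ev2 P x y = 0 & ev2 Q x y = 0]) ->
  exists A, Q = A * P.
Proof.
move=> Pi Pm H; have [//|[A [B [r [r0 E]]]]] := elimination Q Pi Pm.
have [s Hs] := finite_roots r0; have [x [y [xs Px Qx]]] := H s.
case/negP: xs; apply: Hs.
by rewrite -(ev2C r x y) E ev2D !ev2M Px Qx !mulr0 addr0.
Qed.

(** The derivative is nonzero in characteristic 0 and too small to be a multiple of [P], so
    elimination leaves finitely many abscissae with a multiple root. *)
Lemma separable_roots P : birreducible P -> P \is monic -> (1 < size P)%N ->
  exists s : seq K, forall x y, x \notin s -> ev2 P x y = 0 -> ev2 (deriv P) x y != 0.
Proof.
move=> Pi Pm sP; have [[A PA]|[A [B [r [r0 E]]]]] := elimination (deriv P) Pi Pm.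
  have P'0 : (deriv P) != 0.
    apply/eqP => /(congr1 (fun p : {poly {poly K}} => p`_((size P).-2))).
    rewrite coef_deriv coef0 -{1}(subnK sP) addn2 /=.
    have -> : (size P - 2).+1 = (size P).-1 by move: sP; lia.
    move=> /eqP; rewrite -lead_coefE (monicP Pm) -polyC_natr polyC_eq0 pnatr_eq0.
    by move: sP; lia.
  have A0 : A != 0 by apply: contraNneq P'0 => A0; rewrite PA A0 mul0r.
  have := lt_size_deriv (monic_neq0 Pm); rewrite PA size_Mmonic //.
  by have := size_poly_gt0 A; rewrite A0; lia.
have [s Hs] := finite_roots r0; exists s => x y xs Px; apply: contraNneq xs => P'x.
by apply: Hs; rewrite -(ev2C r x y) E ev2D !ev2M Px P'x !mulr0 addr0.
Qed.

End BivariatePolynomials.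

(** * Neighborhoods of a complex number *)

Section Nearness.
Variable R : realType.
Local Notation C := R[i].
Implicit Types (z w : C) (Q : C -> Prop).

Definition cnear z Q := exists2 d : R, 0 < d & forall w, cabs (w - z) < d -> Q w.

Lemma cnear_and z Q Q' : cnear z Q -> cnear z Q' -> cnear z (fun w => Q w /\ Q' w).
Proof.
move=> [d d0 H] [d' d'0 H']; exists (Num.min d d'); first by rewrite lt_min d0.
by move=> w; rewrite lt_min => /andP[/H ? /H'].
Qed.

Lemma cnearW z Q Q' : (forall w, Q w -> Q' w) -> cnear z Q -> cnear z Q'.
Proof. by move=> QQ [d d0 H]; exists d => // w /H /QQ. Qed.

Lemma cnear_all z Q : (forall w, Q w) -> cnear z Q.
Proof. by move=> H; exists 1. Qed.

Lemma cnear_at z Q : cnear z Q -> Q z.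
Proof. by case=> d d0; apply; rewrite subrr cabs0. Qed.

Lemma cnear_ball z (e : R) : 0 < e -> cnear z (fun w => cabs (w - z) < e).
Proof. by move=> e0; exists e. Qed.

Lemma cnear_ord z n (Q : nat -> C -> Prop) :
  (forall i, (i < n)%N -> cnear z (Q i)) ->
  cnear z (fun w => forall i, (i < n)%N -> Q i w).
Proof.
elim: n => [|n IH] H; first exact: cnear_all.
have := cnear_and (H n (ltnSn n)) (IH (fun i in' => H i (leqW in'))).
apply: cnearW => w [Hn Hi] i; rewrite ltnS leq_eqVlt => /orP[/eqP ->//|].
exact: Hi.
Qed.

Lemma cnear_seq z (T : eqType) (s : seq T) (Q : T -> C -> Prop) :
  (forall i, i \in s -> cnear z (Q i)) ->
  cnear z (fun w => forall i, i \in s -> Q i w).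
Proof.
elim: s => [|a s IH] H; first exact: cnear_all.
have Ha := H a (mem_head _ _).
have Hs := IH (fun i si => H i ltac:(by rewrite inE si orbT)).
apply: cnearW (cnear_and Ha Hs) => w [Hw Hsw] i; rewrite inE => /orP[/eqP ->//|].
exact: Hsw.
Qed.

Lemma cdiff_of_near (f k : C -> C) z :
  cnear z (fun w => f w = f z + k w * (w - z)) -> ccont k z -> cdiff f z.
Proof.
move=> [d d0 H] ck; apply: (cdiff_near (d := d) (f := fun w => f z + k w * (w - z))) => //.
  by move=> w /H ->.
by exists k => // w; rewrite subrr mulr0 addr0.
Qed.

End Nearness.

(** * Continuity of the roots of a monic polynomial *)

Section RootsContinuity.
Variable R : realType.
Local Notation C := R[i].
Implicit Types (P : {poly {poly C}}) (x y : C).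

(** The roots come with multiplicity, in an arbitrary order that need not vary continuously with
    [x]. *)
Definition rts P x : seq C := sval (closed_field_poly_normal (ev1 P x)).

Lemma rtsE P x : P \is monic -> ev1 P x = \prod_(z <- rts P x) ('X - z%:P).
Proof.
move=> Pm; rewrite /rts; case: closed_field_poly_normal => s /= {1}->.
by rewrite (monicP (ev1_monic x Pm)) scale1r.
Qed.

Lemma mem_rts P x y : P \is monic -> (y \in rts P x) = (ev2 P x y == 0).
Proof.
move=> Pm; rewrite -ev1E rtsE // horner_prod prodf_seq_eq0.
apply/idP/hasP => [ys|[z zs]]; last by rewrite /= !hornerE subr_eq0 => /eqP ->.
by exists y => //=; rewrite !hornerE subrr.
Qed.

Lemma size_rts P x : P \is monic -> size (rts P x) = (size P).-1.
Proof.
by move=> Pm; rewrite -(size_ev1 x Pm) rtsE // size_prod_XsubC.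
Qed.

Lemma ev2_prod P x y : P \is monic -> ev2 P x y = \prod_(z <- rts P x) (y - z).
Proof.
move=> Pm; rewrite -ev1E rtsE // horner_prod.
by apply: eq_bigr => z _; rewrite !hornerE.
Qed.

Lemma ev2_sum P x y : ev2 P x y = \sum_(j < size P) (P`_j).[x] * y ^+ j.
Proof.
rewrite /ev2 [P.[_]]horner_coef horner_sum; apply: eq_bigr => j _.
by rewrite hornerM -rmorphXn hornerC.
Qed.

Lemma nuniq_perm (T : eqType) (s : seq T) : ~~ uniq s ->
  exists z s', perm_eq s [:: z, z & s'].
Proof.
elim: s => // a s IH /=; rewrite negb_and negbK => /orP[as_|/IH[z [s' p]]].
  by exists a, (rem a s); rewrite perm_cons; exact: perm_to_rem.
exists z, (a :: s'); rewrite -(perm_cons a) in p; apply: perm_trans p _.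
by apply/permP => q /=; rewrite !addnA; congr addn; rewrite addnC -addnA; congr addn; rewrite addnC.
Qed.

Lemma uniq_rts P x : P \is monic ->
  (forall y, ev2 P x y = 0 -> ev2 (deriv P) x y != 0) -> uniq (rts P x).
Proof.
move=> Pm H; apply: contraT => /nuniq_perm[z [s' p]].
have zr : z \in rts P x by rewrite (perm_mem p) mem_head.
have := H z; rewrite (mem_rts _ _ Pm) in zr; move=> /(_ (eqP zr)).
have E : ev1 P x = ('X - z%:P) * (('X - z%:P) * \prod_(t <- s') ('X - t%:P)).
  by rewrite rtsE // (perm_big _ p) !big_cons.
rewrite -ev1E /ev1 -deriv_map -/(ev1 P x) E derivM hornerD !hornerM hornerXsubC subrr.
by rewrite !(mul0r, mulr0) addr0 eqxx.
Qed.

Lemma root_bound P x y : P \is monic -> ev2 P x y = 0 ->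
  cabs y <= 1 + \sum_(j < size P) cabs (P`_j).[x].
Proof.
move=> Pm Py; have S0 : 0 <= \sum_(j < size P) cabs (P`_j).[x].
  by apply: sumr_ge0 => j _; exact: cabs_ge0.
rewrite leNgt; apply/negP => yb.
have y1 : 1 < cabs y by lra.
have [n sP] : exists n, size P = n.+1.
  by exists (size P).-1; rewrite prednK // size_poly_gt0 monic_neq0.
move: S0 yb Py; rewrite ev2_sum sP !big_ord_recr /=.
have -> : P`_n = 1 by move/monicP: Pm; rewrite lead_coefE sP.
rewrite hornerC mul1r cabs1 => S0 yb /eqP; rewrite addr_eq0 => /eqP E.
case: n sP S0 yb E => [|n] sP S0 yb E.
  by move: E; rewrite big_ord0 expr0 => /eqP; rewrite eq_sym oppr_eq0 oner_eq0.
have : cabs (y ^+ n.+1) <= (\sum_(j < n.+1) cabs (P`_j).[x]) * cabs y ^+ n.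
  rewrite -cabsN -E; apply: le_trans (cabs_sum _ _ _) _.
  rewrite mulr_suml; apply: ler_sum => j _.
  rewrite cabsM cabsX ler_wpM2l ?cabs_ge0 // ler_weXn2l ?ltW //.
  by have := ltn_ord j; lia.
rewrite cabsX exprS ler_pM2r; first by lra.
by rewrite exprn_gt0 //; lra.
Qed.

Lemma coef_near P x1 (e : R) : 0 < e -> cnear x1 (fun x =>
  forall j, (j < size P)%N -> cabs ((P`_j).[x] - (P`_j).[x1]) < e).
Proof.
move=> e0; apply: cnear_ord => j _; exact: (ccont_horner P`_j (ccont_id x1) e0).
Qed.

Lemma prod_dist_ge (s : seq C) y (e : R) : 0 <= e ->
  (forall z, z \in s -> e <= cabs (y - z)) ->
  e ^+ size s <= cabs (\prod_(z <- s) (y - z)).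
Proof.
move=> e0; elim: s => [|a s IH] H; first by rewrite big_nil expr0 cabs1.
rewrite big_cons exprS cabsM; apply: ler_pM; rewrite ?exprn_ge0 //.
  by apply: H; rewrite mem_head.
by apply: IH => z zs; apply: H; rewrite inE zs orbT.
Qed.

(** If [y] were at distance at least [e] from all roots over [x1], the product formula would give
    [e ^ d <= |P(x1, y)|]. But [P(x, y) = 0] and [y] is bounded uniformly in [x], so [P(x1, y)] is
    small. *)
Lemma root_near P x1 (e : R) : P \is monic -> 0 < e -> cnear x1 (fun x =>
  forall y, y \in rts P x -> exists2 y1, y1 \in rts P x1 & cabs (y - y1) < e).
Proof.
move=> Pm e0; pose d := (size P).-1.
pose B := 1 + \sum_(j < size P) (cabs (P`_j).[x1] + 1).
have B1 : 1 <= B.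
  by rewrite lerDl; apply: sumr_ge0 => j _; have := cabs_ge0 (P`_j).[x1]; lra.
pose S := \sum_(j < size P) B ^+ j.
have S0 : 0 <= S by apply: sumr_ge0 => j _; apply: exprn_ge0; lra.
have ed : 0 < e ^+ d by apply: exprn_gt0.
have n1 := coef_near P x1 (e := e ^+ d / (S + 1)) ltac:(by rewrite divr_gt0 //; lra).
apply: cnearW (cnear_and n1 (coef_near P x1 ltr01)) => x [Hx Hx1] y yr.
have Py : ev2 P x y = 0 by apply/eqP; rewrite -mem_rts.
have yB : cabs y <= B.
  apply: le_trans (root_bound Pm Py) _; rewrite lerD2l; apply: ler_sum => j _.
  by have := Hx1 j (ltn_ord j); have := cabs_lowerB (P`_j).[x] (P`_j).[x1]; lra.
apply: contrapT => far.
have : e ^+ d <= cabs (ev2 P x1 y).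
  rewrite ev2_prod // /d -(size_rts x1 Pm); apply: prod_dist_ge (ltW e0) _ => z zr.
  by rewrite leNgt; apply/negP => zy; apply: far; exists z.
have -> : ev2 P x1 y = - (ev2 P x y - ev2 P x1 y) by rewrite Py sub0r opprK.
rewrite cabsN !ev2_sum -sumrB => h.
suff : e ^+ d < e ^+ d by rewrite ltxx.
apply: le_lt_trans h _; apply: le_lt_trans (cabs_sum _ _ _) _.
apply: (@le_lt_trans _ _ (\sum_(j < size P) e ^+ d / (S + 1) * B ^+ j)).
  apply: ler_sum => j _; rewrite -mulrBl cabsM cabsX; apply: ler_pM; rewrite ?exprn_ge0 ?cabs_ge0 //.
    exact/ltW/Hx.
  by apply: lerXn2r; rewrite ?nnegrE ?cabs_ge0 //; lra.
rewrite -mulr_sumr -/S mulrAC ltr_pdivrMr; last by lra.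
by rewrite ltr_pM2l //; lra.
Qed.

Lemma root_near' P x1 (e : R) : P \is monic -> 0 < e ->
  cnear x1 (fun x => forall y1, y1 \in rts P x1 ->
    exists2 y, y \in rts P x & cabs (y - y1) < e).
Proof.
move=> Pm e0; apply: cnear_seq => y1 y1r; pose d := (size P).-1.
pose S := \sum_(j < size P) cabs y1 ^+ j.
have S0 : 0 <= S by apply: sumr_ge0 => j _; apply: exprn_ge0; exact: cabs_ge0.
have ed : 0 < e ^+ d by apply: exprn_gt0.
have n1 := coef_near P x1 (e := e ^+ d / (S + 1)) ltac:(by rewrite divr_gt0 //; lra).
apply: cnearW n1 => x Hx.
have Py : ev2 P x1 y1 = 0 by apply/eqP; rewrite -mem_rts.
apply: contrapT => far.
have : e ^+ d <= cabs (ev2 P x y1).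
  rewrite ev2_prod // /d -(size_rts x Pm); apply: prod_dist_ge (ltW e0) _ => z zr.
  by rewrite leNgt; apply/negP => zy; apply: far; exists z => //; rewrite cabsBC.
have -> : ev2 P x y1 = ev2 P x y1 - ev2 P x1 y1 by rewrite Py subr0.
rewrite !ev2_sum -sumrB => h.
suff : e ^+ d < e ^+ d by rewrite ltxx.
apply: le_lt_trans h _; apply: le_lt_trans (cabs_sum _ _ _) _.
apply: (@le_lt_trans _ _ (\sum_(j < size P) e ^+ d / (S + 1) * cabs y1 ^+ j)).
  apply: ler_sum => j _; rewrite -mulrBl cabsM cabsX ler_wpM2r ?exprn_ge0 ?cabs_ge0 //.
  exact/ltW/Hx.
rewrite -mulr_sumr -/S mulrAC ltr_pdivrMr; last by lra.
by rewrite ltr_pM2l //; lra.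
Qed.

End RootsContinuity.

(** * Holomorphic sections through simple roots *)

Section LocalSections.
Variable R : realType.
Local Notation C := R[i].
Implicit Types (P : {poly {poly C}}) (x y : C) (e : R).

(** When [e] separates the simple roots over [x1], exactly one root over a nearby [x] passes the
    filter; the default [y1] is then never returned. *)
Definition local_root P e y1 x : C :=
  head y1 [seq y <- rts P x | cabs (y - y1) < e].

Lemma separation (s : seq C) : exists2 e : R, 0 < e &
  forall y z, y \in s -> z \in s -> y != z -> 2 * e <= cabs (y - z).
Proof.
elim: s => [|a s [e e0 He]]; first by exists 1.
have [d d0 Hd] : exists2 d : R, 0 < d & forall z, z \in s -> a != z -> 2 * d <= cabs (a - z).
  elim: s {He} => [|b s [d d0 Hd]]; first by exists 1.
  have [ab|ab] := eqVneq a b.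
    exists d => // z; rewrite inE => /orP[/eqP ->|]; last exact: Hd.
    by rewrite ab eqxx.
  have p0 : 0 < cabs (a - b) by rewrite cabs_gt0 subr_eq0.
  exists (Num.min d (cabs (a - b) / 2)); first by rewrite lt_min d0 divr_gt0.
  move=> z; rewrite inE => /orP[/eqP -> _|zs az].
    have : Num.min d (cabs (a - b) / 2) <= cabs (a - b) / 2 by rewrite ge_min lexx orbT.
    lra.
  have : Num.min d (cabs (a - b) / 2) <= d by rewrite ge_min lexx.
  by have := Hd z zs az; lra.
exists (Num.min d e); first by rewrite lt_min d0.
have m1 : Num.min d e <= d by rewrite ge_min lexx.
have m2 : Num.min d e <= e by rewrite ge_min lexx orbT.
move=> y z; rewrite !inE => /orP[/eqP ->|ys] /orP[/eqP ->|zs] yz.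
- by rewrite eqxx in yz.
- by have := Hd z zs yz; lra.
- by rewrite cabsBC; have := Hd y ys ltac:(by rewrite eq_sym); lra.
- by have := He y z ys zs yz; lra.
Qed.

Section AtSimplePoint.
Variables (P : {poly {poly C}}) (x1 : C) (e : R).
Hypothesis Pm : P \is monic.
Hypothesis simple : forall y, ev2 P x1 y = 0 -> ev2 (deriv P) x1 y != 0.
Hypothesis e0 : 0 < e.
Hypothesis sep : forall y z, y \in rts P x1 -> z \in rts P x1 -> y != z ->
  2 * e <= cabs (y - z).

Lemma local_rootP : cnear x1 (fun x => forall y1, y1 \in rts P x1 ->
  local_root P e y1 x \in rts P x /\ cabs (local_root P e y1 x - y1) < e).
Proof.
apply: cnearW (root_near' x1 Pm e0) => x H y1 /H[y yr ye].
have : local_root P e y1 x \in [seq y <- rts P x | cabs (y - y1) < e].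
  rewrite /local_root; case E: [seq _ <- _ | _] => [|b s] /=; last exact: mem_head.
  have : y \in [seq y <- rts P x | cabs (y - y1) < e] by rewrite mem_filter ye.
  by rewrite E.
by rewrite mem_filter => /andP[].
Qed.

Lemma close_roots_eq y z t : y \in rts P x1 -> z \in rts P x1 ->
  cabs (t - y) < e -> cabs (t - z) < e -> y = z.
Proof.
move=> yr zr ty tz; apply/eqP/negPn/negP => yz.
by have := sep yr zr yz; have := cabs_triangle y t z; rewrite (cabsBC y t); lra.
Qed.

(** The local roots attached to distinct roots over [x1] are distinct, and there are as many of them
    as roots over [x]. *)
Lemma perm_local_roots : cnear x1 (fun x =>
  perm_eq (rts P x) [seq local_root P e y1 x | y1 <- rts P x1]).
Proof.
apply: cnearW local_rootP => x H.
have u1 : uniq (rts P x1) by apply: uniq_rts.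
have u2 : uniq [seq local_root P e y1 x | y1 <- rts P x1].
  rewrite map_inj_in_uniq // => y z yr zr E.
  apply: (close_roots_eq yr zr (t := local_root P e y x)); first by case: (H y yr).
  by rewrite E; case: (H z zr).
have sub : {subset [seq local_root P e y1 x | y1 <- rts P x1] <= rts P x}.
  by move=> _ /mapP[y yr ->]; case: (H y yr).
have ss : (size (rts P x) <= size [seq local_root P e y1 x | y1 <- rts P x1])%N.
  by rewrite size_map !size_rts.
have [eqs eqi] := uniq_min_size u2 sub ss.
by rewrite perm_sym; apply: uniq_perm => //; rewrite -(eq_uniq eqs eqi).
Qed.

Lemma local_root_at y1 : y1 \in rts P x1 -> local_root P e y1 x1 = y1.
Proof.
move=> yr; have [lr le] := cnear_at local_rootP y1 yr.
by apply: (close_roots_eq lr yr (t := local_root P e y1 x1)) => //; rewrite subrr cabs0.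
Qed.

Lemma ccont_local_root y1 : y1 \in rts P x1 -> ccont (local_root P e y1) x1.
Proof.
move=> yr d d0; rewrite local_root_at //.
have m0 : 0 < Num.min d e by rewrite lt_min d0.
have n1 := root_near' x1 Pm m0.
apply: cnearW (cnear_and n1 (cnear_and perm_local_roots local_rootP)).
move=> x [/(_ y1 yr)[y yrx +] [pr lr]].
rewrite lt_min => /andP[yd ye].
have : y \in [seq local_root P e y1 x | y1 <- rts P x1] by rewrite -(perm_mem pr).
move=> /mapP[y2 y2r yE].
have y12 : y1 = y2.
  by apply: (close_roots_eq yr y2r ye); rewrite yE; case: (lr y2 y2r).
by rewrite {1}y12 -yE.
Qed.

(** The implicit function theorem by factorization: [P(x1, y) = V(y) (y - y1)] with [V(y1) <> 0],
    and [P(x, y) - P(x1, y) = (x - x1) U(x, y)]. Hence [- U / V] along the section is a continuous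
    difference quotient. *)
Lemma cdiff_local_root y1 : y1 \in rts P x1 -> cdiff (local_root P e y1) x1.
Proof.
move=> yr; set s := local_root P e y1.
have cs : ccont s x1 := ccont_local_root yr.
have sx1 : s x1 = y1 := local_root_at yr.
have Py : ev2 P x1 y1 = 0 by apply/eqP; rewrite -mem_rts.
have /factor_theorem[V VE] : root (ev1 P x1) y1 by rewrite rootE ev1E Py.
have Vy : V.[y1] != 0.
  have := simple Py; rewrite -ev1E /ev1 -deriv_map -/(ev1 P x1) VE derivM.
  by rewrite derivXsubC hornerD !hornerM hornerXsubC subrr mulr0 add0r hornerC mulr1.
have uex (j : nat) : exists u : {poly C}, P`_j - (P`_j).[x1]%:P = u * ('X - x1%:P).
  by apply/factor_theorem; rewrite rootE !hornerE subrr.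
have [u uE] := choice uex.
pose U x y := \sum_(j < size P) (u j).[x] * y ^+ j.
have PU x y : ev2 P x y - ev2 P x1 y = (x - x1) * U x y.
  rewrite !ev2_sum -sumrB /U mulr_sumr; apply: eq_bigr => j _.
  rewrite -mulrBl; have := congr1 (fun p : {poly C} => p.[x]) (uE j).
  by rewrite hornerD hornerN hornerC hornerM hornerXsubC => ->; ring.
have PV y : ev2 P x1 y = V.[y] * (y - y1) by rewrite -ev1E VE !hornerE.
apply: (cdiff_of_near (k := fun x => - U x (s x) / V.[s x])).
  have cV : ccont (fun x => V.[s x]) x1 by exact: ccont_horner.
  have [d d0 Hd] := ccont_neq0 cV ltac:(by rewrite /= sx1).
  apply: cnearW (cnear_and (ex_intro2 _ _ d d0 Hd) local_rootP).
  move=> x [Vx /(_ y1 yr)[sr _]].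
  have Vx0 : V.[s x] != 0.
    by rewrite -cabs_gt0; apply: le_lt_trans Vx; rewrite divr_ge0 ?cabs_ge0.
  have Ps : ev2 P x (s x) = 0 by apply/eqP; rewrite -mem_rts.
  have := PU x (s x); rewrite Ps sub0r PV => /eqP; rewrite eqr_oppLR => /eqP E.
  apply: (mulfI Vx0); rewrite sx1 mulrDr.
  have -> : V.[s x] * (- U x (s x) / V.[s x] * (x - x1)) = - ((x - x1) * U x (s x)).
    by field; rewrite ?Vx0.
  by rewrite -E; ring.
apply: ccontM; last by apply: ccontV; [rewrite sx1|exact: ccont_horner].
apply: ccontN; apply: ccont_sum => j.
apply: ccontM; last exact: ccontX.
exact: (ccont_horner (u j) (ccont_id x1)).
Qed.

End AtSimplePoint.

Lemma cdiff_coef_prod (T : eqType) (s : seq T) (v : T -> C -> C) x1 :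
  (forall t, t \in s -> cdiff (v t) x1) -> forall k,
  cdiff (fun x => (\prod_(t <- s) ('X - (v t x)%:P))`_k) x1.
Proof.
elim: s => [|a s IH] H k.
  by under eq_fun do rewrite big_nil; exact: cdiff_cst.
have {}IH := IH (fun t ts => H t ltac:(by rewrite inE ts orbT)).
have Ha := H a (mem_head _ _).
under eq_fun do rewrite big_cons mulrBl coefB coefXM coefCM.
apply: cdiffB; last exact: cdiffM.
by case: k => [|k] /=; [exact: cdiff_cst|exact: IH].
Qed.

(** Its coefficients are, up to sign, the elementary symmetric functions of the values of [w x] on
    the fiber; they do not depend on the order of the roots. *)
Definition root_poly P (w : C -> C -> C) x : {poly C} :=
  \prod_(y <- rts P x) ('X - (w x y)%:P).

Lemma cdiff_root_poly P (w : C -> C -> C) x1 : P \is monic ->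
  (forall y, ev2 P x1 y = 0 -> ev2 (deriv P) x1 y != 0) ->
  (forall (s : C -> C), cdiff s x1 -> ev2 P x1 (s x1) = 0 ->
     cdiff (fun x => w x (s x)) x1) ->
  forall k, cdiff (fun x => (root_poly P w x)`_k) x1.
Proof.
move=> Pm simple dw k; have [e e0 sep] := separation (rts P x1).
have [d d0 Hd] := perm_local_roots Pm simple e0 sep.
apply: (cdiff_near (d := d) (f := fun x =>
    (\prod_(y1 <- rts P x1) ('X - (w x (local_root P e y1 x))%:P))`_k)) => //.
  by move=> x /Hd pr; rewrite /root_poly (perm_big _ pr) big_map.
apply: (cdiff_coef_prod (v := fun y1 x => w x (local_root P e y1 x))) => y1 yr.
apply: dw; first exact: cdiff_local_root.
by rewrite local_root_at //; apply/eqP; rewrite -mem_rts.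
Qed.

End LocalSections.

(** * Polynomials in three variables, seen in an affine frame *)

Section MultivariateEvaluation.
Variable K : numClosedFieldType.
Implicit Types (F G : mpoly 3 K).

Lemma exists_notin (s : seq K) : exists t : K, t \notin s.
Proof.
have u : uniq [seq (i%:R : K) | i <- iota 0 (size s).+1].
  by rewrite map_inj_uniq ?iota_uniq // => i j /eqP; rewrite eqr_nat => /eqP.
apply: contrapT => nt.
have sub : {subset [seq (i%:R : K) | i <- iota 0 (size s).+1] <= s}.
  by move=> x _; apply/negPn/negP => xs; apply: nt; exists x.
by have := uniq_leq_size u sub; rewrite size_map size_iota ltnn.
Qed.

Lemma poly_eq0_horner (p : {poly K}) : (forall x, p.[x] = 0) -> p = 0.
Proof.
move=> H; apply/eqP/negPn/negP => /finite_roots[s Hs].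
by have [t /negP[]] := exists_notin s; apply: Hs.
Qed.

Lemma bipoly_eq0_ev2 (P : {poly {poly K}}) : (forall x y, ev2 P x y = 0) -> P = 0.
Proof.
move=> H; apply/polyP => j; rewrite coef0; apply: poly_eq0_horner => x.
have := @poly_eq0_horner (ev1 P x) (fun y => etrans (ev1E P x y) (H x y)).
by move=> /(congr1 (fun p : {poly K} => p`_j)); rewrite coef_map coef0.
Qed.

Lemma meval_ext n (G : mpoly n K) (v w : 'I_n -> K) : v =1 w ->
  meval v G = meval w G.
Proof.
move=> vw; rewrite !mevalE; apply: eq_bigr => m _; congr (_ * _).
by apply: eq_bigr => i _; rewrite vw.
Qed.

Lemma base_inj (N a b c a' b' c' : nat) : (a < N)%N -> (b < N)%N ->
  (a' < N)%N -> (b' < N)%N ->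
  (a + N * (b + N * c) = a' + N * (b' + N * c'))%N -> [/\ a = a', b = b' & c = c'].
Proof.
move=> aN bN a'N b'N E; have N0 : (0 < N)%N by lia.
have md r k : (r < N)%N -> ((r + N * k) %% N = r)%N.
  by move=> rN; rewrite addnC mulnC modnMDl modn_small.
have Ea : a = a' by have := congr1 (modn^~ N) E; rewrite !md.
have E' : (b + N * c = b' + N * c')%N.
  by move: E; rewrite Ea => /addnI/eqP; rewrite eqn_pmul2l // => /eqP.
have Eb : b = b' by have := congr1 (modn^~ N) E'; rewrite !md.
by split=> //; move: E'; rewrite Eb => /addnI/eqP; rewrite eqn_pmul2l // => /eqP.
Qed.

(* Kronecker substitution: evaluate at [(t, t ^ N, t ^ (N ^ 2))]. *)
Lemma meval_neq0 G : G != 0 -> exists v : 'rV[K]_3, meval (v 0) G != 0.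
Proof.
move=> G0; pose N := msize G.
pose e (m : multinom 3) : nat := (m ord0 + N * (m (inord 1) + N * m ord_max))%N.
pose p : {poly K} := \sum_(m <- msupp G) mcoeff m G *: 'X^(e m).
have deg_lt (m : multinom 3) i : m \in msupp G -> (m i < N)%N.
  move=> /msize_mdeg_lt; apply: leq_ltn_trans; rewrite mdegE.
  by rewrite (bigD1 i) //= leq_addr.
have ord3 (i : 'I_3) : [\/ i = ord0, i = inord 1 | i = ord_max].
  by case: i => -[|[|[|//]]] i3; [apply: Or31|apply: Or32|apply: Or33];
    apply: val_inj; rewrite /= ?inordK.
have e_inj : {in msupp G &, injective e}.
  move=> m m' mG m'G E.
  have [Ea Eb Ec] := base_inj (deg_lt m ord0 mG) (deg_lt m (inord 1) mG)
    (deg_lt m' ord0 m'G) (deg_lt m' (inord 1) m'G) E.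
  by apply/mnmP => i; case: (ord3 i) => ->.
have p0 : p != 0.
  have mG := mlead_supp G0; set m0 := mlead G in mG.
  apply/eqP => /(congr1 (fun q : {poly K} => q`_(e m0))).
  rewrite coef0 coef_sum (bigD1_seq m0) //= big_seq_cond big1 => [|m /andP[mG' mm]].
    rewrite coefZ coefXn eqxx mulr1 addr0 => /eqP.
    by rewrite mcoeff_eq0 mG.
  rewrite coefZ coefXn; case: eqP => [E|_]; last by rewrite mulr0.
  by rewrite (e_inj _ _ mG mG' E) eqxx in mm.
have [s Hs] : exists s : seq K, forall t, p.[t] = 0 -> t \in s.
  exact: finite_roots p0.
have [t ts] := exists_notin s.
exists (\row_(i < 3) t ^+ (N ^ i)); apply: contraNneq ts => Gt; apply: Hs.
rewrite /p horner_sum -[RHS]Gt mevalE; apply: eq_bigr => m _.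
rewrite hornerZ hornerXn; congr (_ * _).
rewrite /e !big_ord_recl big_ord0 !mxE /= mulr1 -!exprM -!exprD; congr (_ ^+ _).
have -> : lift ord0 (lift ord0 ord0) = ord_max :> 'I_3 by apply: val_inj.
have -> : lift ord0 ord0 = inord 1 :> 'I_3 by apply: val_inj; rewrite /= inordK.
rewrite /bump /= expn0 expn1; lia.
Qed.

Lemma mpoly_eq_meval F G : (forall v : 'rV[K]_3, meval (v 0) F = meval (v 0) G) ->
  F = G.
Proof.
move=> FG; apply/eqP; rewrite -subr_eq0; apply/negPn/negP => /meval_neq0[v].
by rewrite mevalB FG subrr eqxx.
Qed.

Lemma meval_homog d F (c : K) (v : 'rV[K]_3) : F \is ishomog1 d mdeg ->
  meval ((c *: v) 0) F = c ^+ d * meval (v 0) F.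
Proof.
move=> /dhomogP hF; rewrite !mevalE mulr_sumr; apply: eq_big_seq => m mF.
rewrite mulrCA; congr (_ * _); have hm : mdeg m = d := hF m mF; rewrite -hm mdegE.
rewrite -prodrXr -big_split /=; apply: eq_bigr => i _.
by rewrite mxE exprMn.
Qed.

(** The rows of [A] are the frame: the origin of the chart, then the points at infinity of its two
    axes. *)
Definition aff (A : 'M[K]_3) (x y : K) : 'rV[K]_3 :=
  (\row_(j < 3) [:: 1; x; y]`_j) *m A.

Definition frame_lin (A : 'M[K]_3) (j : 'I_3) : {poly {poly K}} :=
  \sum_(k < 3) [:: 1; 'X%:P; 'X]`_k * (A k j)%:P%:P.

Definition dehomog (A : 'M[K]_3) F : {poly {poly K}} :=
  mmap (fun c => c%:P%:P) (frame_lin A) F.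

Lemma ev2_frame_lin A j x y : ev2 (frame_lin A j) x y = aff A x y 0 j.
Proof.
rewrite /frame_lin /aff mxE /ev2 !horner_sum; apply: eq_bigr => k _.
rewrite mxE !hornerM !hornerC; congr (_ * _).
by case: k => -[|[|[|//]]] k3 /=; rewrite ?(hornerC, hornerX).
Qed.

Lemma ev2_dehomog A F x y : ev2 (dehomog A F) x y = meval (aff A x y 0) F.
Proof.
rewrite /dehomog /mmap mevalE /ev2 !horner_sum; apply: eq_bigr => m _.
rewrite !hornerM !hornerC; congr (_ * _); rewrite /mmap1 !horner_prod.
by apply: eq_bigr => j _; rewrite !horner_exp -ev2_frame_lin.
Qed.

Lemma size_coef_mul n m (p q : {poly {poly K}}) :
  (size p <= n.+1)%N -> (size q <= m.+1)%N ->
  (size (p * q)%R <= (n + m).+1)%N /\ (p * q)`_(n + m) = p`_n * q`_m.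
Proof.
move=> sp sq; split.
  by apply: leq_trans (size_polyMleq _ _) _; lia.
have nlt : (n < (n + m).+1)%N by rewrite ltnS leq_addr.
rewrite coefM (bigD1 (Ordinal nlt)) //= addKn big1 ?addr0 // => i ni.
have ni' : nat_of_ord i != n by apply: contraNneq ni => E; apply/eqP/val_inj.
have [lt|ge] := ltnP n i; first by rewrite (leq_sizeP _ _ sp) ?mul0r.
by rewrite [q`_ _](leq_sizeP _ _ sq) ?mulr0 //; lia.
Qed.

Lemma size_coef_exp n (p : {poly {poly K}}) : (size p <= 2)%N ->
  (size (p ^+ n)%R <= n.+1)%N /\ (p ^+ n)`_n = p`_1 ^+ n.
Proof.
move=> sp; elim: n => [|n [IH1 IH2]]; first by rewrite !expr0 size_poly1 coefC.
by have [h1 h2] := size_coef_mul sp IH1; rewrite !exprS -IH2; rewrite add1n in h1 h2.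
Qed.

Lemma size_coef_prod (n : nat) (e : 'I_n -> nat) (p : 'I_n -> {poly {poly K}}) :
  (forall i, size (p i) <= 2)%N ->
  (size (\prod_i p i ^+ e i)%R <= (\sum_i e i).+1)%N /\
  (\prod_i p i ^+ e i)`_(\sum_i e i)%N = \prod_i (p i)`_1 ^+ e i.
Proof.
move=> sp; elim: n e p sp => [|n IH] e p sp.
  by rewrite !big_ord0 size_poly1 coefC.
rewrite !big_ord_recl.
have [h1 h2] := size_coef_exp (e ord0) (sp ord0).
have [k1 k2] := IH (fun i => e (lift ord0 i)) (fun i => p (lift ord0 i)) (fun i => sp _).
by have [l1 l2] := size_coef_mul h1 k1; rewrite l2 h2 k2.
Qed.

Lemma size_frame_lin A j : (size (frame_lin A j) <= 2)%N /\
  (frame_lin A j)`_1 = (A ord_max j)%:P.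
Proof.
rewrite /frame_lin !big_ord_recl big_ord0 addr0 /= mul1r.
have -> : lift ord0 (lift ord0 ord0) = ord_max :> 'I_3 by apply: val_inj.
split.
  apply: leq_trans (size_polyD _ _) _; rewrite geq_max; apply/andP; split.
    by apply: leq_trans (size_polyC_leq1 _) _.
  apply: leq_trans (size_polyD _ _) _; rewrite geq_max; apply/andP; split.
    by rewrite -polyCM; apply: leq_trans (size_polyC_leq1 _) _.
  by rewrite mulrC mul_polyC; apply: leq_trans (size_scale_leq _ _) _; rewrite size_polyX.
by rewrite !coefD -polyCM !coefC /= !add0r coefXM coefC.
Qed.

(** The coefficient of [y ^ d] is the value of [F] at the last frame vector. If this point, the
    centre of the projection to [x], is off the curve, the equation is monic in [y] up to a
    scalar. *)
Lemma size_coef_dehomog d A F : F \is ishomog1 d mdeg ->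
  (size (dehomog A F) <= d.+1)%N /\
  (dehomog A F)`_d = (meval (row ord_max A 0) F)%:P.
Proof.
move=> /dhomogP hF; rewrite /dehomog /mmap mevalE; split.
  apply: (leq_trans (size_sum _ _ _)); rewrite big_seq; apply/bigmax_leqP_seq => m mF _.
  rewrite mul_polyC; apply: leq_trans (size_scale_leq _ _) _.
  have hm : mdeg m = d := hF m mF; rewrite -hm mdegE.
  by have [h _] := size_coef_prod (fun i => m i) (fun i => (size_frame_lin A i).1).
rewrite coef_sum rmorph_sum /=; apply: eq_big_seq => m mF.
rewrite coefCM polyCM rmorph_prod /=; congr (_ * _).
have hm : mdeg m = d := hF m mF; rewrite -hm mdegE.
have [_ ->] := size_coef_prod (fun i => m i) (fun i => (size_frame_lin A i).1).
by apply: eq_bigr => i _; rewrite (size_frame_lin A i).2 mxE rmorphXn.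
Qed.

End MultivariateEvaluation.

(** * Homogenization, and irreducibility of the affine equation *)

Section Homogenization.
Variable K : numClosedFieldType.
Variable A : 'M[K]_3.
Hypothesis Au : A \in unitmx.
Implicit Types (F : mpoly 3 K) (G H P : {poly {poly K}}) (v w : 'rV[K]_3).

Definition coord (k : 'I_3) v : K := (v *m invmx A) 0 k.

Definition coord_mpoly (k : 'I_3) : mpoly 3 K :=
  \sum_(j < 3) (invmx A j k) *: mpolyX K (mnm1 j).

Lemma meval_coord k v : meval (v 0) (coord_mpoly k) = coord k v.
Proof.
rewrite /coord_mpoly raddf_sum /coord mxE; apply: eq_bigr => j _.
by rewrite /= mevalZ mevalXU mulrC.
Qed.

Lemma aff_coord v : coord 0 v = 1 -> v = aff A (coord 1 v) (coord (2%:R) v).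
Proof.
move=> v1; rewrite /aff -[LHS](mulmxKV Au); congr (_ *m _); apply/rowP => k.
rewrite [RHS]mxE -[LHS]/(coord k v).
case: k => -[|[|[|//]]] k3 /=.
- by rewrite -[RHS]v1; congr (coord _ v); apply: val_inj.
- by congr (coord _ v); apply: val_inj.
- by congr (coord _ v); apply: val_inj.
Qed.

Lemma coord_aff x y : [/\ coord 0 (aff A x y) = 1, coord 1 (aff A x y) = x
  & coord 2%:R (aff A x y) = y].
Proof. by rewrite /coord /aff mulmxK // !mxE. Qed.

Lemma coordZ k (c : K) v : coord k (c *: v) = c * coord k v.
Proof. by rewrite /coord -scalemxAl mxE. Qed.

(** Substitutes the linear forms dual to the last two frame vectors for [x] and [y]; the result
    agrees with the original where the form [coord 0] equals 1. *)
Definition mpoly_of : {poly {poly K}} -> mpoly 3 K :=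
  horner_eval (coord_mpoly 2%:R) \o
  map_poly (horner_eval (coord_mpoly 1) \o map_poly (@mpolyC 3 K)).

HB.instance Definition _ := GRing.RMorphism.on mpoly_of.

Lemma meval_mpoly_of G v :
  meval (v 0) (mpoly_of G) = ev2 G (coord 1 v) (coord 2%:R v).
Proof.
rewrite /mpoly_of /= /horner_eval.
rewrite -(horner_map (meval (v 0))) /= -map_poly_comp meval_coord -ev1E /ev1.
congr (_.[_]); apply: eq_map_poly => p /=.
rewrite -(horner_map (meval (v 0))) /= -map_poly_comp meval_coord /horner_eval.
by congr (_.[_]); apply/polyP => i; rewrite coef_map /= mevalC.
Qed.

Definition homog_of G : mpoly 3 K :=
  let a := (msize (mpoly_of G)).-1 in
  \sum_(k < a.+1) pihomog mdeg k (mpoly_of G) * coord_mpoly 0 ^+ (a - k).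

Lemma meval_homog_of G v : coord 0 v != 0 ->
  meval (v 0) (homog_of G) = coord 0 v ^+ (msize (mpoly_of G)).-1
    * ev2 G (coord 1 ((coord 0 v)^-1 *: v)) (coord 2%:R ((coord 0 v)^-1 *: v)).
Proof.
set c := coord 0 v => c0; set a := (msize _).-1; set w := _ *: v.
have vw : v = c *: w by rewrite scalerA mulfV // scale1r.
rewrite -meval_mpoly_of.
have le : (msize (mpoly_of G) <= a.+1)%N by rewrite /a; lia.
rewrite [X in _ = _ * meval _ X](pihomog_partitionE le) /homog_of -/a !raddf_sum mulr_sumr; apply: eq_bigr => k _ /=.
rewrite mevalM rmorphXn /= meval_coord -/c {1}vw (meval_homog _ _ (pihomogP _ _ _)).
rewrite mulrAC -exprD; congr (_ ^+ _ * _).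
by have := ltn_ord k; lia.
Qed.

Lemma msize_mul_le n m (p q : mpoly 3 K) : (msize p <= n.+1)%N -> (msize q <= m.+1)%N ->
  (msize (p * q)%R <= (n + m).+1)%N.
Proof.
move=> sp sq; have [->|p0] := eqVneq p 0; first by rewrite mul0r msize0.
have [->|q0] := eqVneq q 0; first by rewrite mulr0 msize0.
by rewrite msizeM //; move: (msize p) (msize q) sp sq => a b; lia.
Qed.

Lemma msize_prod_le n (e : 'I_n -> nat) (p : 'I_n -> mpoly 3 K) :
  (forall i, msize (p i) <= 2)%N ->
  (msize (\prod_i p i ^+ e i)%R <= (\sum_i e i).+1)%N.
Proof.
move=> sp; elim: n e p sp => [|n IH] e p sp; first by rewrite !big_ord0 msize1.
rewrite !big_ord_recl; apply: msize_mul_le; last exact: IH.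
elim: (e ord0) => [|k IHk]; first by rewrite expr0 msize1.
by rewrite exprS; apply: (msize_mul_le (n := 1) (m := k)).
Qed.

Lemma mpoly_of_const (c : K) : mpoly_of c%:P%:P = mpolyC 3 c.
Proof.
rewrite /mpoly_of /= map_polyC /= /horner_eval hornerC map_polyC /= hornerC //.
Qed.

Lemma msize_coord k : (msize (coord_mpoly k) <= 2)%N.
Proof.
apply: leq_trans (msize_sum _ _ _) _; apply/bigmax_leqP => j _.
by apply: leq_trans (msizeZ_le _ _) _; rewrite msizeX mdeg1.
Qed.

Lemma msize_mpoly_of_dehomog d F : F \is ishomog1 d mdeg ->
  (msize (mpoly_of (dehomog A F)) <= d.+1)%N.
Proof.
move=> /dhomogP hF; rewrite /dehomog /mmap rmorph_sum /=.
apply: leq_trans (msize_sum _ _ _) _; rewrite big_seq; apply/bigmax_leqP_seq => m mF _.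
rewrite rmorphM /= mpoly_of_const -[d]add0n.
apply: msize_mul_le; first by rewrite msizeC leq_b1.
have hm : mdeg m = d := hF m mF; rewrite -hm mdegE /mmap1 rmorph_prod /=.
under eq_bigr do rewrite rmorphXn /=.
apply: msize_prod_le => i; rewrite /frame_lin rmorph_sum /=.
apply: leq_trans (msize_sum _ _ _) _; apply/bigmax_leqP => k _.
rewrite rmorphM /= mpoly_of_const mulrC.
apply: (msize_mul_le (n := 0) (m := 1)); first by rewrite msizeC leq_b1.
case: k => -[|[|[|//]]] k3 /=.
- by rewrite rmorph1 msize1.
- rewrite /mpoly_of /= map_polyC /= /horner_eval hornerC map_polyX hornerX.
  exact: msize_coord.
- rewrite /mpoly_of /= map_polyX /horner_eval hornerX.
  exact: msize_coord.
Qed.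

Lemma const_of_homog_unit G : homog_of G \is a GRing.unit -> G \is a GRing.unit.
Proof.
move=> u; have [c cE] : exists c, homog_of G = mpolyC 3 c.
  exists (mcoeff (@mnm0 3) (homog_of G)); move: u; rewrite unfold_in /=.
  by rewrite /mpoly_unit => /andP[/eqP].
have GE : G = c%:P%:P.
  apply/eqP; rewrite -subr_eq0; apply/eqP; apply: bipoly_eq0_ev2 => x y.
  have := @meval_homog_of G (aff A x y); have [-> cx cy] := coord_aff x y.
  rewrite invr1 scale1r cx cy expr1n mul1r => /(_ (oner_neq0 _)) E; move: E.
  rewrite cE mevalC => E.
  by rewrite ev2B -E ev2C hornerC subrr.
have c0 : c != 0.
  by apply/negP => /eqP c0; move: u; rewrite cE c0 mpolyC0 unitr0.
by rewrite GE; do 2! apply: rmorph_unit; rewrite unitfE.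
Qed.

(** A factorization in the chart homogenizes to [F l ^ (a + b) = l ^ d G' H'], where [l = 0] is the
    line at infinity. If [a + b < d] then [l] divides [F], but [l] vanishes at the last frame vector
    and [F] does not. So [a + b = d], and [F = G' H'] is settled by the irreducibility of [F]. *)
Lemma birreducible_dehomog d F : F \is ishomog1 d mdeg ->
  F \isn't a GRing.unit ->
  (forall G H : mpoly 3 K, F = G * H -> G \is a GRing.unit \/ H \is a GRing.unit) ->
  meval (row ord_max A 0) F != 0 -> birreducible (dehomog A F).
Proof.
move=> hF Fnu Firr Fe.
have F0 : F != 0 by apply: contraNneq Fe => ->; rewrite meval0.
have [sP Pd] := size_coef_dehomog A hF.
split.
  apply/negP; rewrite poly_unitE => /andP[/eqP s1 _].
  have d0 : d = 0%N.
    have : (d < size (dehomog A F))%N.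
      rewrite ltnNge; apply/negP => sd; move: Pd; rewrite nth_default // => /eqP.
      by rewrite eq_sym polyC_eq0 (negbTE Fe).
    by rewrite s1; lia.
  move: hF Fnu; rewrite d0 => /dhomogP hF /negP; apply.
  have sF : (msize F <= 1)%N.
    rewrite msizeE big_seq; apply/bigmax_leqP_seq => m mF _.
    by have -> : mdeg m = 0%N := hF m mF.
  have FE := msize1_polyC sF.
  rewrite unfold_in /= /mpoly_unit {1}FE eqxx /= unitfE.
  by apply: contraNneq F0 => F0; rewrite FE F0 mpolyC0.
move=> G H PGH.
pose a := (msize (mpoly_of G)).-1; pose b := (msize (mpoly_of H)).-1.
have e0 : coord_mpoly 0 != 0.
  apply/eqP => e0; have := meval_coord 0 (row 0 A).
  rewrite e0 meval0 /coord -row_mul mulmxV // !mxE eqxx => /eqP.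
  by rewrite eq_sym oner_eq0.
have main : F * coord_mpoly 0 ^+ (a + b) =
    coord_mpoly 0 ^+ d * (homog_of G * homog_of H).
  (* One more factor [coord_mpoly 0] makes the identity trivial where this form vanishes; elsewhere
     it is checked in the chart. *)
  apply: (mulfI e0); apply: mpoly_eq_meval => v.
  rewrite !mevalM !rmorphXn /= meval_coord.
  have [->|c0] := eqVneq (coord 0 v) 0; first by rewrite !mul0r.
  congr (_ * _); rewrite !meval_homog_of // -/a -/b.
  set c := coord 0 v in c0 *; set w := c^-1 *: v.
  have vw : v = c *: w by rewrite scalerA mulfV // scale1r.
  have w1 : coord 0 w = 1 by rewrite coordZ mulVf.
  rewrite vw (meval_homog _ _ hF) {1}(aff_coord w1) -ev2_dehomog PGH ev2M.
  by rewrite exprD -[LHS]mulrA; congr (_ * _); rewrite mulrC mulrACA.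
have P0 : dehomog A F != 0.
  by apply: contraNneq Fe => P0; move: Pd; rewrite P0 coef0 => /esym/eqP; rewrite polyC_eq0.
have nz G' : G' != 0 -> mpoly_of G' != 0.
  apply: contraNneq => mG; apply/eqP; apply: bipoly_eq0_ev2 => x y.
  by have := meval_mpoly_of G' (aff A x y); have [_ -> ->] := coord_aff x y;
    rewrite mG meval0.
have [G0 H0] : G != 0 /\ H != 0.
  by apply/andP; rewrite -negb_or -mulf_eq0 -PGH.
have abd : (a + b <= d)%N.
  have := msize_mpoly_of_dehomog hF; rewrite PGH rmorphM /= msizeM ?nz //.
  have : msize (mpoly_of G) != 0%N by rewrite msize_poly_eq0 nz.
  have : msize (mpoly_of H) != 0%N by rewrite msize_poly_eq0 nz.
  by rewrite /a /b; move: (msize (mpoly_of G)) (msize (mpoly_of H)) => m n; lia.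
have ab : (a + b = d)%N.
  apply/eqP; rewrite eqn_leq abd /= leqNgt; apply/negP => lt.
  have FE : F = coord_mpoly 0 ^+ (d - (a + b)) * (homog_of G * homog_of H).
    apply: (mulfI (expf_neq0 (a + b) e0)).
    by rewrite mulrC main [RHS]mulrA -exprD subnKC.
  case/negP: Fe; rewrite FE mevalM rmorphXn /= meval_coord.
  rewrite /coord -row_mul mulmxV // !mxE /= expr0n mulrb.
  have -> : (d - (a + b) == 0)%N = false by lia.
  by rewrite /= mul0r.
have FGH : F = homog_of G * homog_of H.
  by apply: (mulfI (expf_neq0 d e0)); rewrite mulrC -{1}ab main.
by case: (Firr _ _ FGH) => /const_of_homog_unit; [left|right].
Qed.

End Homogenization.

(** * Germs and local branches *)

Section Conversions.
Variable R : realType.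
Local Notation C := R[i].

Lemma near_CaffP (Q : set (Caff R)) : (\forall p \near (0 : Caff R), Q p) <->
  exists2 e : R, 0 < e & forall x y : C, cabs x < e -> cabs y < e -> Q (x, y).
Proof.
split.
  move=> /nbhs_ballP[e /= e0 H].
  have er : e = (complex.Re e)%:C.
    by apply/esym/RRe_real/ger0_real/ltW.
  exists (complex.Re e); first by rewrite -ltcR -er.
  move=> x y xe ye; apply: H; split; rewrite /ball /= sub0r normrN cabsE er ltcR //.
move=> [e e0 H]; apply/nbhs_ballP; exists e%:C => /=; first by rewrite ltcR.
move=> [x y] [] /=; rewrite /ball /= !sub0r !normrN !cabsE !ltcR.
exact: H.
Qed.

Lemma near_CP (Q : set (R[i]^o)) (z : R[i]^o) : (\forall p \near z, Q p) <-> cnear z Q.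
Proof.
split.
  move=> /nbhs_ballP[e /= e0 H].
  have er : e = (complex.Re e)%:C.
    by apply/esym/RRe_real/ger0_real/ltW.
  exists (complex.Re e); first by rewrite -ltcR -er.
  by move=> x xe; apply: H; rewrite /ball /= -normrN opprB cabsE er ltcR.
move=> [e e0 H]; apply/nbhs_ballP; exists e%:C => /=; first by rewrite ltcR.
by move=> x; rewrite /ball /= -normrN opprB cabsE ltcR; exact: H.
Qed.

Lemma cdiffP (f : R[i]^o -> R[i]^o) (z : R[i]^o) : differentiable f z <-> cdiff f z.
Proof.
rewrite -derivable1_diffP; split.
  move=> /cvg_ex[/= l Hl].
  exists (fun w => if w == z then l else (f w - f z) / (w - z)).
    move=> w; case: eqP => [->|/eqP wz]; first by rewrite subrr mulr0 addr0.
    by rewrite divfK ?subr_eq0 // addrC subrK.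
  move=> e e0; have ec : (0 : R[i]) < e%:C by rewrite ltcR.
  have [d /= d0 H] := (@nbhs_ballP _ (R[i]^o) 0 _).1 ((cvgrPdist_lt _ _).1 Hl _ ec).
  have dr : d = (complex.Re d)%:C by apply/esym/RRe_real/ger0_real/ltW.
  exists (complex.Re d); first by rewrite -ltcR -dr.
  move=> w wd; rewrite eqxx; case: eqP => [_|/eqP wz]; first by rewrite subrr cabs0.
  have := H (w - z); rewrite /ball /= sub0r normrN cabsE dr ltcR => /(_ wd).
  move=> /(_ _)/wrap[]; first by rewrite subr_eq0.
  rewrite -normrN opprB cabsE ltcR; congr (cabs (_ - _) < _).
  by rewrite -[_ *: _]/(_ * _) /= -[_ *: 1]/(_ * 1) mulr1 subrK mulrC.
case=> k fk ck; apply/cvg_ex; exists (k z).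
apply/(@cvgrPdist_lt _ (R[i]^o) _ _ (dnbhs_filter (0 : R[i]^o))) => e e0.
have er : e = (complex.Re e)%:C by apply/esym/RRe_real/ger0_real/ltW.
have [|d d0 H] := ck (complex.Re e); first by rewrite -ltcR -er.
apply: (@nbhs_ballP _ (R[i]^o) 0 _).2; exists d%:C => /=; first by rewrite ltcR.
move=> h; rewrite /ball /= sub0r normrN cabsE ltcR => hd h0.
rewrite -normrN opprB cabsE er ltcR.
have -> : h^-1 *: (f (h *: 1 + z) - f z) = k (h + z).
  rewrite -[_ *: 1]/(_ * 1) mulr1 (fk (h + z)) addrK [f z + _]addrC addrK.
  by rewrite -[_ *: _]/(_ * _) mulrC mulfK.
by apply: H; rewrite addrK.
Qed.

Lemma cdiff_section (f : Caff R -> R[i]^o) (s : C -> C) (x : C) :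
  differentiable f ((x, s x) : Caff R) -> cdiff s x -> cdiff (fun z => f (z, s z)) x.
Proof.
move=> df /cdiffP ds; apply/cdiffP.
pose g : R[i]^o -> Caff R := fun z => (z, s z).
have dg : differentiable g (x : R[i]^o).
  apply: differentiable_pair => //; exact: differentiable_id.
exact: (differentiable_comp dg).
Qed.

Lemma holo_near (f : Caff R -> R[i]^o) : holomorphic_at0 f <->
  exists2 e : R, 0 < e & forall x y : C, cabs x < e -> cabs y < e ->
    differentiable f ((x, y) : Caff R).
Proof. exact: near_CaffP. Qed.

Lemma holo_bounded (f : Caff R -> R[i]^o) : holomorphic_at0 f ->
  exists2 e : R, 0 < e & forall x y : C, cabs x < e -> cabs y < e ->
    cabs (f (x, y)) <= cabs (f 0) + 1.
Proof.
move=> /nbhs_singleton /differentiable_continuous cf.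
have e1 : (0 : R[i]) < 1%:C by rewrite ltcR.
have [e e0 H] := (near_CaffP _).1 ((cvgrPdist_lt _ _).1 cf _ e1); exists e => // x y xe ye.
have := H x y xe ye; rewrite cabsE ltcR cabsBC => h.
by have := cabs_lowerB (f (x, y)) (f 0); lra.
Qed.

End Conversions.

(** * Counting the points of a germ over nearby abscissae *)

Section RootCounting.
Variable R : realType.
Local Notation C := R[i].
Variable P : {poly {poly C}}.
Hypothesis Pm : P \is monic.
Hypothesis Pirr : birreducible P.
Hypothesis sP : (1 < size P)%N.

Definition pnear (Q : C -> Prop) := exists2 d : R, 0 < d &
  forall x, 0 < cabs x < d -> Q x.

Lemma pnear_and (Q Q' : C -> Prop) : pnear Q -> pnear Q' -> pnear (fun x => Q x /\ Q' x).
Proof.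
move=> [d d0 H] [d' d'0 H']; exists (Num.min d d'); first by rewrite lt_min d0.
by move=> x; rewrite lt_min => /and3P[x0 xd xd']; split; [apply: H|apply: H']; rewrite x0.
Qed.

Lemma pnearW (Q Q' : C -> Prop) : (forall x, Q x -> Q' x) -> pnear Q -> pnear Q'.
Proof. by move=> QQ [d d0 H]; exists d => // x /H /QQ. Qed.

Lemma cnear_pnear (Q : C -> Prop) : cnear 0 Q -> pnear Q.
Proof. by move=> [d d0 H]; exists d => // x /andP[_ xd]; apply: H; rewrite subr0. Qed.

Lemma pnear_ex (Q : C -> Prop) : pnear Q -> exists x, Q x.
Proof.
move=> [d d0 H]; exists ((d / 2)%:C); apply: H.
by rewrite cabsR gtr0_norm ?divr_gt0 //=; lra.
Qed.

Lemma pnear_ord n (Q : nat -> C -> Prop) : (forall i, (i < n)%N -> pnear (Q i)) ->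
  pnear (fun x => forall i, (i < n)%N -> Q i x).
Proof.
elim: n => [|n IH] H; first by exists 1.
have := pnear_and (H n (ltnSn n)) (IH (fun i in' => H i (leqW in'))).
apply: pnearW => x [Hn Hi] i; rewrite ltnS leq_eqVlt => /orP[/eqP ->//|].
exact: Hi.
Qed.

Lemma pnear_notin (s : seq C) : pnear (fun x => x \notin s).
Proof.
have [e e0 He] := separation (0 :: s); exists e => // x /andP[x0 xe].
apply/negP => xs; have := He x 0.
rewrite !inE eqxx xs orbT -cabs_gt0 x0 subr0 => /(_ isT isT isT); lra.
Qed.

Lemma pnear_simple : pnear (fun x => forall y, ev2 P x y = 0 -> ev2 (deriv P) x y != 0).
Proof.
have [s Hs] := separable_roots Pirr Pm sP.
by apply: pnearW (pnear_notin s) => x xs y; exact: Hs.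
Qed.

Lemma root_radius : exists2 e : R, 0 < e &
  forall y, y \in rts P 0 -> y != 0 -> 2 * e <= cabs y.
Proof.
have [e e0 He] := separation (0 :: rts P 0); exists e => // y yr y0.
by have := He y 0; rewrite !inE eqxx yr orbT subr0; apply.
Qed.

(* Only the roots of absolute value less than [rho] tend to 0 with [x]. *)
Variable rho : R.
Hypothesis rho0 : 0 < rho.
Hypothesis rhoP : forall y, y \in rts P 0 -> y != 0 -> 2 * rho <= cabs y.

Lemma small_roots (e : R) : 0 < e -> cnear 0 (fun x => forall y, y \in rts P x ->
  cabs y < e \/ rho < cabs y).
Proof.
move=> e0; have m0 : 0 < Num.min e rho by rewrite lt_min e0.
apply: cnearW (root_near 0 Pm m0) => x H y /H[y1 y1r].
rewrite lt_min => /andP[ye yr]; have [y10|y10] := eqVneq y1 0.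
  by left; move: ye; rewrite y10 subr0.
right; have := rhoP y1r y10; have := cabs_lowerB y1 y.
by rewrite (cabsBC y1); lra.
Qed.

(** For [x] near 0 the roots below [rho] are as small as desired, so the number depends only on the
    germ of [A]. *)
Definition root_count (A : set (Caff R)) x : nat :=
  count (fun y => (cabs y < rho) && `[< A (x, y) >]) (rts P x).

Lemma root_count_sub (A B : set (Caff R)) : germ_sub A B -> cnear 0 (fun x =>
  forall y, y \in rts P x -> cabs y < rho -> A (x, y) -> B (x, y)).
Proof.
move=> /near_CaffP[e e0 H].
apply: cnearW (cnear_and (cnear_ball 0 e0) (small_roots e0)) => x [xe Hx] y yr yrho.
rewrite subr0 in xe; case: (Hx y yr) => [ye|]; last by lra.
exact: H.
Qed.

Lemma root_count_eq (A B : set (Caff R)) : germ_eq A B ->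
  cnear 0 (fun x => root_count A x = root_count B x).
Proof.
move=> AB.
have h1 : germ_sub A B by apply: (@filterS _ _ (nbhs_filter _) _ _ _ AB) => p [].
have h2 : germ_sub B A by apply: (@filterS _ _ (nbhs_filter _) _ _ _ AB) => p [].
apply: cnearW (cnear_and (root_count_sub h1) (root_count_sub h2)) => x [H1 H2].
apply: eq_in_count => y yr; have [yrho|//] := ltrP (cabs y) rho.
by apply/asboolP/asboolP; [exact: H1|exact: H2].
Qed.

(** The multiplicity of the root 0 is the order of the polynomial at 0. The number of zero values on
    a fiber is thus read off from which coefficients vanish. *)
Lemma prod_XsubC_low (s : seq C) (p := \prod_(v <- s) ('X - v%:P)) :
  (forall k, (k < count_mem (0 : C)%R s)%N -> p`_k = 0) /\ p`_(count_mem (0 : C)%R s) != 0.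
Proof.
rewrite /p {p}; elim: s => [|a s [IH1 IH2]].
  by rewrite big_nil; split=> //=; rewrite coefC oner_neq0.
rewrite big_cons mulrBl; case: (eqVneq a 0) => [->|a0] /=.
  rewrite mul0r subr0 eqxx add1n; split=> [[|k] kc|]; rewrite coefXM //=.
  by apply: IH1.
rewrite (negbTE a0) add0n; split=> [k kc|]; rewrite coefB coefXM coefCM.
  rewrite (IH1 k kc) mulr0 subr0; case: k kc => //= k kc.
  by apply: IH1; apply: ltn_trans kc.
case E: (count_mem (0 : C)%R s) => [|c] /=; rewrite -E ?sub0r ?oppr_eq0 ?mulf_neq0 //.
by rewrite IH1 ?E // sub0r oppr_eq0 mulf_neq0 // -E.
Qed.

Lemma coef_prod_bound (s : seq C) (v : C -> C) (M : R) : 0 <= M ->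
  (forall t, t \in s -> cabs (v t) <= M) ->
  forall k, cabs (\prod_(t <- s) ('X - (v t)%:P))`_k <= (1 + M) ^+ size s.
Proof.
move=> M0; elim: s => [|a s IH] H k.
  by rewrite big_nil coefC expr0; case: eqP; rewrite ?cabs1 ?cabs0.
have {}IH := IH (fun t ts => H t ltac:(by rewrite inE ts orbT)).
rewrite big_cons mulrBl coefB coefXM coefCM exprS mulrDl mul1r.
apply: le_trans (cabsD _ _) _; rewrite cabsN cabsM; apply: lerD.
  by case: ifP => _; [rewrite cabs0 exprn_ge0 // addr_ge0|exact: IH].
by apply: ler_pM; rewrite ?cabs_ge0 //; apply: H; rewrite mem_head.
Qed.

(* The coefficients of the monic polynomial whose roots are the values of [f]
   are bounded and holomorphic in [x <> 0], so each of them either vanishes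
   identically or does not vanish near 0. *)
Lemma root_count_holo (f : Caff R -> R[i]^o) : holomorphic_at0 f ->
  exists n, pnear (fun x => root_count [set p | f p = 0] x = n).
Proof.
move=> hf; have [e1 e10 df] := (holo_near f).1 hf.
have [e2 e20 bf] := holo_bounded hf.
(* Roots that do not tend to 0 receive the value 1, so that they are not counted as zeros. *)
pose w x y : C := if cabs y < rho then f (x, y) else 1.
set M := cabs (f 0) + 1 in bf; have M1 : 1 <= M by rewrite /M; have := cabs_ge0 (f 0); lra.
have [e [e0 ee1 ee2 ee3]] : exists e, [/\ 0 < e, e <= e1, e <= e2 & e <= rho].
  exists (Num.min e1 (Num.min e2 rho)); split.
  - by rewrite !lt_min e10 e20.
  - by rewrite ge_min lexx.
  - by rewrite !ge_min lexx orbT.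
  - by rewrite !ge_min lexx !orbT.
have [d d0 Hd] := pnear_and pnear_simple
  (cnear_pnear (cnear_and (cnear_ball 0 e0) (small_roots e0))).
have hol k : holo_punctured (fun x => (root_poly P w x)`_k) 0 (d / 2) ((1 + M) ^+ (size P).-1).
  move=> x; rewrite subr0 => /andP[x0 xd].
  have [simple [xe sm]] := Hd x ltac:(by rewrite x0 /=; lra).
  rewrite subr0 in xe.
  split; last first.
    rewrite -(size_rts x Pm) /root_poly; apply: coef_prod_bound; first by lra.
    move=> y yr; rewrite /w; have [yrho|//] := ltrP (cabs y) rho; last by rewrite cabs1.
    by apply: bf; [lra|case: (sm y yr); lra].
  apply: cdiff_root_poly => // s ds Ps.
  have sr : s x \in rts P x by rewrite mem_rts // Ps.
  case: (sm _ sr) => [se|srho]; last first.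
    have [dl dl0 Hdl] := cdiff_cont ds (e := cabs (s x) - rho) ltac:(lra).
    apply: (cdiff_near (d := dl) (f := fun=> 1)) => //; last exact: cdiff_cst.
    move=> z /Hdl; rewrite /w ltNge => h; case: ltP => // h'.
    by have := cabs_lowerB (s x) (s z); rewrite (cabsBC (s x)) => h2; exfalso; lra.
  have [dl dl0 Hdl] := cdiff_cont ds (e := rho - cabs (s x)) ltac:(lra).
  apply: (cdiff_near (d := dl) (f := fun z => f (z, s z))) => //.
    move=> z /Hdl h; rewrite /w.
    have -> // : cabs (s z) < rho by have := cabs_lowerB (s z) (s x); lra.
  by apply: cdiff_section => //; apply: df; lra.
have iso k : exists b : bool, pnear (fun x => ((root_poly P w x)`_k == 0) = b).
  have := isolated_zeros (r := d / 2) _ _ (hol k).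
  move=> /(_ _ _)/wrap[||[] [d' d'0 H]]; rewrite ?divr_gt0 ?exprn_ge0 //; first by lra.
    by exists true, d' => // x xd; rewrite H ?eqxx ?subr0.
  by exists false, d' => // x xd; apply/negbTE; rewrite H ?subr0.
have [b Hb] := choice iso.
have cnt x : (forall y, y \in rts P x -> cabs y < e \/ rho < cabs y) ->
    root_count [set p | f p = 0] x = count_mem (0 : C)%R [seq w x y | y <- rts P x].
  move=> sm; rewrite count_map; apply: eq_in_count => y yr /=; rewrite /w.
  have [yrho|_] /= := ltrP (cabs y) rho; last by rewrite oner_eq0.
  by apply/asboolP/eqP.
have ncnt := pnear_and (pnear_ord (n := size P) (Q := fun k x =>
  ((root_poly P w x)`_k == 0) = b k) (fun k _ => Hb k))
  (cnear_pnear (small_roots e0)).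
have [x0 [H0 sm0]] := pnear_ex ncnt; exists (root_count [set p | f p = 0] x0).
have low x : root_poly P w x = \prod_(v <- [seq w x y | y <- rts P x]) ('X - v%:P).
  by rewrite big_map.
have cs x : (count_mem (0 : C)%R [seq w x y | y <- rts P x] < size P)%N.
  apply: leq_ltn_trans (count_size _ _) _.
  by rewrite size_map size_rts // prednK //; lia.
have le x x' : (forall i, (i < size P)%N -> ((root_poly P w x)`_i == 0) = b i) ->
    (forall i, (i < size P)%N -> ((root_poly P w x')`_i == 0) = b i) ->
    (count_mem (0 : C)%R [seq w x y | y <- rts P x] <= count_mem (0 : C)%R [seq w x' y | y <- rts P x'])%N.
  move=> Hx Hx'; rewrite leqNgt; apply/negP => lt.
  have [/(_ _ lt) + _] := prod_XsubC_low [seq w x y | y <- rts P x].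
  have [_] := prod_XsubC_low [seq w x' y | y <- rts P x'].
  by rewrite -!low => /negP + /eqP; rewrite Hx // Hx'.
apply: pnearW ncnt => x [Hx sm].
by rewrite !cnt //; apply/eqP; rewrite eqn_leq !le.
Qed.

End RootCounting.

From mathcomp Require Import functions.

(** * Decomposition of a germ on the curve into irreducible components *)

Section GermDecomposition.
Variable R : realType.
Local Notation C := R[i].
Variable P : {poly {poly C}}.
Hypothesis Pm : P \is monic.
Hypothesis Pirr : birreducible P.
Hypothesis sP : (1 < size P)%N.
Variable rho : R.
Hypothesis rho0 : 0 < rho.
Hypothesis rhoP : forall y, y \in rts P 0 -> y != 0 -> 2 * rho <= cabs y.

Local Notation root_count := (root_count P rho).
Implicit Types A B : set (Caff R).

Lemma count_le_in (T : eqType) (a b : pred T) (s : seq T) :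
  {in s, forall t, a t -> b t} -> (count a s <= count b s)%N.
Proof.
elim: s => // z s IH ab /=; apply: leq_add.
  by have := ab z (mem_head _ _); case: (a z) => // /(_ isT) ->.
by apply: IH => t ts; apply: ab; rewrite inE ts orbT.
Qed.

Lemma size_prod_le (s : seq {poly C}) n : (forall q, q \in s -> (size q <= n.+1)%N) ->
  (size (\prod_(q <- s) q)%R <= (n * size s).+1)%N.
Proof.
elim: s => [|a s IH] H; first by rewrite big_nil size_poly1.
rewrite big_cons; apply: leq_trans (size_polyMleq _ _) _.
have := H a (mem_head _ _).
have := IH (fun q qs => H q ltac:(by rewrite inE qs orbT)).
by rewrite /= mulnS; lia.
Qed.

(* The common zeros of the [f k] among finitely many points are the zeros of
   [\sum_k t ^ k f k] for a suitable [t] in a fixed finite set. *)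
Lemma root_count_analytic A : analytic_germ A ->
  exists n, pnear (fun x => root_count A x = n).
Proof.
case=> n [f [hf Af]].
(* For each point where some [f k] is nonzero, the polynomial in [t] has at most [n] roots, and
   there are at most [(size P).-1] points: among [N] integers one is a root of none of these
   polynomials. *)
pose N := (n * (size P).-1).+1.
pose ft (j : nat) : Caff R -> R[i]^o := fun p => \sum_(k < n) (j%:R ^+ k : R[i]^o) *: f k p.
have hft j : holomorphic_at0 (ft j).
  have : \forall p \near (0 : Caff R), forall k, differentiable (f k) p.
    apply/near_CaffP.
    have H k := (holo_near (f k)).1 (hf k).
    elim: n f hf {Af N ft} H => [|n IH] f hf H; first by exists 1 => // x y _ _ [].
    have [e e0 He] := IH (fun k => f (lift ord0 k)) (fun k => hf _) (fun k => H _).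
    have [d d0 Hd] := H ord0; exists (Num.min d e); first by rewrite lt_min d0.
    move=> x y; rewrite !lt_min => /andP[xd xe] /andP[yd ye] k.
    by case: (unliftP ord0 k) => [k' ->|->]; [apply: He|apply: Hd].
  apply: filterS => p dp; rewrite /ft.
  pose g (k : 'I_n) : Caff R -> R[i]^o := (j%:R ^+ k : R[i]) *: f k.
  have -> : (fun q => \sum_(k < n) (j%:R ^+ k : R[i]^o) *: f k q) = \sum_(k < n) g k.
    by apply/funext => q; rewrite fct_sumE.
  by apply: differentiable_sum => k; apply: differentiableZ.
have [m Hm] := choice (fun j => root_count_holo Pm Pirr sP rho0 rhoP (hft j)).
have main := pnear_and (pnear_ord (n := N) (Q := fun j x =>
  root_count [set p | ft j p = 0%R] x = m j) (fun j _ => Hm j))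
  (cnear_pnear (root_count_eq Pm rho0 rhoP Af)).
have le1 x j : (root_count [set p | forall k, f k p = 0%R] x <=
    root_count [set p | ft j p = 0%R] x)%N.
  apply: sub_count => y /= /andP[-> /asboolP fk] /=; apply/asboolP.
  by rewrite /ft big1 // => k _; rewrite fk scaler0.
have ex x : exists2 j, (j < N)%N & (root_count [set p | ft j p = 0%R] x <=
    root_count [set p | forall k, f k p = 0%R] x)%N.
  pose q y : {poly C} := \sum_(k < n) f k (x, y) *: 'X^k.
  pose S := [seq q y | y <- rts P x & q y != 0].
  have sS : (size S <= (size P).-1)%N.
    by rewrite size_map size_filter; apply: leq_trans (count_size _ _) _; rewrite size_rts.
  have qn y : (size (q y) <= n)%N.
    apply: leq_trans (size_sum _ _ _) _; apply/bigmax_leqP => k _.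
    by apply: leq_trans (size_scale_leq _ _) _; rewrite size_polyXn.
  have Q0 : \prod_(p <- S) p != 0.
    rewrite prodf_seq_neq0; apply/allP => p /mapP[y]; rewrite mem_filter => /andP[qy _] -> /=.
    by [].
  have [j jN Hj] : exists2 j, (j < N)%N & (\prod_(p <- S) p).[j%:R] != 0.
    apply: contrapT => nj.
    have /max_poly_roots := Q0.
    move=> /(_ [seq j%:R | j <- iota 0 N] _ _)/wrap[||].
    - apply/allP => z /mapP[j]; rewrite mem_iota add0n => jN ->.
      by apply/negPn/negP => Hj; apply: nj; exists j.
    - by rewrite map_inj_uniq ?iota_uniq // => i i' /eqP; rewrite eqr_nat => /eqP.
    rewrite size_map size_iota => lt.
    have sz : (size (\prod_(p <- S) p)%R <= (n * size S).+1)%N.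
      by apply: size_prod_le => q' /mapP[y _ ->]; apply: leqW.
    have : (n * size S <= n * (size P).-1)%N by rewrite leq_mul2l sS orbT.
    by have := leq_trans lt sz; rewrite /N !ltnS => h1 h2; have := leq_trans h1 h2; rewrite ltnn.
  exists j => //; apply: count_le_in => y yr /= /andP[-> /asboolP fj] /=; apply/asboolP.
  have ftq : ft j (x, y) = (q y).[j%:R].
    rewrite /ft /q horner_sum; apply: eq_bigr => k _.
    by rewrite hornerZ hornerXn mulrC.
  have qy0 : q y = 0.
    apply/eqP/negPn/negP => qy; case/negP: Hj.
    rewrite horner_prod prodf_seq_eq0; apply/hasP; exists (q y) => /=.
      by apply/mapP; exists y => //; rewrite mem_filter qy.
    by rewrite -ftq; apply/eqP.
  move=> k; have := congr1 (fun p : {poly C} => p`_k) qy0.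
  rewrite coef0 /q coef_sum (bigD1 k) //= coefZ coefXn eqxx mulr1 big1 ?addr0 //.
  move=> i ik; rewrite coefZ coefXn; case: eqP => [E|]; last by rewrite mulr0.
  by case/eqP: ik; apply: val_inj.
have le x x' : (forall j, (j < N)%N -> root_count [set p | ft j p = 0%R] x = m j) ->
    (forall j, (j < N)%N -> root_count [set p | ft j p = 0%R] x' = m j) ->
    (root_count [set p | forall k, f k p = 0%R] x <=
     root_count [set p | forall k, f k p = 0%R] x')%N.
  move=> Hx Hx'; have [j jN] := ex x'; apply: leq_trans.
  by rewrite Hx' // -(Hx j jN); exact: le1.
have [x0 [H0 _]] := pnear_ex main.
exists (root_count [set p | forall k, f k p = 0%R] x0); apply: pnearW main => x [Hx ->].
by apply/eqP; rewrite eqn_leq !le.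
Qed.

Lemma germ_subI A B : germ_sub (A `&` B) A.
Proof. by apply: (near_CaffP _).2; exists 1 => // x y _ _ []. Qed.

Lemma germ_sub_trans A B D : germ_sub A B -> germ_sub B D -> germ_sub A D.
Proof.
move=> /near_CaffP[e e0 H] /near_CaffP[d d0 H']; apply/near_CaffP.
exists (Num.min e d); first by rewrite lt_min e0.
move=> x y; rewrite !lt_min => /andP[xe xd] /andP[ye yd] Axy.
by apply: H' => //; apply: H.
Qed.

Lemma germ_eq_subP A B : germ_eq A B <-> germ_sub A B /\ germ_sub B A.
Proof.
split=> [AB|[]].
  by split; apply: (@filterS _ _ (nbhs_filter _) _ _ _ AB) => p [].
move=> /near_CaffP[e e0 H] /near_CaffP[d d0 H']; apply/near_CaffP.
exists (Num.min e d); first by rewrite lt_min e0.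
move=> x y; rewrite !lt_min => /andP[xe xd] /andP[ye yd].
by split=> ?; [apply: H|apply: H'].
Qed.

Lemma germ_eq_trans A B D : germ_eq A B -> germ_eq B D -> germ_eq A D.
Proof.
move=> /germ_eq_subP[ab ba] /germ_eq_subP[bd db]; apply/germ_eq_subP; split.
  exact: germ_sub_trans bd.
exact: germ_sub_trans ba.
Qed.

Lemma germ_eq2 (op : Prop -> Prop -> Prop) A A' B B' : germ_eq A A' -> germ_eq B B' ->
  (forall a a' b b' : Prop, (a <-> a') -> (b <-> b') -> (op a b <-> op a' b')) ->
  germ_eq [set p | op (A p) (B p)] [set p | op (A' p) (B' p)].
Proof.
move=> /near_CaffP[e e0 H] /near_CaffP[d d0 H'] Hop; apply/near_CaffP.
exists (Num.min e d); first by rewrite lt_min e0.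
move=> x y; rewrite !lt_min => /andP[xe xd] /andP[ye yd].
by apply: Hop; [exact: H|exact: H'].
Qed.

Lemma analytic_germI A B : analytic_germ A -> analytic_germ B -> analytic_germ (A `&` B).
Proof.
move=> [n [f [hf Af]]] [m [g [hg Bg]]].
exists (n + m)%N, (fun k => match fintype.split k with inl i => f i | inr j => g j end).
split; first by move=> k; case: fintype.split.
apply: germ_eq_trans (germ_eq2 (op := and) Af Bg _) _; first by tauto.
apply: (near_CaffP _).2; exists 1 => // x y _ _; split=> /= [[fx gx] k|H].
  by case: fintype.split.
split=> i; first by have := H (lshift m i); rewrite -[lshift m i]/(unsplit (inl i)) unsplitK.
by have := H (rshift n i); rewrite -[rshift n i]/(unsplit (inr i)) unsplitK.
Qed.

Lemma analytic_germU A B : analytic_germ A -> analytic_germ B -> analytic_germ (A `|` B).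
Proof.
move=> [n [f [hf Af]]] [m [g [hg Bg]]].
pose T : finType := ('I_n * 'I_m)%type.
exists #|T|, (fun k => f (enum_val k).1 * g (enum_val k).2); split.
  move=> k; have [e e0 He] := (holo_near _).1 (hf (enum_val k).1).
  have [d d0 Hd] := (holo_near _).1 (hg (enum_val k).2).
  apply/holo_near; exists (Num.min e d); first by rewrite lt_min e0.
  move=> x y; rewrite !lt_min => /andP[xe xd] /andP[ye yd].
  by apply: differentiableM; [apply: He|apply: Hd].
apply: germ_eq_trans (germ_eq2 (op := or) Af Bg _) _; first by tauto.
apply: (near_CaffP _).2; exists 1 => // x y _ _; split=> /= [|H].
  by move=> [fx|gx] k; rewrite -[(_ * _) _]/(_ * _) ?fx ?gx ?mul0r ?mulr0.
have [fx|nfx] := pselect (forall k, f k (x, y) = 0); [by left|right=> j].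
apply: contrapT => gj; apply: nfx => i; apply/eqP/negPn/negP => fi.
have := H (enum_rank ((i, j) : T)); rewrite enum_rankK => /eqP.
by rewrite -[(_ * _) _]/(_ * _) mulf_eq0 (negbTE fi) /= => /eqP.
Qed.

Lemma analytic_germ0 : analytic_germ (classical_sets.set0 : set (Caff R)).
Proof.
exists 1%N, (fun _ _ => 1); split.
  by move=> k; apply/holo_near; exists 1 => // x y _ _; exact: differentiable_cst.
by apply: (near_CaffP _).2; exists 1 => // x y _ _; split=> //= /(_ ord0)/eqP; rewrite oner_eq0.
Qed.

Definition unionN (B : nat -> set (Caff R)) n : set (Caff R) :=
  [set p | exists2 i, (i < n)%N & B i p].

Lemma unionNS (B : nat -> set (Caff R)) n : unionN B n.+1 = unionN B n `|` B n.
Proof.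
apply/funext => p; apply/propext; split=> [[k kl Bk]|[[k kl Bk]|Bn]].
- move: kl; rewrite ltnS leq_eqVlt => /orP[/eqP E|kl]; last by left; exists k.
  by right; rewrite -E.
- by exists k => //; apply: ltnW.
- by exists n.
Qed.

Lemma unionN0 (B : nat -> set (Caff R)) : unionN B 0 = classical_sets.set0.
Proof. by apply/funext => p; apply/propext; split=> // -[]. Qed.

Lemma analytic_unionN (B : nat -> set (Caff R)) n :
  (forall i, (i < n)%N -> analytic_germ (B i)) -> analytic_germ (unionN B n).
Proof.
elim: n => [|n IH] H; first by rewrite unionN0; exact: analytic_germ0.
rewrite unionNS; apply: analytic_germU; last exact: H.
by apply: IH => i il; apply: H; apply: ltnW.
Qed.

Lemma irreducible_in_union D (B : nat -> set (Caff R)) n : irreducible_germ D ->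
  (forall i, (i < n)%N -> analytic_germ (B i)) -> germ_sub D (unionN B n) ->
  exists2 i, (i < n)%N & germ_sub D (B i).
Proof.
move=> [aD D0 Dirr]; elim: n => [|n IH] aB DB.
  exfalso; apply: D0; apply/germ_eq_subP; split; first by rewrite unionN0 in DB.
  by apply: (near_CaffP _).2; exists 1.
have aU : analytic_germ (unionN B n).
  by apply: analytic_unionN => i il; apply: aB; apply: ltnW.
have [|E|E] := Dirr _ _ (analytic_germI aD aU) (analytic_germI aD (aB n (ltnSn n))).
- rewrite -classical_sets.setIUr -unionNS; apply/germ_eq_subP; split; last exact: germ_subI.
  move: DB => /near_CaffP[e e0 H]; apply/near_CaffP; exists e => // x y xe ye Dxy.
  by split=> //; apply: H.
- have [|i il Di] := IH (fun i il => aB i (ltnW il)).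
    apply: germ_sub_trans ((germ_eq_subP _ _).1 E).1 _.
    by rewrite classical_sets.setIC; exact: germ_subI.
  by exists i => //; apply: ltnW.
- exists n => //; apply: germ_sub_trans ((germ_eq_subP _ _).1 E).1 _.
  by rewrite classical_sets.setIC; exact: germ_subI.
Qed.

Lemma eq_count_imp (T : eqType) (a b : pred T) (s : seq T) :
  {in s, forall t, a t -> b t} -> (count b s <= count a s)%N ->
  {in s, forall t, b t -> a t}.
Proof.
elim: s => // z s IH ab /=.
have abs : {in s, forall t, a t -> b t} by move=> t ts; apply: ab; rewrite inE ts orbT.
have le : (count a s <= count b s)%N.
  by apply: count_le_in.
have zab := ab z (mem_head _ _).
move=> h t; rewrite inE => /orP[/eqP ->|ts] bt.
  by move: h; rewrite bt; case: (a z) zab => // _; lia.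
apply: (IH abs) => //.
by move: h; case: (a z) zab => [/(_ isT) ->|_]; [lia|case: (b z) => /=; lia].
Qed.

Definition curve_germ : set (Caff R) := [set p | ev2 P p.1 p.2 = 0].

(* The number of points over [x <> 0], plus one if the germ contains the
   origin, decreases strictly along proper inclusions. *)
Lemma germ_decomposition A : analytic_germ A -> germ_sub A curve_germ ->
  exists n (B : nat -> set (Caff R)), (forall i, (i < n)%N -> irreducible_germ (B i)) /\ germ_eq A (unionN B n).
Proof.
move=> aA; have [n0 Hn0] := root_count_analytic aA.
have [N] := ubnP (n0 + `[< A (0 : Caff R)%R >])%N.
elim: N A aA n0 Hn0 => // N IH A aA n Hn nN Ac.
have [E0|E0] := pselect (germ_eq A classical_sets.set0).
  by exists 0%N, (fun=> classical_sets.set0); split=> //; rewrite unionN0.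
have [irr|nirr] := pselect (irreducible_germ A).
  exists 1%N, (fun=> A); split=> // ; apply: (near_CaffP _).2; exists 1 => // x y _ _.
  by split=> [?|[]//]; exists 0%N.
have [A1 [A2 [a1 a2 E nE1 nE2]]] : exists A1 A2, [/\ analytic_germ A1, analytic_germ A2,
    germ_eq A (A1 `|` A2), ~ germ_eq A A1 & ~ germ_eq A A2].
  apply: contrapT => nex; apply: nirr; split=> // A1 A2 a1 a2 E.
  have [E1|nE1] := pselect (germ_eq A A1); [by left|right].
  by apply: contrapT => nE2; apply: nex; exists A1, A2.
have part A' : analytic_germ A' -> germ_sub A' A -> ~ germ_eq A A' ->
    exists m (B : nat -> set (Caff R)), (forall i, (i < m)%N -> irreducible_germ (B i)) /\ germ_eq A' (unionN B m).
  move=> a' sub ne; have [n' Hn'] := root_count_analytic a'.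
  apply: (IH _ a' n' Hn'); last exact: germ_sub_trans Ac.
  have subc := cnear_pnear (root_count_sub Pm rho0 rhoP sub).
  have all3 := pnear_and Hn (pnear_and Hn' subc).
  have n'n : (n' <= n)%N.
    have [x [<- [<- Hx]]] := pnear_ex all3; apply: count_le_in => y yr /= /andP[yrho /asboolP ?].
    by rewrite yrho; apply/asboolP; exact: Hx.
  have [s s0 Hs] := (near_CaffP _).1 sub.
  have b'b : (`[< A' (0 : Caff R)%R >] <= `[< A (0 : Caff R)%R >])%N.
    have [A'0|//] := asboolP (A' 0); have -> // : `[< A (0 : Caff R)%R >].
    by apply/asboolP; apply: (Hs 0 0); rewrite ?cabs0.
  rewrite -ltnS; apply: leq_trans nN; rewrite ltnS ltn_neqAle leq_add // andbT.
  apply/eqP => Em; apply: ne; apply/germ_eq_subP; split=> //.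
  have En : n' = n by lia.
  have Eb : `[< A (0 : Caff R)%R >] -> `[< A' (0 : Caff R)%R >] by move: Em b'b; case: `[< A (0 : Caff R)%R >]; case: `[< A' (0 : Caff R)%R >] => //=; lia.
  have [d d0 Hd] := all3.
  have [c c0 Hc] := (near_CaffP _).1 Ac.
  apply/near_CaffP; exists (Num.min (Num.min d c) rho); first by rewrite !lt_min d0 c0.
  move=> x y; rewrite !lt_min => /andP[/andP[xd xc] xr] /andP[/andP[yd yc] yr] Axy.
  have Pxy := Hc x y xc yc Axy; rewrite /curve_germ /= in Pxy.
  have yroot : y \in rts P x by rewrite mem_rts // Pxy.
  have [x0|x0] := eqVneq x 0; last first.
    have [Hx [Hx' Hxs]] := Hd x ltac:(by rewrite cabs_gt0 x0).
    have := @eq_count_imp _ (fun y => (cabs y < rho) && `[< A' (x, y) >])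
      (fun y => (cabs y < rho) && `[< A (x, y) >]) (rts P x).
    move=> /(_ _ _ _ yroot)/wrap[||].
    - move=> t tr /andP[trho /asboolP A't]; rewrite trho; apply/asboolP; exact: Hxs.
    - by rewrite -/(root_count A x) -/(root_count A' x) Hx Hx' En.
    by rewrite yr => /(_ ltac:(by apply/asboolP))/asboolP.
  have [y0|y0] := eqVneq y 0.
    by move: Axy; rewrite x0 y0 => /asboolP/Eb/asboolP.
  by exfalso; move: yroot; rewrite x0 => yr0; have := rhoP yr0 y0; rewrite leNgt (lt_trans yr) // ltr_pMl // ltr1n.
have s1 : germ_sub A1 A.
  apply: germ_sub_trans ((germ_eq_subP _ _).1 E).2.
  by apply: (near_CaffP _).2; exists 1 => // x y _ _; left.
have s2 : germ_sub A2 A.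
  apply: germ_sub_trans ((germ_eq_subP _ _).1 E).2.
  by apply: (near_CaffP _).2; exists 1 => // x y _ _; right.
have [m1 [B1 [iB1 E1]]] := part A1 a1 s1 nE1.
have [m2 [B2 [iB2 E2]]] := part A2 a2 s2 nE2.
exists (m1 + m2)%N, (fun i => if (i < m1)%N then B1 i else B2 (i - m1)%N); split.
  by move=> i im; case: ltnP => [/iB1//|mi]; apply: iB2; lia.
apply: germ_eq_trans E _; apply: germ_eq_trans (germ_eq2 (op := or) E1 E2 _) _; first by tauto.
apply: (near_CaffP _).2; exists 1 => // x y _ _; split=> /= [[ [i im Bi] | [i im Bi] ] | [i im] ].
- by exists i; [lia|rewrite im].
- exists (m1 + i)%N; first by rewrite ltn_add2l.
  by rewrite ltnNge leq_addr /= addKn.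
- by case: ltnP => [lt Bi|ge Bi]; [left; exists i|right; exists (i - m1)%N => //; lia].
Qed.

(** Take a decomposition with the fewest irreducible germs. An irreducible germ between [B i] and
    [A] lies in some [B j], and [j <> i] would make [B i] redundant. *)
Lemma germ_components A : analytic_germ A -> germ_sub A curve_germ ->
  exists n (B : nat -> set (Caff R)), (forall i, (i < n)%N -> germ_component A (B i)) /\ germ_eq A (unionN B n).
Proof.
move=> aA Ac.
pose ok n := `[< exists B : nat -> set (Caff R), (forall i, (i < n)%N -> irreducible_germ (B i)) /\
  germ_eq A (unionN B n) >].
have exn : exists n, ok n.
  by have [n [B HB]] := germ_decomposition aA Ac; exists n; apply/asboolP; exists B.
have [n /asboolP[B [iB E]] minn] := ex_minnP exn.
exists n, B; split=> // i il.
have subB : germ_sub (B i) A.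
  apply: germ_sub_trans ((germ_eq_subP _ _).1 E).2.
  by apply: (near_CaffP _).2; exists 1 => // x y _ _ ?; exists i.
split=> //; first exact: iB.
move=> B' iB' B'A BB'.
have aB j : (j < n)%N -> analytic_germ (B j) by move=> /iB[].
have [j jn B'j] := irreducible_in_union iB' aB
  (germ_sub_trans B'A ((germ_eq_subP _ _).1 E).1).
have [ij|ij] := eqVneq i j.
  by apply/germ_eq_subP; split=> //; rewrite ij.
have Bij := germ_sub_trans BB' B'j.
exfalso; have : (n <= n.-1)%N; last by lia.
(* [bump i] skips the index [i]; the remaining germs still cover, since [B i] lies in [B j]. *)
apply: minn; apply/asboolP; exists (fun k => B (bump i k)); split.
  by move=> k kn; apply: iB; rewrite /bump; lia.
apply: germ_eq_trans E _; apply/germ_eq_subP; split; last first.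
  apply: (near_CaffP _).2; exists 1 => // x y _ _ [k kn Bk]; exists (bump i k) => //.
  by rewrite /bump; lia.
have [e e0 He] := (near_CaffP _).1 Bij.
have reidx k : (k < n)%N -> k != i -> (unbump i k < n.-1)%N /\ bump i (unbump i k) = k.
  by move=> kn ki; rewrite unbumpK //; split=> //; rewrite /unbump; lia.
apply: (near_CaffP _).2; exists e => // x y xe ye [k kn Bk].
have [ki|ki] := eqVneq k i; last first.
  by have [h1 h2] := reidx k kn ki; exists (unbump i k); rewrite ?h2.
have [h1 h2] := reidx j jn ltac:(by rewrite eq_sym); exists (unbump i j) => //.
by rewrite h2; apply: He => //; rewrite -ki.
Qed.

End GermDecomposition.

(** * The local branches of a projective curve in a chart *)

Section LocalBranches.
Variable R : realType.
Local Notation C := R[i].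

Definition caff_fst (p : Caff R) : R[i]^o := p.1.
Definition caff_snd (p : Caff R) : R[i]^o := p.2.

Fact caff_fst_linear : linear caff_fst. Proof. by []. Qed.
Fact caff_snd_linear : linear caff_snd. Proof. by []. Qed.

HB.instance Definition _ := GRing.isLinear.Build R[i] (Caff R) (R[i]^o) _
  caff_fst caff_fst_linear.
HB.instance Definition _ := GRing.isLinear.Build R[i] (Caff R) (R[i]^o) _
  caff_snd caff_snd_linear.

Lemma differentiable_ev2 (P : {poly {poly C}}) (p : Caff R) :
  differentiable (fun q : Caff R => ev2 P q.1 q.2 : R[i]^o) p.
Proof.
have d1 : differentiable (fun q : Caff R => q.1 : R[i]^o) p.
  by apply: (@linear_differentiable _ _ _ caff_fst) => q; exact: cvg_fst.
have d2 : differentiable (fun q : Caff R => q.2 : R[i]^o) p.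
  by apply: (@linear_differentiable _ _ _ caff_snd) => q; exact: cvg_snd.
have dc (c : {poly C}) : differentiable (fun q : Caff R => c.[q.1] : R[i]^o) p.
  elim/poly_ind: c => [|c a IH].
    by under eq_fun do rewrite horner0; exact: differentiable_cst.
  under eq_fun do rewrite hornerMXaddC.
  apply: (differentiableD (f := fun q : Caff R => c.[q.1] * q.1 : R[i]^o)); last exact: differentiable_cst.
  exact: (differentiableM (f := fun q : Caff R => c.[q.1] : R[i]^o) (g := fun q : Caff R => q.1 : R[i]^o)).
elim/poly_ind: P => [|P c IH].
  by under eq_fun do rewrite ev2_0; exact: differentiable_cst.
under eq_fun do rewrite ev2D ev2M ev2X ev2C.
apply: (differentiableD (f := fun q : Caff R => ev2 P q.1 q.2 * q.2 : R[i]^o)) => //.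
exact: (differentiableM (f := fun q : Caff R => ev2 P q.1 q.2 : R[i]^o) (g := fun q : Caff R => q.2 : R[i]^o)).
Qed.

Lemma chart_vecE (M : affine_chart R) (x y : C) :
  chart_vec M (x, y) = aff (frame M) x y.
Proof. by []. Qed.

Lemma zero_locus_line d (F : mpoly 3 C) (O : CP2 R) (v : 'rV[C]_3) :
  F \is ishomog1 d mdeg -> sval O = <[v]>%VS ->
  zero_locus F O <-> meval (v 0) F = 0.
Proof.
move=> hF Ov; split=> [H|Fv u]; first by apply: H; rewrite Ov memv_line.
by rewrite Ov => /vlineP[k ->]; rewrite (meval_homog _ _ hF) Fv mulr0.
Qed.

Lemma chart_inj (M : affine_chart R) : injective (chart M).
Proof.
move=> [x y] [x' y'] /(congr1 sval) /= E.
have : chart_vec M (x, y) \in <[chart_vec M (x', y')]>%VS.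
  by rewrite -E memv_line.
move=> /vlineP[k] /(congr1 (fun v => v *m invmx (frame M))).
rewrite -scalemxAl /chart_vec !mulmxK ?frame_unit // => /rowP E'.
have := E' 0; have := E' 1; have := E' 2%:R; rewrite !mxE /= mulr1 => + + k1.
by rewrite -k1 !mul1r => -> ->.
Qed.

(** Scaled to be monic in [y], provided the last frame vector is off the curve. *)
Definition curve_poly (A : 'M[C]_3) (F : mpoly 3 C) : {poly {poly C}} :=
  ((meval (row ord_max A 0) F)^-1)%:P *: dehomog A F.

Section CurvePoly.
Variables (d : nat) (F : mpoly 3 C) (A : 'M[C]_3).
Hypothesis hF : F \is ishomog1 d mdeg.
Hypothesis Firr : mpoly_irreducible F.
Hypothesis Au : A \in unitmx.
Hypothesis Fe : meval (row ord_max A 0) F != 0.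

Lemma ev2_curve_poly x y : ev2 (curve_poly A F) x y =
  (meval (row ord_max A 0) F)^-1 * meval (aff A x y 0) F.
Proof. by rewrite ev2Z hornerC ev2_dehomog. Qed.

Lemma ev2_curve_poly_eq0 x y : (ev2 (curve_poly A F) x y == 0) = (meval (aff A x y 0) F == 0).
Proof. by rewrite ev2_curve_poly mulf_eq0 invr_eq0 (negbTE Fe). Qed.

Lemma curve_poly_irr : birreducible (curve_poly A F).
Proof.
have [Fnu Fi] := Firr.
have [nu irr] := birreducible_dehomog Au hF Fnu Fi Fe.
have cu : (meval (row ord_max A 0) F)^-1%:P%:P \is a GRing.unit.
  by do 2! apply: rmorph_unit; rewrite unitfE invr_eq0.
rewrite /curve_poly -mul_polyC; split; first by rewrite unitrM (negbTE nu) andbF.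
move=> G H E; have E' : dehomog A F = ((meval (row ord_max A 0) F)^-1%:P%:P^-1 * G) * H.
  by rewrite -mulrA -E mulKr.
by case: (irr _ _ E'); [rewrite unitrM => /andP[]|]; [left|right].
Qed.

Lemma curve_poly_degree : size (curve_poly A F) = d.+1 /\ curve_poly A F \is monic.
Proof.
have [s c] := size_coef_dehomog A hF.
have sz : size (curve_poly A F) = d.+1.
  apply/eqP; rewrite size_scale ?polyC_eq0 ?invr_eq0 // eqn_leq s /=.
  rewrite ltnNge; apply/negP => sd.
  by move: c; rewrite nth_default // => /eqP; rewrite eq_sym polyC_eq0 (negbTE Fe).
split=> //; rewrite monicE lead_coefE sz /curve_poly coefZ c -polyCM mulVf //.
Qed.

Lemma curve_degree_gt0 : (0 < d)%N.
Proof.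
have [sz mon] := curve_poly_degree; have [nu _] := curve_poly_irr.
rewrite lt0n; apply/eqP => d0; case/negP: nu.
have /eqP/size_poly1P[c c0 E] : size (curve_poly A F) = 1%N by rewrite sz d0.
by move: mon; rewrite E monicE lead_coefC => /eqP ->; exact: unitr1.
Qed.

End CurvePoly.

(** Reduces an estimate near a point of the curve to finitely many estimates, one on each local
    branch. *)
Lemma local_branches_cover (d : nat) (F : mpoly 3 C) (gamma : set (CP2 R)) (O : CP2 R)
    (M : affine_chart R) :
  F \is ishomog1 d mdeg -> mpoly_irreducible F -> gamma = zero_locus F ->
  meval (row ord_max (frame M) 0) F != 0 -> centered M O ->
  exists n (b : nat -> set (CP2 R)), (forall j, (j < n)%N -> local_branch gamma O (b j)) /\
  exists2 e : R, 0 < e & forall x y : C, cabs x < e -> cabs y < e ->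
    meval (aff (frame M) x y 0) F = 0 -> exists2 j, (j < n)%N & b j (chart M (x, y)).
Proof.
move=> hF Firr gE Fe cM; set P := curve_poly (frame M) F.
have Pirr := curve_poly_irr hF Firr (frame_unit M) Fe.
have [sz Pm] := curve_poly_degree hF Fe.
have d0 := curve_degree_gt0 hF Firr (frame_unit M) Fe.
have sP : (1 < size P)%N by rewrite sz ltnS.
have [rho rho0 rhoP] := root_radius P.
have curveE (p : Caff R) : (chart M @^-1` gamma) p <-> curve_germ P p.
  case: p => x y; rewrite /preimage /= gE (zero_locus_line hF (v := chart_vec M (x, y))) //.
  rewrite /curve_germ /= chart_vecE; split => /eqP H; apply/eqP.
    by rewrite ev2_curve_poly_eq0.
  by move: H; rewrite ev2_curve_poly_eq0.
have aG : analytic_germ (chart M @^-1` gamma).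
  exists 1%N, (fun _ p => ev2 P p.1 p.2); split.
    by move=> _; apply/holo_near; exists 1 => // x y _ _; exact: differentiable_ev2.
  apply: (near_CaffP _).2; exists 1 => // x y _ _; split.
    by move=> /curveE ? k.
  by move=> H; apply/curveE; exact: H ord0.
have sG : germ_sub (chart M @^-1` gamma) (curve_germ P).
  by apply: (near_CaffP _).2; exists 1 => // x y _ _ /curveE.
have [n [B [cB E]]] := germ_components Pm Pirr sP rho0 rhoP aG sG.
have preim j : chart M @^-1` (chart M @` B j) = B j.
  apply/funext => p; apply/propext; split=> [[q Bq /chart_inj <-]//|Bp].
  by exists p.
exists n, (fun j => chart M @` B j); split.
  by move=> j jn; exists M; rewrite preim; split=> //; exact: cB.
have [e e0 He] := (near_CaffP _).1 ((germ_eq_subP _ _).1 E).1.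
exists e => // x y xe ye Fxy.
have [|j jn Bj] := He x y xe ye.
  by apply/curveE; rewrite /curve_germ /=; apply/eqP; rewrite ev2_curve_poly_eq0 // Fxy.
by exists j => //; exists (x, y).
Qed.

End LocalBranches.

(** * Jets and Wronskians *)

Section Jets.
Variable K : numClosedFieldType.
Implicit Types (f g p q r u v : {poly K}) (P Q : {poly {poly K}}) (n N : nat).

(** Power series are represented by polynomials modulo ['X^N]. *)
Definition jeq N p q := forall j, (j < N)%N -> p`_j = q`_j.

Lemma jeqP N p q : jeq N p q <-> 'X^N %| p - q.
Proof.
split=> [H|/dvdpP[r E] j jN]; last first.
  by apply/eqP; rewrite -subr_eq0 -coefB E coefMXn jN.
apply/dvdpP; exists (drop_poly N (p - q)).
rewrite -[LHS](poly_take_drop N) [take_poly _ _](_ : _ = 0) ?add0r //.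
by apply/polyP => j; rewrite coef_take_poly coef0 coefB; case: ltnP => // /H ->; rewrite subrr.
Qed.

Lemma jeq_refl N p : jeq N p p. Proof. by []. Qed.

Lemma jeq_sym N p q : jeq N p q -> jeq N q p.
Proof. by move=> H j jN; rewrite H. Qed.

Lemma jeq_trans N p q r : jeq N p q -> jeq N q r -> jeq N p r.
Proof. by move=> H H' j jN; rewrite H // H'. Qed.

Lemma jeqW N N' p q : (N' <= N)%N -> jeq N p q -> jeq N' p q.
Proof. by move=> NN H j jN; apply: H; apply: leq_trans NN. Qed.

Lemma jeqD N p q p' q' : jeq N p q -> jeq N p' q' -> jeq N (p + p') (q + q').
Proof. by move=> H H' j jN; rewrite !coefD H // H'. Qed.

Lemma jeqM N p q p' q' : jeq N p q -> jeq N p' q' -> jeq N (p * p') (q * q').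
Proof.
move=> /jeqP H /jeqP H'; apply/jeqP.
have -> : p * p' - q * q' = (p - q) * p' + q * (p' - q') by ring.
by apply: dvdp_add; [apply: dvdp_mulr|apply: dvdp_mull].
Qed.

Lemma jeqX N p q n : jeq N p q -> jeq N (p ^+ n) (q ^+ n).
Proof. by move=> H; elim: n => [//|n IH]; rewrite !exprS; apply: jeqM. Qed.

Lemma jeq_sum N (I : Type) (s : seq I) (F G : I -> {poly K}) :
  (forall i, jeq N (F i) (G i)) -> jeq N (\sum_(i <- s) F i) (\sum_(i <- s) G i).
Proof.
by move=> H; elim: s => [|i s IH]; rewrite ?big_nil // !big_cons; apply: jeqD.
Qed.

Lemma jeq_comp N p q r : r`_0 = 0 -> jeq N p q -> jeq N (p \Po r) (q \Po r).
Proof.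
move=> r0 /jeqP/dvdpP[s E]; apply/jeqP; rewrite -comp_polyB E comp_polyM comp_Xn_poly.
apply: dvdp_mull; have /dvdpP[t ->] : 'X %| r.
  by rewrite -['X]subr0 -polyC0 dvdp_XsubCl rootE horner_coef0 r0.
by rewrite exprMn dvdp_mull ?dvdpp.
Qed.

Lemma jeq_compr N p q r : jeq N q r -> jeq N (p \Po q) (p \Po r).
Proof.
move=> qr; elim/poly_ind: p => [|p c IH]; first by rewrite !comp_poly0.
by rewrite !comp_polyD !comp_polyM !comp_polyX !comp_polyC; apply: jeqD => //; apply: jeqM.
Qed.

Lemma jeq_cancel N p q : p`_0 != 0 -> jeq N (p * q) 0 -> jeq N q 0.
Proof.
move=> p0 /jeqP; rewrite subr0 => H; apply/jeqP; rewrite subr0.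
rewrite Gauss_dvdpr // in H; apply: coprimep_expl.
by rewrite coprimep_sym coprimepX rootE horner_coef0.
Qed.

Lemma jeq_inv N p : p`_0 != 0 -> exists q, jeq N (p * q) 1.
Proof.
move=> p0; have : coprimep 'X^N p.
  by apply: coprimep_expl; rewrite coprimep_sym coprimepX rootE horner_coef0.
move=> /Bezout_eq1_coprimepP[[u v] /= E]; exists v; apply/jeqP.
have -> : p * v - 1 = - u * 'X^N by rewrite -E; ring.
by rewrite dvdp_mull ?dvdpp.
Qed.

Lemma taylor2 (S : comNzRingType) (q : {poly S}) (a b : S) :
  exists w, q.[a] = q.[b] + (a - b) * (deriv q).[b] + (a - b) ^+ 2 * w.
Proof.
elim/poly_ind: q => [|q c [w E]]; first by exists 0; rewrite deriv0 !horner0; ring.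
exists (w * a + (deriv q).[b]); rewrite derivMXaddC !hornerMXaddC hornerD hornerM hornerX E.
by ring.
Qed.

(** The formal inverse function theorem: as [q'(0)] is invertible, the coefficients of [r] are found
    one order at a time. *)
Lemma jeq_solve N q p : (deriv q)`_0 != 0 -> p`_0 = q`_0 ->
  exists2 r : {poly K}, r`_0 = 0 & jeq N (q \Po r) p.
Proof.
move=> q0 pq; elim: N => [|N [r r0 H]]; first by exists 0; rewrite ?coef0.
case: N r r0 H => [|N] r r0 H.
  exists 0; first by rewrite coef0.
  by case=> // _; rewrite comp_poly0r coefC eqxx pq.
(* [c] is the discrepancy in the next coefficient divided by [q'(0)]; the second order term of the
   expansion has too high an order to interfere. *)
pose m := (deriv q)`_0; pose c := (p - (q \Po r))`_N.+1 / m.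
exists (r + c *: 'X^(N.+1)).
  by rewrite coefD coefZ coefXn /= mulr0 addr0.
have [w E] := taylor2 (map_poly polyC q) (r + c *: 'X^(N.+1)) r.
have {}E : q \Po (r + c *: 'X^(N.+1)) = q \Po r + (c *: (deriv q \Po r)) * 'X^(N.+1)
    + (c ^+ 2 *: w) * 'X^(N.+1 * 2).
  rewrite /comp_poly E deriv_map (_ : r + _ - r = c *: 'X^(N.+1)); last first.
    by rewrite addrAC subrr add0r.
  rewrite -!mul_polyC exprM (rmorphXn (@polyC K)) /=.
  by ring.
move=> j; rewrite E ltnS leq_eqVlt => /orP[/eqP ->|jN].
  rewrite !coefD !coefMXn ltnn subnn ifT; last by lia.
  have -> : (c *: (deriv q \Po r))`_0 = c * m.
    by rewrite coefZ -horner_coef0 horner_comp horner_coef0 r0 horner_coef0.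
  by rewrite divfK // coefB; ring.
by rewrite !coefD !coefMXn jN ifT ?addr0; [exact: H|lia].
Qed.

End Jets.

(** * Wronskians of jets and their transformation rules *)

Section CoefficientDeterminants.
Variable K : numClosedFieldType.
Implicit Types (f g p q r u v : {poly K}) (n N : nat).

(* [wr fs] is the Wronskian of the power series [fs] at 0, divided by
   [\prod_j j!]. *)
Definition jet_mx n (fs : 'I_n -> {poly K}) : 'M[K]_n := \matrix_(i, j) (fs i)`_j.

Definition wr n (fs : 'I_n -> {poly K}) : K := \det (jet_mx fs).

Lemma wr_jeq n (fs gs : 'I_n -> {poly K}) : (forall i, jeq n (fs i) (gs i)) ->
  wr fs = wr gs.
Proof.
by move=> H; congr (\det _); apply/matrixP => i j; rewrite !mxE H.
Qed.

Lemma det_upper n (T : 'M[K]_n) : (forall i j : 'I_n, (j < i)%N -> T i j = 0) ->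
  \det T = \prod_i T i i.
Proof.
move=> H; rewrite -det_tr det_trig; first by apply: eq_bigr => i _; rewrite mxE.
by apply/is_trig_mxP => i j ij; rewrite mxE H.
Qed.

(** Multiplication by [u] acts on coefficients by a triangular matrix with constant diagonal
    [u(0)]. *)
Lemma wr_mul n u (fs : 'I_n -> {poly K}) :
  wr (fun i => u * fs i) = u`_0 ^+ n * wr fs.
Proof.
pose T : 'M[K]_n := \matrix_(k, j) if (k <= j)%N then u`_(j - k) else 0.
have E : jet_mx (fun i => u * fs i) = jet_mx fs *m T.
  apply/matrixP => i j; rewrite !mxE mulrC coefM.
  rewrite (big_ord_widen n (fun k => (fs i)`_k * u`_(j - k))); last exact: ltn_ord.
  rewrite big_mkcond; apply: eq_bigr => k _; rewrite !mxE ltnS.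
  by case: leqP => _ //; rewrite mulr0.
rewrite /wr E det_mulmx mulrC; congr (_ * _).
rewrite det_upper => [|i j ij]; last by rewrite mxE leqNgt ij.
under eq_bigr do rewrite mxE leqnn subnn.
by rewrite prodr_const card_ord.
Qed.

(** Substitution of [r] acts on coefficients by the matrix of the powers of [r], triangular with
    diagonal entries the powers of [r'(0)]. *)
Lemma wr_comp n r (fs : 'I_n -> {poly K}) : r`_0 = 0 ->
  wr (fun i => fs i \Po r) = r`_1 ^+ (\sum_(k < n) k)%N * wr fs.
Proof.
move=> r0; have [t rE] : exists t, r = t * 'X.
  by apply/dvdpP; rewrite -['X]subr0 -polyC0 dvdp_XsubCl rootE horner_coef0 r0.
have rk (k j : nat) : (j < k)%N -> (r ^+ k)`_j = 0.
  by move=> jk; rewrite rE exprMn coefMXn jk.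
pose T : 'M[K]_n := \matrix_(k, j) (r ^+ k)`_j.
have E : jet_mx (fun i => fs i \Po r) = jet_mx fs *m T.
  apply/matrixP => i j; rewrite !mxE.
  under [RHS]eq_bigr do rewrite !mxE -coefZ.
  rewrite -coef_sum comp_polyE !coef_sum.
  pose m := maxn n (size (fs i)).
  rewrite (big_ord_widen m (fun k => ((fs i)`_k *: r ^+ k)`_j)) ?leq_maxr //.
  rewrite [RHS](big_ord_widen m (fun k => ((fs i)`_k *: r ^+ k)`_j)) ?leq_maxl //.
  rewrite big_mkcond [RHS]big_mkcond; apply: eq_bigr => k _ /=.
  case: ltnP => [_|/leq_sizeP/(_ _ (leqnn _)) ->]; case: ltnP => [_|nk] //.
    by rewrite coefZ rk ?mulr0 //; apply: leq_trans nk.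
  by rewrite scale0r coef0.
rewrite /wr E det_mulmx mulrC; congr (_ * _).
rewrite det_upper => [|i j ij]; last by rewrite mxE rk.
rewrite -prodrXr; apply: eq_bigr => k _; rewrite mxE rE exprMn coefMXn ltnn subnn.
rewrite coefMX /= -horner_coef0 -[t`_0]horner_coef0.
by rewrite horner_exp.
Qed.

Lemma wr_linear n (S : 'M[K]_n) (fs : 'I_n -> {poly K}) :
  wr (fun i => \sum_k S k i *: fs k) = \det S * wr fs.
Proof.
rewrite /wr -det_tr -[X in _ = X * _]det_tr -det_mulmx.
rewrite -det_tr; congr (\det _); apply/matrixP => i j; rewrite !mxE coef_sum.
by apply: eq_bigr => k _; rewrite coefZ !mxE.
Qed.

Definition mon3 (a b c : {poly K}) (i : 'I_3) : {poly K} := [:: a; b; c]`_i.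

Definition mon6 (a b c : {poly K}) (i : 'I_6) : {poly K} :=
  [:: a * a; a * b; a * c; b * b; b * c; c * c]`_i.

Lemma mon3_mul u a b c : mon3 (u * a) (u * b) (u * c) =1 fun i => u * mon3 a b c i.
Proof. by rewrite /mon3; case=> -[|[|[|//]]]. Qed.

Lemma mon6_mul u a b c : mon6 (u * a) (u * b) (u * c) =1 fun i => u ^+ 2 * mon6 a b c i.
Proof. by rewrite /mon6; case=> -[|[|[|[|[|[|//]]]]]] ? /=; ring. Qed.

Lemma mon3_comp r a b c : mon3 (a \Po r) (b \Po r) (c \Po r) =1 fun i => mon3 a b c i \Po r.
Proof. by rewrite /mon3; case=> -[|[|[|//]]]. Qed.

Lemma mon6_comp r a b c : mon6 (a \Po r) (b \Po r) (c \Po r) =1 fun i => mon6 a b c i \Po r.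
Proof. by rewrite /mon6; case=> -[|[|[|[|[|[|//]]]]]] ? /=; rewrite comp_polyM. Qed.

Lemma mon3_jeq N a b c a' b' c' : jeq N a a' -> jeq N b b' -> jeq N c c' ->
  forall i, jeq N (mon3 a b c i) (mon3 a' b' c' i).
Proof. by move=> ha hb hc; rewrite /mon3; case=> -[|[|[|//]]]. Qed.

Lemma mon6_jeq N a b c a' b' c' : jeq N a a' -> jeq N b b' -> jeq N c c' ->
  forall i, jeq N (mon6 a b c i) (mon6 a' b' c' i).
Proof.
by move=> ha hb hc; rewrite /mon6; case=> -[|[|[|[|[|[|//]]]]]] ? /=; apply: jeqM.
Qed.

Lemma wr_ext n (fs gs : 'I_n -> {poly K}) : fs =1 gs -> wr fs = wr gs.
Proof. by move=> E; apply: wr_jeq => i; rewrite E. Qed.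

Definition w3 a b c := wr (mon3 a b c).
Definition w6 a b c := wr (mon6 a b c).

Lemma w3_mul u a b c : w3 (u * a) (u * b) (u * c) = u`_0 ^+ 3 * w3 a b c.
Proof. by rewrite /w3 (wr_ext (mon3_mul u a b c)) wr_mul. Qed.

Lemma w6_mul u a b c : w6 (u * a) (u * b) (u * c) = u`_0 ^+ 12 * w6 a b c.
Proof.
by rewrite /w6 (wr_ext (mon6_mul u a b c)) wr_mul -!horner_coef0 horner_exp -exprM.
Qed.

Lemma w3_comp r a b c : r`_0 = 0 ->
  w3 (a \Po r) (b \Po r) (c \Po r) = r`_1 ^+ 3 * w3 a b c.
Proof.
by move=> r0; rewrite /w3 (wr_ext (mon3_comp r a b c)) wr_comp // !big_ord_recl big_ord0.
Qed.

Lemma w6_comp r a b c : r`_0 = 0 ->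
  w6 (a \Po r) (b \Po r) (c \Po r) = r`_1 ^+ 15 * w6 a b c.
Proof.
by move=> r0; rewrite /w6 (wr_ext (mon6_comp r a b c)) wr_comp // !big_ord_recl big_ord0.
Qed.

Lemma w3_jeq N a b c a' b' c' : (3 <= N)%N -> jeq N a a' -> jeq N b b' -> jeq N c c' ->
  w3 a b c = w3 a' b' c'.
Proof. by move=> N3 ha hb hc; apply: wr_jeq; apply: mon3_jeq; apply: jeqW N3 _. Qed.

Lemma w6_jeq N a b c a' b' c' : (6 <= N)%N -> jeq N a a' -> jeq N b b' -> jeq N c c' ->
  w6 a b c = w6 a' b' c'.
Proof. by move=> N3 ha hb hc; apply: wr_jeq; apply: mon6_jeq; apply: jeqW N3 _. Qed.

Definition lin3 (A : 'M[K]_3) (a b c : {poly K}) (j : 'I_3) : {poly K} :=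
  \sum_(k < 3) A k j *: mon3 a b c k.

Lemma w3_lin A a b c :
  w3 (lin3 A a b c 0) (lin3 A a b c 1) (lin3 A a b c 2%:R) = \det A * w3 a b c.
Proof.
rewrite /w3 -wr_linear; apply: wr_ext; case=> -[|[|[|//]]] ? /=;
by rewrite /mon3 /= /lin3; apply: eq_bigr => k _; congr (_ *: _); congr (A _ _); apply: val_inj.
Qed.

(** A linear change of coordinates acts on quadratic monomials by the symmetric square of [A], whose
    determinant is [S]. *)
Lemma w6_lin A : exists S : K, forall a b c,
  w6 (lin3 A a b c 0) (lin3 A a b c 1) (lin3 A a b c 2%:R) = S * w6 a b c.
Proof.
pose pr (i : 'I_6) : 'I_3 * 'I_3 :=
  nth (0, 0) [:: (0, 0); (0, 1); (0, 2%:R); (1, 1); (1, 2%:R); (2%:R, 2%:R)] i.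
pose S : 'M[K]_6 := \matrix_(k, i)
  if (pr k).1 == (pr k).2 then A (pr k).1 (pr i).1 * A (pr k).1 (pr i).2
  else A (pr k).1 (pr i).1 * A (pr k).2 (pr i).2 + A (pr k).2 (pr i).1 * A (pr k).1 (pr i).2.
exists (\det S) => a b c; rewrite /w6 -wr_linear; apply: wr_ext => i.
have mE : mon6 (lin3 A a b c 0) (lin3 A a b c 1) (lin3 A a b c 2%:R) i =
    lin3 A a b c (pr i).1 * lin3 A a b c (pr i).2.
  by case: i => -[|[|[|[|[|[|//]]]]]].
rewrite mE !big_ord_recl big_ord0 !mxE; move: (pr i) => [j l].
rewrite /pr /= /lin3 !big_ord_recl !big_ord0 /mon6 /mon3 /=.
have l1 : lift ord0 ord0 = 1 :> 'I_3 by apply: val_inj.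
have l2 : lift ord0 (lift ord0 ord0) = 2%:R :> 'I_3 by apply: val_inj.
rewrite l2 l1 -[ord0]/(0 : 'I_3) -!mul_polyC !(rmorphD, rmorphM) /=.
by ring.
Qed.

End CoefficientDeterminants.

(** * Taylor expansions along the Hamiltonian flow of the equation *)

Section HamiltonianJets.
Variable K : numClosedFieldType.
Variable P : {poly {poly K}}.
Implicit Types (f g : {poly {poly K}}) (p q r u v : {poly K}) (x y : K) (n N : nat).

Definition derivx f : {poly {poly K}} := map_poly (@deriv K) f.

(** The derivation [P_y d/dx - P_x d/dy]. It kills [P], hence is tangent to the curve, and it
    preserves polynomials. *)
Definition ham f : {poly {poly K}} := deriv P * derivx f - derivx P * deriv f.

Lemma derivxD f g : derivx (f + g) = derivx f + derivx g.
Proof. by rewrite /derivx raddfD. Qed.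

Lemma derivxM f g : derivx (f * g) = derivx f * g + f * derivx g.
Proof.
apply/polyP => i; rewrite coefD !coefM coef_map /= coefM raddf_sum /= -big_split /=.
by apply: eq_bigr => j _; rewrite derivM !coef_map.
Qed.

Lemma hamD f g : ham (f + g) = ham f + ham g.
Proof. by rewrite /ham derivxD derivD; ring. Qed.

Lemma hamM f g : ham (f * g) = ham f * g + f * ham g.
Proof. by rewrite /ham derivxM derivM; ring. Qed.

Lemma hamP : ham P = 0.
Proof. by rewrite /ham mulrC subrr. Qed.

Lemma derivxC p : derivx p%:P = (deriv p)%:P.
Proof. by rewrite /derivx map_polyC. Qed.

Lemma hamCX : ham 'X%:P = deriv P.
Proof. by rewrite /ham derivxC derivX derivC mulr0 subr0 mulr1. Qed.

Lemma ham_cst (c : K) : ham c%:P%:P = 0.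
Proof. by rewrite /ham derivxC !derivC !mulr0 subr0. Qed.

Lemma ham0 : ham 0 = 0.
Proof. by have := ham_cst 0. Qed.

Lemma iter_ham0 j : iter j ham 0 = 0.
Proof. by elim: j => //= j ->; exact: ham0. Qed.

(* Taylor coefficients at [(x, y)] along the flow of the Hamiltonian vector
   field of [P]. *)
Definition ejet x y N f : {poly K} :=
  \poly_(j < N) (ev2 (iter j ham f) x y / j`!%:R).

Lemma coef_ejet x y N f j : (j < N)%N ->
  (ejet x y N f)`_j = ev2 (iter j ham f) x y / j`!%:R.
Proof. by move=> jN; rewrite coef_poly jN. Qed.

Lemma ejet_jeq x y N N' f : (N' <= N)%N -> jeq N' (ejet x y N f) (ejet x y N' f).
Proof. by move=> NN j jN; rewrite !coef_ejet //; apply: leq_trans NN. Qed.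

Lemma iter_hamD j f g : iter j ham (f + g) = iter j ham f + iter j ham g.
Proof. by elim: j => //= j ->; rewrite hamD. Qed.

Lemma ejetD x y N f g : ejet x y N (f + g) = ejet x y N f + ejet x y N g.
Proof.
apply/polyP => j; rewrite coefD !coef_poly; case: ifP => _; last by rewrite addr0.
by rewrite iter_hamD ev2D mulrDl.
Qed.

Lemma deriv_ejet x y N f : deriv (ejet x y N.+1 f) = ejet x y N (ham f).
Proof.
apply/polyP => j; rewrite coef_deriv !coef_poly ltnS; case: ifP => _; last by rewrite mul0rn.
rewrite -[LHS]mulr_natr iterSr factS natrM; move: (ev2 _ _ _) => e.
have : j.+1%:R != 0 :> K by rewrite pnatr_eq0.
have : j`!%:R != 0 :> K by rewrite pnatr_eq0 -lt0n fact_gt0.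
by move: (j.+1%:R) (j`!%:R) => a b b0 a0; field; rewrite b0 a0.
Qed.

Lemma jeq_of_deriv N p q : p`_0 = q`_0 -> jeq N (deriv p) (deriv q) -> jeq N.+1 p q.
Proof.
move=> pq0 H [|j] //; rewrite ltnS => jN; have := H j jN; rewrite !coef_deriv.
by rewrite -[LHS]mulr_natr -[RHS]mulr_natr => /mulIf; apply; rewrite pnatr_eq0.
Qed.

Lemma ejet0 x y N f : (ejet x y N.+1 f)`_0 = ev2 f x y.
Proof. by rewrite coef_ejet // fact0 divr1. Qed.

(** Both sides have the same constant term and, by the Leibniz rule for [ham] and induction, the
    same derivative. *)
Lemma ejetM x y N f g : jeq N (ejet x y N (f * g)) (ejet x y N f * ejet x y N g).
Proof.
elim: N f g => [//|N IH] f g; apply: jeq_of_deriv.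
  by rewrite coef0M !ejet0 ev2M.
rewrite derivM !deriv_ejet hamM ejetD; apply: jeqD.
  apply: jeq_trans (IH _ _) _; apply: jeqM => //.
  by apply: jeq_sym; apply: ejet_jeq.
apply: jeq_trans (IH _ _) _; apply: jeqM => //.
by apply: jeq_sym; apply: ejet_jeq.
Qed.

Lemma ejet_cst x y N (c : K) : jeq N (ejet x y N c%:P%:P) c%:P.
Proof.
case=> [|j] jN; rewrite coef_ejet // coefC /=.
  by rewrite fact0 divr1 ev2C hornerC.
by rewrite -iterS iterSr ham_cst iter_ham0 ev2_0 mul0r.
Qed.

Definition subst2 f u v : {poly K} := (map_poly (fun p => p \Po u) f).[v].

Lemma subst2D f g u v : subst2 (f + g) u v = subst2 f u v + subst2 g u v.
Proof. by rewrite /subst2 raddfD hornerD. Qed.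

Lemma subst2M f g u v : subst2 (f * g) u v = subst2 f u v * subst2 g u v.
Proof. by rewrite /subst2 rmorphM hornerM. Qed.

Lemma subst2C p u v : subst2 p%:P u v = p \Po u.
Proof. by rewrite /subst2 map_polyC hornerC. Qed.

Lemma subst2X u v : subst2 'X u v = v.
Proof. by rewrite /subst2 map_polyX hornerX. Qed.

Lemma subst2_jeq N f u v u' v' : jeq N u u' -> jeq N v v' ->
  jeq N (subst2 f u v) (subst2 f u' v').
Proof.
move=> hu hv; elim/poly_ind: f => [|f c IH]; first by rewrite /subst2 !rmorph0 !horner0.
rewrite !subst2D !subst2M !subst2X !subst2C; apply: jeqD; last exact: jeq_compr.
exact: jeqM.
Qed.

Lemma subst2_comp f u v r : subst2 f u v \Po r = subst2 f (u \Po r) (v \Po r).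
Proof.
elim/poly_ind: f => [|f c IH]; first by rewrite /subst2 !rmorph0 !horner0 comp_poly0.
by rewrite !subst2D !subst2M !subst2X !subst2C comp_polyD comp_polyM IH comp_polyA.
Qed.

Lemma subst2_coef0 f u v : (subst2 f u v)`_0 = ev2 f u`_0 v`_0.
Proof.
elim/poly_ind: f => [|f c IH]; first by rewrite /subst2 !rmorph0 !horner0 coef0 ev2_0.
rewrite !subst2D !subst2M !subst2X !subst2C coefD coef0M IH ev2D ev2M ev2X ev2C.
by rewrite -!horner_coef0 horner_comp.
Qed.

Lemma ejet_subst2 x y N f :
  jeq N (ejet x y N f) (subst2 f (ejet x y N 'X%:P) (ejet x y N 'X)).
Proof.
elim/poly_ind: f => [|f c IH].
  by rewrite /subst2 !rmorph0 !horner0 => j jN; rewrite coef_ejet // iter_ham0 ev2_0 mul0r coef0.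
rewrite ejetD subst2D subst2M subst2X subst2C; apply: jeqD.
  by apply: jeq_trans (ejetM _ _ _ _) _; apply: jeqM.
elim/poly_ind: c => [|c a IHc].
  rewrite comp_poly0 => j jN; by rewrite coef_ejet // iter_ham0 ev2_0 mul0r coef0.
rewrite comp_polyD comp_polyM comp_polyX comp_polyC polyCD polyCM ejetD.
apply: jeqD; last exact: ejet_cst.
by apply: jeq_trans (ejetM _ _ _ _) _; apply: jeqM.
Qed.

Lemma ejet_zero x y N : ev2 P x y = 0 -> jeq N (ejet x y N P) 0.
Proof.
move=> P0 [|j] jN; rewrite coef_ejet // coef0 /=; first by rewrite P0 mul0r.
by rewrite -iterS iterSr hamP iter_ham0 ev2_0 mul0r.
Qed.

Lemma ejet_curve x y N : ev2 P x y = 0 ->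
  jeq N (subst2 P (ejet x y N 'X%:P) (ejet x y N 'X)) 0.
Proof. by move=> P0; apply: jeq_trans (ejet_zero P0); apply/jeq_sym/ejet_subst2. Qed.

Lemma ejet_x0 x y N : (ejet x y N.+1 'X%:P)`_0 = x.
Proof. by rewrite ejet0 ev2C hornerX. Qed.

Lemma ejet_y0 x y N : (ejet x y N.+1 'X)`_0 = y.
Proof. by rewrite ejet0 ev2X. Qed.

Lemma ejet_x1 x y N : (ejet x y N.+2 'X%:P)`_1 = ev2 (deriv P) x y.
Proof. by rewrite coef_ejet //= hamCX divr1. Qed.

Lemma subst2_uniq x y N u v v' : ev2 (deriv P) x y != 0 ->
  u`_0 = x -> v`_0 = y -> v'`_0 = y ->
  jeq N (subst2 P u v) 0 -> jeq N (subst2 P u v') 0 -> jeq N v v'.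
Proof.
move=> Py ux vy v'y H H'.
have [w E] := taylor2 (map_poly (fun p => p \Po u) P) v v'.
rewrite deriv_map -!/(subst2 _ _ _) in E.
have : jeq N ((subst2 (deriv P) u v' + (v - v') * w) * (v - v')) 0.
  have -> : (subst2 (deriv P) u v' + (v - v') * w) * (v - v') =
    subst2 P u v - subst2 P u v' by rewrite E; ring.
  by move=> j jN; rewrite coefB H // H' // subrr coef0.
move=> H2; have D : jeq N (v - v') 0.
  apply: jeq_cancel H2; by rewrite coefD coef0M coefB vy v'y subrr mul0r addr0 subst2_coef0 ux v'y.
move=> j jN; apply/eqP; rewrite -subr_eq0 -coefB; apply/eqP.
by rewrite D ?coef0.
Qed.

(** The first coordinate of the flow has velocity [P_y <> 0], so some [r] adjusts it to [u]; the
    second coordinate is then determined by the equation. *)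
Lemma ejet_reparam x y N u v : ev2 P x y = 0 -> ev2 (deriv P) x y != 0 ->
  u`_0 = x -> v`_0 = y -> jeq N.+2 (subst2 P u v) 0 ->
  exists2 r : {poly K}, r`_0 = 0 &
    jeq N.+2 u (ejet x y N.+2 'X%:P \Po r) /\ jeq N.+2 v (ejet x y N.+2 'X \Po r).
Proof.
move=> P0 Py ux vy H.
have [||r r0 Hr] := @jeq_solve K N.+2 (ejet x y N.+2 'X%:P) u.
- by rewrite coef_deriv mulr1n ejet_x1.
- by rewrite ejet_x0.
exists r => //; split; first exact: jeq_sym.
have r1 : (ejet x y N.+2 'X \Po r)`_0 = y.
  by rewrite -horner_coef0 horner_comp horner_coef0 r0 horner_coef0 ejet_y0.
have r2 : jeq N.+2 (subst2 P u (ejet x y N.+2 'X \Po r)) 0.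
  have s1 : jeq N.+2 (subst2 P u (ejet x y N.+2 'X \Po r))
      (subst2 P (ejet x y N.+2 'X%:P \Po r) (ejet x y N.+2 'X \Po r)).
    by apply: subst2_jeq => //; exact: jeq_sym.
  apply: jeq_trans s1 _.
  rewrite -subst2_comp -[0](comp_poly0 r); apply: jeq_comp => //.
  exact: ejet_curve.
exact: (subst2_uniq Py ux vy r1 H r2).
Qed.

End HamiltonianJets.

(** * Arcs in projective coordinates, and the invariance of the quotient *)

Section Arcs.
Variable K : numClosedFieldType.
Implicit Types (F : mpoly 3 K) (A B : 'M[K]_3) (a b c l u v : {poly K})
  (P f : {poly {poly K}}) (x y k : K).

Definition pullback A F a b c : {poly K} := mmap (@polyC K) (lin3 A a b c) F.

Lemma jeq_prod N (I : Type) (s : seq I) (p q : I -> {poly K}) :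
  (forall i, jeq N (p i) (q i)) -> jeq N (\prod_(i <- s) p i) (\prod_(i <- s) q i).
Proof.
by move=> H; elim: s => [|i s IH]; rewrite ?big_nil // !big_cons; apply: jeqM.
Qed.

Lemma pullback_jeq N A F a b c a' b' c' : jeq N a a' -> jeq N b b' -> jeq N c c' ->
  jeq N (pullback A F a b c) (pullback A F a' b' c').
Proof.
move=> ha hb hc; rewrite /pullback /mmap; apply: jeq_sum => m; apply: jeqM => //.
rewrite /mmap1; apply: jeq_prod => j; apply: jeqX.
rewrite /lin3; apply: jeq_sum => i; rewrite -!mul_polyC; apply: jeqM => //; exact: mon3_jeq.
Qed.

Lemma pullback_homog d A F l a b c : F \is ishomog1 d mdeg ->
  pullback A F (l * a) (l * b) (l * c) = l ^+ d * pullback A F a b c.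
Proof.
move=> /dhomogP hF; rewrite /pullback /mmap mulr_sumr; apply: eq_big_seq => m mF.
rewrite mulrCA; congr (_ * _); have hm : mdeg m = d := hF m mF; rewrite -hm mdegE.
rewrite -prodrXr -big_split /=; apply: eq_bigr => i _; rewrite -exprMn; congr (_ ^+ _).
by rewrite /lin3 mulr_sumr; apply: eq_bigr => j _; rewrite mon3_mul scalerAr.
Qed.

Lemma pullback_subst2 A F u v : pullback A F 1 u v = subst2 (dehomog A F) u v.
Proof.
have rm : {morph (fun f => subst2 f u v) : f g / f + g >-> f + g} by move=> f g; exact: subst2D.
have mm : {morph (fun f => subst2 f u v) : f g / f * g >-> f * g} by move=> f g; exact: subst2M.
have r0 : subst2 0 u v = 0 by rewrite /subst2 rmorph0 horner0.
have m1 : subst2 1 u v = 1 by rewrite /subst2 rmorph1 hornerC.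
rewrite /dehomog /pullback /mmap (big_morph _ rm r0); apply: eq_bigr => m _.
rewrite subst2M subst2C comp_polyC; congr (_ * _); rewrite /mmap1 (big_morph _ mm m1).
apply: eq_bigr => j _.
have -> n f : subst2 (f ^+ n) u v = subst2 f u v ^+ n.
  by elim: n => [|n IH]; rewrite ?expr0 // !exprS subst2M IH.
congr (_ ^+ _); rewrite /frame_lin (big_morph _ rm r0); apply: eq_bigr => i _.
rewrite subst2M subst2C comp_polyC mulrC mul_polyC; congr (_ *: _).
by case: i => -[|[|[|//]]] ? /=; rewrite ?m1 ?subst2X ?subst2C ?comp_polyX.
Qed.

Lemma lin3_comp A B a b c j :
  lin3 A (lin3 B a b c 0) (lin3 B a b c 1) (lin3 B a b c 2%:R) j = lin3 (B *m A) a b c j.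
Proof.
rewrite /lin3 !big_ord_recl !big_ord0 /mon3 /= !mxE !big_ord_recl !big_ord0 -!mul_polyC.
have l1 : lift ord0 ord0 = 1 :> 'I_3 by apply: val_inj.
have l2 : lift ord0 (lift ord0 ord0) = 2%:R :> 'I_3 by apply: val_inj.
rewrite l2 l1 -[ord0]/(0 : 'I_3) !(rmorphD, rmorphM, rmorph0) /=.
by ring.
Qed.

Lemma pullback_frame A B F a b c : A \in unitmx ->
  pullback A F (lin3 (B *m invmx A) a b c 0) (lin3 (B *m invmx A) a b c 1)
    (lin3 (B *m invmx A) a b c 2%:R) = pullback B F a b c.
Proof.
move=> Au; rewrite /pullback; congr mmap; apply/funext => j.
by rewrite lin3_comp mulmxKV.
Qed.

Definition bwronskian P n (fs : 'I_n -> {poly {poly K}}) : {poly {poly K}} :=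
  \det (\matrix_(i, j) iter j (ham P) (fs i)).

(** The ratio of the Wronskian of derivatives to [wr], which is built on Taylor coefficients. *)
Definition facts n : K := \prod_(j < n) (j`!)%:R.

Lemma facts_neq0 n : facts n != 0.
Proof. by apply/prodf_neq0 => j _; rewrite pnatr_eq0 -lt0n fact_gt0. Qed.

Lemma ev2_bwronskian P n (fs : 'I_n -> {poly {poly K}}) x y :
  ev2 (bwronskian P fs) x y = facts n * wr (fun i => ejet P x y n (fs i)).
Proof.
have rE : (fun f => ev2 f x y) =1 (horner_eval x \o horner_eval y%:P) by [].
rewrite rE -[LHS]det_map_mx /wr.
have -> : map_mx (horner_eval x \o horner_eval y%:P) (\matrix_(i, j) iter j (ham P) (fs i)) =
   jet_mx (fun i => ejet P x y n (fs i)) *m diag_mx (\row_(j < n) (j`!)%:R).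
  apply/matrixP => i j; rewrite mul_mx_diag !mxE -rE coef_ejet // divfK //.
  by rewrite pnatr_eq0 -lt0n fact_gt0.
rewrite det_mulmx det_diag mulrC; congr (_ * _).
by apply: eq_bigr => j _; rewrite mxE.
Qed.

Definition bmon3 (i : 'I_3) : {poly {poly K}} := [:: 1; 'X%:P; 'X]`_i.

Definition bmon6 (i : 'I_6) : {poly {poly K}} :=
  [:: 1 * 1; 1 * 'X%:P; 1 * 'X; 'X%:P * 'X%:P; 'X%:P * 'X; 'X * 'X]`_i.

(** A substitute for the Hessian determinant: at a point of the curve with [P_y <> 0] it vanishes
    only at an inflection. *)
Definition hessian P := bwronskian P bmon3.
Definition sextactic P := bwronskian P bmon6.

Lemma ejet1 P x y N : jeq N (ejet P x y N 1) 1.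
Proof. exact: (ejet_cst P x y (N := N) 1). Qed.

Lemma ev2_hessian P x y N : (3 <= N)%N -> ev2 (hessian P) x y =
  facts 3 * w3 1 (ejet P x y N 'X%:P) (ejet P x y N 'X).
Proof.
move=> N3; rewrite ev2_bwronskian; congr (_ * _); apply: wr_jeq.
rewrite /bmon3 /mon3; case=> -[|[|[|//]]] ? /=; first exact: ejet1.
  by apply/jeq_sym/ejet_jeq.
by apply/jeq_sym/ejet_jeq.
Qed.

Lemma ev2_sextactic P x y N : (6 <= N)%N -> ev2 (sextactic P) x y =
  facts 6 * w6 1 (ejet P x y N 'X%:P) (ejet P x y N 'X).
Proof.
move=> N6; rewrite ev2_bwronskian; congr (_ * _); apply: wr_jeq.
have hx : jeq 6 (ejet P x y 6 'X%:P) (ejet P x y N 'X%:P) by apply/jeq_sym/ejet_jeq.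
have hy : jeq 6 (ejet P x y 6 'X) (ejet P x y N 'X) by apply/jeq_sym/ejet_jeq.
have h1 : jeq 6 (ejet P x y 6 1) 1 by exact: ejet1.
by rewrite /bmon6 /mon6; case=> -[|[|[|[|[|[|//]]]]]] ? /=;
  apply: jeq_trans (ejetM _ _ _ _ _) _; apply: jeqM.
Qed.

(* The quotient [w6 / w3 ^ 5] is a section of the dual of the cube of the
   hyperplane bundle: it does not depend on the arc, up to the factor [k ^ 3]. *)
Lemma arc_formula d A F P (e : K) a b c x y k :
  F \is ishomog1 d mdeg -> P = e%:P *: dehomog A F ->
  ev2 P x y = 0 -> ev2 (deriv P) x y != 0 -> k != 0 ->
  a`_0 = k -> b`_0 = k * x -> c`_0 = k * y -> jeq 6 (pullback A F a b c) 0 ->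
  ev2 (sextactic P) x y * facts 3 ^+ 5 * w3 a b c ^+ 5 =
  facts 6 * w6 a b c * k ^+ 3 * ev2 (hessian P) x y ^+ 5.
Proof.
move=> hF PE P0 Py k0 ak bk ck H.
have [a' aa'] := jeq_inv 6 (p := a) ltac:(by rewrite ak).
have a'0 : a'`_0 = k^-1.
  have := aa' 0%N isT; rewrite coef0M ak coefC /= => E.
  by apply: (mulfI k0); rewrite E mulfV.
pose u := a' * b; pose v := a' * c.
have u0 : u`_0 = x by rewrite coef0M a'0 bk mulKf.
have v0 : v`_0 = y by rewrite coef0M a'0 ck mulKf.
have a'a : jeq 6 (a' * a) 1 by rewrite mulrC.
have Huv : jeq 6 (subst2 P u v) 0.
  have -> : subst2 P u v = e%:P * subst2 (dehomog A F) u v.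
    by rewrite PE -mul_polyC subst2M subst2C comp_polyC.
  rewrite -pullback_subst2 -[0](mulr0 e%:P); apply: jeqM => //.
  apply: jeq_trans (pullback_jeq A F (jeq_sym a'a) (@jeq_refl _ 6 u) (@jeq_refl _ 6 v)) _.
  by rewrite (pullback_homog A _ _ _ _ hF) -[0](mulr0 (a' ^+ d)); apply: jeqM.
have [r r0 [Hu Hv]] := ejet_reparam (N := 4) P0 Py u0 v0 Huv.
have au : jeq 6 (a * u) b.
  by rewrite /u mulrA -[X in jeq _ _ X]mul1r; apply: jeqM.
have av : jeq 6 (a * v) c.
  by rewrite /v mulrA -[X in jeq _ _ X]mul1r; apply: jeqM.
have c1 : 1 = 1 \Po r :> {poly K} by rewrite comp_polyC.
have E3 : w3 a b c = k ^+ 3 * (r`_1 ^+ 3 * w3 1 (ejet P x y 6 'X%:P) (ejet P x y 6 'X)).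
  rewrite -w3_comp // -c1 -(w3_jeq (N := 6) isT (@jeq_refl _ 6 1) Hu Hv) -ak -w3_mul mulr1.
  by apply: (w3_jeq (N := 6)) => //; exact: jeq_sym.
have E6 : w6 a b c = k ^+ 12 * (r`_1 ^+ 15 * w6 1 (ejet P x y 6 'X%:P) (ejet P x y 6 'X)).
  rewrite -w6_comp // -c1 -(w6_jeq (N := 6) isT (@jeq_refl _ 6 1) Hu Hv) -ak -w6_mul mulr1.
  by apply: (w6_jeq (N := 6)) => //; exact: jeq_sym.
rewrite (ev2_sextactic P x y (N := 6)) // (ev2_hessian P x y (N := 6)) // E3 E6.
move: (w3 1 _ _) (w6 1 _ _) (r`_1) (facts 3) (facts 6) => W3 W6 r1 f3 f6.
by ring.
Qed.

End Arcs.

(** * Osculating conics and contact of infinite order *)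

Section Conics.
Variable K : numClosedFieldType.
Implicit Types (f g : {poly {poly K}}) (n N : nat).

Lemma lin2 (a b c d u v : K) : a * d - b * c != 0 ->
  u * a + v * b = 0 -> u * c + v * d = 0 -> u = 0 /\ v = 0.
Proof.
move=> D E1 E2; split; apply: (mulfI D); rewrite mulr0.
  have -> : (a * d - b * c) * u = (u * a + v * b) * d - (u * c + v * d) * b by ring.
  by rewrite E1 E2; ring.
have -> : (a * d - b * c) * v = (u * c + v * d) * a - (u * a + v * b) * c by ring.
by rewrite E1 E2; ring.
Qed.

Lemma sum6 (V : zmodType) (G : 'I_6 -> V) : \sum_i G i = G (inord 0) + G (inord 1) + G (inord 2)
  + G (inord 3) + G (inord 4) + G (inord 5).
Proof.
transitivity (\sum_(i <- index_iota 0 6) G (inord i)).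
  by rewrite big_mkord; apply: eq_bigr => i _; rewrite inord_val.
by rewrite /index_iota /= !big_cons big_nil addr0 !addrA.
Qed.

(** The last hypothesis, that the quadratic part vanishes on the velocity, is a sixth equation. With
    orders 1 and 2 it kills the gradient of the conic at the point; with orders 3 and 4 it kills the
    quadratic part, since velocity and acceleration are independent. *)
Lemma conic_contact (X Y : {poly K}) (c0 c1 c2 a b g : K) :
  X`_1 * Y`_2 - X`_2 * Y`_1 != 0 ->
  (forall j, (j < 5)%N -> c0 * (1 : {poly K})`_j + c1 * X`_j + c2 * Y`_j
     + a * (X * X)`_j + b * (X * Y)`_j + g * (Y * Y)`_j = 0) ->
  a * X`_1 ^+ 2 + b * (X`_1 * Y`_1) + g * Y`_1 ^+ 2 = 0 ->
  [/\ c0 = 0, c1 = 0, c2 = 0 & [/\ a = 0, b = 0 & g = 0]].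
Proof.
move=> W H q.
have e0 := H 0%N isT; have e1 := H 1%N isT; have e2 := H 2%N isT.
have e3 := H 3%N isT; have e4 := H 4%N isT.
move: e0 e1 e2 e3 e4; rewrite !coefM !big_ord_recl !big_ord0 !coefC /=.
rewrite /bump /= /addn /= /subn /=.
move: (X`_0) (X`_1) (X`_2) (X`_3) (X`_4) (Y`_0) (Y`_1) (Y`_2) (Y`_3) (Y`_4) W q.
move=> x0 x1 x2 x3 x4 y0 y1 y2 y3 y4 W q e0 e1 e2 e3 e4.
have W' : x1 * y2 - y1 * x2 != 0 by rewrite [y1 * x2]mulrC.
pose Gx := c1 + 2 * a * x0 + b * y0; pose Gy := c2 + b * x0 + 2 * g * y0.
have [Gx0 Gy0] : Gx = 0 /\ Gy = 0.
  apply: (lin2 W'); first by rewrite -[RHS]e1 /Gx /Gy; ring.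
  by rewrite -[LHS]addr0 -{1}q -[RHS]e2 /Gx /Gy; ring.
have [l1 l2] : 2 * a * x1 + b * y1 = 0 /\ b * x1 + 2 * g * y1 = 0.
  apply: (lin2 W'); first by rewrite -[RHS](mulr0 2) -q; ring.
  have E : Gx * x3 + Gy * y3 = 0 by rewrite Gx0 Gy0; ring.
  by rewrite -[LHS]addr0 -{1}E -[RHS]e3 /Gx /Gy; ring.
have e4' : a * x2 ^+ 2 + b * (x2 * y2) + g * y2 ^+ 2 = 0.
  have E : Gx * x4 + Gy * y4 + ((2 * a * x1 + b * y1) * x3 + (b * x1 + 2 * g * y1) * y3) = 0.
    by rewrite Gx0 Gy0 l1 l2; ring.
  by rewrite -[LHS]addr0 -{1}E -[RHS]e4 /Gx /Gy; ring.
have [m1 m2] : 2 * a * x2 + b * y2 = 0 /\ b * x2 + 2 * g * y2 = 0.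
  apply: (lin2 W'); last by rewrite -[RHS](mulr0 2) -e4'; ring.
  have -> : (2 * a * x2 + b * y2) * x1 + (b * x2 + 2 * g * y2) * y1 =
    (2 * a * x1 + b * y1) * x2 + (b * x1 + 2 * g * y1) * y2 by ring.
  by rewrite l1 l2; ring.
have [a2 b0] : 2 * a = 0 /\ b = 0 by apply: (lin2 W').
have [_ g2] : b = 0 /\ 2 * g = 0 by apply: (lin2 W').
have two : 2 != 0 :> K by rewrite pnatr_eq0.
have a0 : a = 0 by apply: (mulfI two); rewrite a2 mulr0.
have g0 : g = 0 by apply: (mulfI two); rewrite g2 mulr0.
have c10 : c1 = 0 by rewrite -[RHS]Gx0 /Gx a0 b0; ring.
have c20 : c2 = 0 by rewrite -[RHS]Gy0 /Gy g0 b0; ring.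
by split=> //; rewrite -[RHS]e0 a0 b0 g0 c10 c20; ring.
Qed.

Section VanishingOrder.
Variable P : {poly {poly K}}.
Variables x y : K.
Hypothesis P0 : ev2 P x y = 0.
Hypothesis Py : ev2 (deriv P) x y != 0.

Definition vanish n f := forall j, (j < n)%N -> ev2 (iter j (ham P) f) x y = 0.

Lemma vanishP n f : vanish n f <-> jeq n (ejet P x y n f) 0.
Proof.
split=> H j jn; have := H j jn; first by move=> E; rewrite coef_ejet // E mul0r coef0.
rewrite coef_ejet // coef0 => /eqP; rewrite mulf_eq0 invr_eq0 pnatr_eq0.
by have := fact_gt0 j; case: (j`!) => // k _; rewrite orbF => /eqP.
Qed.

Lemma vanishM n f g : vanish n f -> vanish n (g * f).
Proof.
move=> /vanishP H; apply/vanishP; apply: jeq_trans (ejetM _ _ _ _ _) _.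
by rewrite -[0](mulr0 (ejet P x y n g)); apply: jeqM.
Qed.

Lemma vanishD n f g : vanish n f -> vanish n g -> vanish n (f + g).
Proof. by move=> H H' j jn; rewrite iter_hamD ev2D H // H' // addr0. Qed.

Lemma vanish0 n : vanish n 0.
Proof. by move=> j _; rewrite iter_ham0 ev2_0. Qed.

Lemma vanish_sum n (I : Type) (s : seq I) (f : I -> {poly {poly K}}) :
  (forall i, vanish n (f i)) -> vanish n (\sum_(i <- s) f i).
Proof.
move=> H; elim: s => [|i s IH]; first by rewrite big_nil; exact: vanish0.
by rewrite big_cons; apply: vanishD.
Qed.

Lemma vanishN n f : vanish n f -> vanish n (- f).
Proof. by rewrite -mulN1r; exact: vanishM. Qed.

Lemma vanish_cancel n f g : ev2 g x y != 0 -> vanish n (g * f) -> vanish n f.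
Proof.
case: n => [//|n] g0 /vanishP H; apply/vanishP.
apply: (@jeq_cancel _ n.+1 (ejet P x y n.+1 g)); first by rewrite ejet0.
by apply: jeq_trans H; apply/jeq_sym/ejetM.
Qed.

Lemma vanish_multiple n f : vanish n (f * P).
Proof. by apply: vanishM; apply/vanishP; apply: ejet_zero. Qed.

Lemma vanishW n m f : (m <= n)%N -> vanish n f -> vanish m f.
Proof. by move=> mn H j jm; apply: H; apply: leq_trans mn. Qed.

Lemma vanish_iter n j f : vanish (n + j) f -> vanish n (iter j (ham P) f).
Proof. by move=> H i im; rewrite -iterD; apply: H; rewrite ltn_add2r. Qed.

Lemma vanish_extend n j f : vanish j f -> vanish n (iter j (ham P) f) -> vanish (n + j) f.
Proof.
move=> H H' i iN; have [ij|ji] := ltnP i j; first exact: H.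
by rewrite -(subnK ji) iterD; apply: H'; lia.
Qed.

(** The abscissa is a local parameter because [P_y <> 0], so the order of [r] along the curve is the
    multiplicity of its root [x], which is finite if [r] is nonzero. *)
Lemma vanish_const (r : {poly K}) : (forall n, vanish n r%:P) -> r = 0.
Proof.
move=> H; apply/eqP/negPn/negP => r0.
have [m [q]] := multiplicity_XsubC r x; rewrite r0 /= => qx rE.
have /vanishP Hm := H m.+2.
set X := ejet P x y m.+2 'X%:P.
have : jeq m.+2 (r \Po X) 0.
  by rewrite -(subst2C r X (ejet P x y m.+2 'X)); apply: jeq_trans Hm; apply/jeq_sym/ejet_subst2.
have cX : (('X - x%:P) ^+ m) \Po X = (X - x%:P) ^+ m.
  elim: (m) => [|k IH]; first by rewrite !expr0 comp_polyC.
  by rewrite !exprS comp_polyM IH comp_polyB comp_polyX comp_polyC.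
rewrite rE comp_polyM cX => H'.
have {}H' : jeq m.+2 ((X - x%:P) ^+ m) 0.
  by apply: jeq_cancel H'; rewrite -horner_coef0 horner_comp horner_coef0 ejet_x0.
have [w wE] : exists w, X - x%:P = w * 'X.
  apply/dvdpP; rewrite -['X]subr0 -polyC0 dvdp_XsubCl rootE horner_coef0.
  by rewrite coefB ejet_x0 coefC subrr.
have := H' m ltac:(by []); rewrite wE exprMn coefMXn ltnn subnn coef0.
rewrite -horner_coef0 horner_exp horner_coef0 => /eqP; rewrite expf_eq0 => /andP[_].
have -> : w`_0 = ev2 (deriv P) x y; last by rewrite (negbTE Py).
have := congr1 (fun p : {poly K} => p`_1) wE.
by rewrite coefMX coefB ejet_x1 coefC subr0 => ->.
Qed.

Lemma iter_hamZ (c : K) j f :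
  iter j (ham P) (c%:P%:P * f) = c%:P%:P * iter j (ham P) f.
Proof. by elim: j => //= j ->; rewrite hamM ham_cst mul0r add0r. Qed.

Definition conic (c : 'I_6 -> K) : {poly {poly K}} := \sum_i (c i)%:P%:P * bmon6 K i.

Lemma ev2_conic c u v : ev2 (conic c) u v = c (inord 0) + c (inord 1) * u + c (inord 2) * v
  + c (inord 3) * (u * u) + c (inord 4) * (u * v) + c (inord 5) * (v * v).
Proof.
rewrite /conic sum6 !ev2D /bmon6 !inordK //= !ev2M !ev2C !hornerC !hornerX !ev2X.
by rewrite !mul1r mulr1.
Qed.

Lemma conic_eq0 c : conic c = 0 -> forall i, c i = 0.
Proof.
move=> c0; have E u v := ev2_conic c u v; rewrite c0 in E.
have H u v := etrans (esym (E u v)) (ev2_0 u v).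
have two : 2 != 0 :> K by rewrite pnatr_eq0.
move: (H 0 0) (H 1 0) (H (-1) 0) (H 0 1) (H 0 (-1)) (H 1 1) => e0 e1 e2 e3 e4 e5.
have h0 : c (inord 0) = 0 by rewrite -[RHS]e0; ring.
have h3 : c (inord 3) = 0.
  have E2 := congr2 +%R e1 e2.
  by apply: (mulfI two); rewrite [RHS]mulr0 -[RHS](addr0 0) -[RHS]E2 h0; ring.
have h5 : c (inord 5) = 0.
  have E2 := congr2 +%R e3 e4.
  by apply: (mulfI two); rewrite [RHS]mulr0 -[RHS](addr0 0) -[RHS]E2 h0; ring.
have h1 : c (inord 1) = 0 by rewrite -[RHS]e1 h0 h3; ring.
have h2 : c (inord 2) = 0 by rewrite -[RHS]e3 h0 h5; ring.
have h4 : c (inord 4) = 0 by rewrite -[RHS]e5 h0 h1 h2 h3 h5; ring.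
move=> i; rewrite -(inord_val i).
by case: i => -[|[|[|[|[|[|//]]]]]].
Qed.

Lemma size_conic c : (size (conic c) <= 3)%N.
Proof.
apply: leq_trans (size_sum _ _ _) _; apply/bigmax_leqP => i _.
rewrite mul_polyC; apply: leq_trans (size_scale_leq _ _) _.
rewrite /bmon6; case: i => -[|[|[|[|[|[|//]]]]]] ? /=; rewrite ?mul1r ?size_poly1 ?size_polyX //.
- by apply: leq_trans (size_polyC_leq1 _) _.
- by rewrite -polyCM; apply: leq_trans (size_polyC_leq1 _) _.
- by rewrite mul_polyC; apply: leq_trans (size_scale_leq _ _) _; rewrite size_polyX.
- by rewrite -expr2 size_polyXn.
Qed.

Definition iter_mx : 'M[{poly {poly K}}]_6 := \matrix_(i, j) iter j (ham P) (bmon6 K i).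

Lemma iter_conic c j : iter j (ham P) (conic c) =
  \sum_i (c i)%:P%:P * iter j (ham P) (bmon6 K i).
Proof.
rewrite /conic; elim/big_rec2: _ => [|i f g _ <-]; first exact: iter_ham0.
by rewrite iter_hamD iter_hamZ.
Qed.

Lemma ejet_conic c N : jeq N (ejet P x y N (conic c))
  (\sum_i (c i)%:P * mon6 1 (ejet P x y N 'X%:P) (ejet P x y N 'X) i).
Proof.
rewrite /conic; elim/big_rec2: _ => [|i f g _ IH].
  by move=> j jN; rewrite coef_ejet // iter_ham0 ev2_0 mul0r coef0.
rewrite ejetD; apply: jeqD => //; apply: jeq_trans (ejetM _ _ _ _ _) _.
apply: jeqM; first exact: ejet_cst.
have h1 := @ejet1 K P x y N.
by rewrite /bmon6 /mon6; case: i => -[|[|[|[|[|[|//]]]]]] ? /=;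
  apply: jeq_trans (ejetM _ _ _ _ _) _; apply: jeqM.
Qed.

Lemma w3_1 (X Y : {poly K}) : w3 1 X Y = X`_1 * Y`_2 - X`_2 * Y`_1.
Proof.
rewrite /w3 /wr (expand_det_row _ 0) !big_ord_recl big_ord0 /cofactor.
rewrite !(expand_det_row _ 0) !big_ord_recl !big_ord0 /cofactor !det_mx11 !mxE /= !coefC /=.
by rewrite /bump /= /addn /=; ring.
Qed.

Hypothesis H0 : ev2 (hessian P) x y != 0.

Lemma conic_vanish c : vanish 5 (conic c) ->
  let u := (ejet P x y 6 'X%:P)`_1 in let v := (ejet P x y 6 'X)`_1 in
  c (inord 3) * u ^+ 2 + c (inord 4) * (u * v) + c (inord 5) * v ^+ 2 = 0 ->
  forall i, c i = 0.
Proof.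
move=> van u v q; move: (@ejet_conic c 6).
set X := ejet P x y 6 'X%:P in u q *; set Y := ejet P x y 6 'X in v q *.
move=> J.
have W : X`_1 * Y`_2 - X`_2 * Y`_1 != 0.
  apply: contraNneq H0 => W0; rewrite (ev2_hessian P x y (N := 6)) // -/X -/Y.
  by rewrite w3_1 W0 mulr0.
have [|c0 c1 c2 [c3 c4 c5]] := @conic_contact X Y (c (inord 0)) (c (inord 1)) (c (inord 2)) _ _ _ W _ q.
  move=> j j5; have j6 : (j < 6)%N by apply: ltnW.
  have := J j j6; rewrite coef_ejet // (van j j5) mul0r => E; rewrite [RHS]E.
  by rewrite coef_sum sum6 !coefCM /mon6 !inordK //= !mul1r.
move=> i; rewrite -(inord_val i).
by case: i => -[|[|[|[|[|[|//]]]]]].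
Qed.

(** The cofactors of the last column ignore that column. Replacing it by the sixth equation of
    [conic_contact] gives an invertible matrix, so they cannot all vanish. *)
Lemma exists_minor : exists k, ev2 (cofactor iter_mx k ord_max) x y != 0.
Proof.
set u := (ejet P x y 6 'X%:P)`_1; set v := (ejet P x y 6 'X)`_1.
pose q (i : 'I_6) : K := [:: 0; 0; 0; u ^+ 2; u * v; v ^+ 2]`_i.
pose M : 'M[K]_6 := \matrix_(i, j) if j == ord_max then q i else ev2 (iter_mx i j) x y.
have M0 : \det M != 0.
  apply/negP => /det0P [w w0 wM]; case/eqP: w0; apply/rowP => i; rewrite mxE.
  have E (j : 'I_6) : \sum_i w 0 i * M i j = 0.
    by have /rowP/(_ j) := wM; rewrite !mxE.
  apply: (@conic_vanish (fun i => w 0 i)).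
    move=> j j5; have j6 : (j < 6)%N by apply: ltnW.
    rewrite iter_conic /ev2 !horner_sum -[RHS](E (inord j)).
    apply: eq_bigr => l _; rewrite -!/(ev2 _ _ _) ev2M ev2C hornerC !mxE.
    rewrite inordK ?j6 //.
    by rewrite -val_eqE /= inordK ?j6 // (ltn_eqF j5).
  rewrite -/u -/v -[RHS](E ord_max) sum6 !mxE eqxx /q !inordK //=.
  by rewrite !mulr0 !add0r.
have [k kM] : exists k, cofactor M k ord_max != 0.
  apply/existsP; apply: contraNT M0; rewrite negb_exists => /forallP H.
  rewrite (expand_det_col M ord_max); apply/eqP; apply: big1 => k _.
  by have /negPn/eqP -> := H k; rewrite mulr0.
exists k; apply: contraNneq kM => k0; apply/eqP; rewrite -k0 /cofactor.
have rE : (fun f => ev2 f x y) =1 (horner_eval x \o horner_eval y%:P) by [].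
rewrite ev2M.
have -> (C : 'M[{poly {poly K}}]_5) : ev2 (\det C) x y = \det (map_mx (horner_eval x \o horner_eval y%:P) C).
  by rewrite det_map_mx.
have -> : ev2 ((-1) ^+ (k + @ord_max 5)) x y = (-1) ^+ (k + @ord_max 5).
  by rewrite rE rmorphXn rmorphN1.
congr (_ * \det _); apply/matrixP => i j; rewrite !mxE.
by rewrite eq_sym (negPf (neq_lift _ _)).
Qed.

(** Five linear conditions on six coefficients; the zero column makes the matrix square. *)
Lemma contact_conic : exists2 c, (exists i, c i != 0) & vanish 5 (conic c).
Proof.
pose M : 'M[K]_6 := \matrix_(i, j) if j == ord_max then 0 else ev2 (iter_mx i j) x y.
have /det0P [w w0 wM] : \det M == 0.
  apply/eqP; rewrite (expand_det_col M ord_max); apply: big1 => k _.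
  by rewrite mxE eqxx mul0r.
exists (fun i => w 0 i).
  by have /rV0Pn [k wk] := w0; exists k.
move=> j j5; have j6 : (j < 6)%N by apply: ltnW.
rewrite iter_conic /ev2 !horner_sum.
have /rowP/(_ (inord j)) := wM; rewrite !mxE => E; rewrite -[RHS]E.
apply: eq_bigr => l _; rewrite -!/(ev2 _ _ _) ev2M ev2C hornerC !mxE.
rewrite inordK ?j6 //.
by rewrite -val_eqE /= inordK ?j6 // (ltn_eqF j5).
Qed.

(* Cramer's rule turns [sextactic P = 0] on the curve into a linear differential
   equation of order 5 for the conics, so that a conic with contact of order 5 has
   contact of infinite order. *)
Lemma conic_of_sextactic A : birreducible P -> P \is monic -> sextactic P = A * P ->
  (size P <= 3)%N.
Proof.
move=> Pirr Pm PA; have [c [i0 ci0] van5] := contact_conic.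
have [k mk] := exists_minor.
(* For [i = k] the sum over [j] is the expansion of [sextactic P] along row [k]; for [i <> k] it is
   an off-diagonal entry of the matrix times its adjugate, hence 0. *)
have rel : \sum_(j < 6) cofactor iter_mx k j * iter j (ham P) (conic c) =
    ((c k)%:P%:P * A) * P.
  under eq_bigr do rewrite iter_conic mulr_sumr.
  rewrite exchange_big /= (bigD1 k) //= [X in _ + X]big1 ?addr0 => [|i ik].
    rewrite -mulrA -PA /sextactic /bwronskian -/iter_mx (expand_det_row _ k) mulr_sumr.
    by apply: eq_bigr => j _; rewrite mxE; ring.
  have : (iter_mx *m \adj iter_mx) i k = 0 by rewrite mul_mx_adj mxE (negPf ik).
  rewrite mxE => E; rewrite -[RHS](mulr0 (c i)%:P%:P) -[in RHS]E mulr_sumr.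
  by apply: eq_bigr => j _; rewrite !mxE; ring.
have van n : vanish n (conic c).
  elim: n => [|n IH]; first by move=> j.
  have [n5|n5] := leqP n.+1 5; first exact: vanishW van5.
  have nE : n.+1 = ((n - 4) + 5)%N by lia.
  rewrite nE; apply: vanish_extend => //.
  have : vanish (n - 4) (\sum_(j < 6) cofactor iter_mx k j * iter j (ham P) (conic c)).
    by rewrite rel; exact: vanish_multiple.
  rewrite big_ord_recr /= => H; apply: vanish_cancel mk _.
  rewrite -[X in vanish _ X](addKr (\sum_(i < 5) cofactor iter_mx k (widen_ord (leqnSn 5) i) *
    iter i (ham P) (conic c))) addrC.
  apply: vanishD; first exact: H.
  apply: vanishN; apply: vanish_sum => j; apply: vanishM; apply: vanish_iter.
  by apply: vanishW IH; have := ltn_ord j; lia.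
have Q0 : conic c != 0 by apply: contraNneq ci0 => /conic_eq0 ->.
apply: leq_trans (size_conic c).
have [[B QB]|] := elimination (conic c) Pirr Pm.
  have B0 : B != 0 by apply: contraNneq Q0 => B0; rewrite QB B0 mul0r.
  rewrite QB size_Mmonic // -ltnS; move: B0; rewrite -size_poly_gt0.
  by move: (size B) (size P) => [//|b] p _; rewrite addSn /= ltnS leq_addl.
(* If [P] did not divide the conic, an eliminant in [x] alone would vanish to infinite order at the
   point. *)
move=> [B [C [r [r0 rE]]]]; case/eqP: r0; apply: vanish_const => n.
rewrite rE; apply: vanishD; first exact: vanish_multiple.
exact: vanishM.
Qed.

End VanishingOrder.

End Conics.

(** * The invariant function and its local bounds *)

Section ChainRule.
Variable K : numClosedFieldType.
Implicit Types (F G : mpoly 3 K) (A : 'M[K]_3) (u v : 'rV[K]_3).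

Lemma mmap_coef0 (p : 'I_3 -> {poly K}) F :
  (mmap (@polyC K) p F)`_0 = meval (fun j => (p j)`_0) F.
Proof.
rewrite mevalE /mmap coef_sum; apply: eq_bigr => m _.
rewrite coefCM; congr (_ * _); rewrite /mmap1 -horner_coef0 horner_prod.
by apply: eq_bigr => j _; rewrite horner_exp horner_coef0.
Qed.

Lemma mmap_coef1 (p : 'I_3 -> {poly K}) F : (mmap (@polyC K) p F)`_1 =
  \sum_j meval (fun i => (p i)`_0) (mderiv j F) * (p j)`_1.
Proof.
set e := meval _; pose D G := \sum_j e (mderiv j G) * (p j)`_1.
rewrite -/(D F).
have DM G H : (mmap (@polyC K) p G)`_1 = D G -> (mmap (@polyC K) p H)`_1 = D H ->
    (mmap (@polyC K) p (G * H))`_1 = D (G * H).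
  rewrite rmorphM /= coefM !big_ord_recl big_ord0 addr0 /= => -> ->.
  rewrite /D mulr_sumr mulr_suml -big_split /=; apply: eq_bigr => j _.
  rewrite mderivM /e mevalD !mevalM !mmap_coef0 -/e.
  by ring.
have D1 : (mmap (@polyC K) p 1)`_1 = D 1.
  rewrite rmorph1 coefC /D big1 // => j _.
  by rewrite -[1]/(mpolyC 3 1) mderivC /e meval0 mul0r.
have DX m : (mmap (@polyC K) p (mpolyX K m))`_1 = D (mpolyX K m).
  rewrite mpolyXE_id; elim/big_ind: _ => // i _.
  elim: (m i) => [|k IH]; first by rewrite expr0.
  rewrite exprS; apply: DM => //; rewrite mmapX mmap1U /D (bigD1 i) //= big1 => [|j ji].
    rewrite addr0 mderivX mnm1E eqxx scale1r (_ : mnm_sub _ _ = mnm0) ?/e ?mevalX.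
      by rewrite big1 ?mul1r // => j _; rewrite mnm0E.
    by apply/mnmP => j; rewrite mnmBE mnm0E subnn.
  by rewrite mderivX mnm1E eq_sym (negPf ji) scale0r /e meval0 mul0r.
elim/mpolyind: F => [|c m F _ _ IH].
  by rewrite mmap0 coef0 /D big1 // => j _; rewrite mderiv0 /e meval0 mul0r.
rewrite mmapD coefD IH mmapZ coefCM DX /D mulr_sumr -big_split /=.
by apply: eq_bigr => j _; rewrite mderivD mderivZ /e mevalD mevalZ; ring.
Qed.

Lemma mderiv_homog d j F : F \is ishomog1 d mdeg -> mderiv j F \is ishomog1 d.-1 mdeg.
Proof.
move=> /dhomogP hF; apply/dhomogP => m; rewrite mcoeff_msupp mcoeff_deriv.
move=> H; have : mnm_add m (mnm1 j) \in msupp F.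
  by rewrite mcoeff_msupp; apply: contraNneq H => ->; rewrite mul0rn.
by move=> /hF /= <-; rewrite mdegD mdeg1 addn1.
Qed.

Lemma lin3_coef A (a b c : {poly K}) j k :
  (lin3 A a b c j)`_k = ((\row_(i < 3) [:: a`_k; b`_k; c`_k]`_i) *m A) 0 j.
Proof.
rewrite /lin3 mxE coef_sum; apply: eq_bigr => i _; rewrite coefZ mulrC mxE; congr (_ * _).
by case: i => -[|[|[|//]]].
Qed.

Lemma pullback_coef1 A F (a b c : {poly K}) : (pullback A F a b c)`_1 =
  \sum_j meval (((\row_(i < 3) [:: a`_0; b`_0; c`_0]`_i) *m A) 0) (mderiv j F) *
    ((\row_(i < 3) [:: a`_1; b`_1; c`_1]`_i) *m A) 0 j.
Proof.
rewrite /pullback mmap_coef1; apply: eq_bigr => j _; rewrite lin3_coef; congr (_ * _).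
by apply: meval_ext => i; rewrite lin3_coef.
Qed.

Lemma ev2_derivE A F x y : ev2 (deriv (dehomog A F)) x y =
  \sum_j meval (aff A x y 0) (mderiv j F) * A 2%:R j.
Proof.
have -> : ev2 (deriv (dehomog A F)) x y = (pullback A F 1 x%:P ('X + y%:P))`_1.
  rewrite pullback_subst2 /subst2.
  have [w ->] := taylor2 (map_poly (fun p => p \Po x%:P) (dehomog A F)) ('X + y%:P) y%:P.
  rewrite deriv_map -!/(subst2 _ _ _) addrK !coefD coefXM /= subst2_coef0 !coefC /=.
  rewrite coefXnM /= addr0 -[LHS]add0r; congr (_ + _).
  elim/poly_ind: (dehomog A F) => [|f c IH]; first by rewrite /subst2 rmorph0 horner0 coef0.
  rewrite subst2D subst2M subst2X subst2C coefD coefMC -IH mul0r add0r.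
  by rewrite comp_polyCr coefC.
rewrite pullback_coef1; apply: eq_bigr => j _; rewrite !coefC !coefD coefX !coefC /=; congr (_ * _).
  by apply: meval_ext => i; rewrite /aff add0r.
rewrite mxE (bigD1 2%:R) //= big1 => [|i i2]; rewrite !mxE /= coefX ?addr0 ?mul1r //.
by case: i i2 => -[|[|[|//]]] ? //= _; rewrite mul0r.
Qed.

(** Differentiate [F] along the arc [(1 + t) u], where it equals [(1 + t) ^ d] times [F(u) = 0]. *)
Lemma euler d F u : F \is ishomog1 d mdeg -> meval (u 0) F = 0 ->
  \sum_j meval (u 0) (mderiv j F) * u 0 j = 0.
Proof.
move=> hF Fu; pose p (j : 'I_3) : {poly K} := (u 0 j) *: (1 + 'X).
have p0 j : (p j)`_0 = u 0 j by rewrite coefZ coefD coefC coefX addr0 mulr1.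
have p1 j : (p j)`_1 = u 0 j by rewrite coefZ coefD coefC coefX add0r mulr1.
have := mmap_coef1 p F; rewrite (_ : mmap _ _ _ = (meval (u 0) F)%:P * (1 + 'X) ^+ d).
  rewrite Fu mul0r coef0 => E; rewrite [RHS]E; apply: eq_bigr => j _; rewrite p1; congr (_ * _).
  by apply: meval_ext => i; rewrite p0.
move/dhomogP: hF => hF; rewrite /mmap mevalE rmorph_sum mulr_suml /=; apply: eq_big_seq => m mF.
have hm : mdeg m = d := hF m mF; rewrite -hm mdegE /= rmorphM rmorph_prod /= -mulrA.
congr (_ * _); rewrite -prodrXr -big_split /=; apply: eq_bigr => i _.
by rewrite /p -mul_polyC exprMn rmorphXn.
Qed.

End ChainRule.

(** * Frames with prescribed first and last vectors *)

Section Frames.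
Variable K : numClosedFieldType.
Implicit Types (A B : 'M[K]_3) (u v : 'rV[K]_3).

Lemma ord3P (i : 'I_3) : [\/ i = 0, i = 1 | i = 2%:R].
Proof.
by case: i => -[|[|[|//]]] i3; [apply: Or31|apply: Or32|apply: Or33]; apply: val_inj.
Qed.

Lemma sum3 (V : zmodType) (G : 'I_3 -> V) : \sum_i G i = G 0 + G 1 + G 2%:R.
Proof.
rewrite !big_ord_recl big_ord0 addr0 addrA.
by congr (_ + G _ + G _); apply: val_inj.
Qed.

(** ['I_3] is read as the integers modulo 3, where the three indices sum to 0. *)
Lemma third_index (m i : 'I_3) : m != i -> exists2 k, k != m & k != i.
Proof. by exists (- (m + i)); case: (ord3P m) (ord3P i) H => -> [] ->. Qed.

(** Some minor of [u] and [v], on columns [m] and [i], is nonzero; the middle row is the basis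
    vector of the remaining column. *)
Lemma complete_frame u v : u != 0 -> (forall k, v != k *: u) ->
  exists A, [/\ A \in unitmx, row 0 A = u & row ord_max A = v].
Proof.
move=> u0 vu; have /rV0Pn [m um] := u0.
have [i mi] : exists i, u 0 m * v 0 i - v 0 m * u 0 i != 0.
  apply/existsP; apply: contraT; rewrite negb_exists => /forallP H.
  case/eqP: (vu (v 0 m / u 0 m)); apply/rowP => i; rewrite mxE.
  have /negPn/eqP/eqP := H i; rewrite subr_eq0 => /eqP E.
  by apply: (mulfI um); rewrite E; field.
have [k km ki] : exists2 k, k != m & k != i.
  apply: third_index; apply: contraNneq mi => ->; rewrite mulrC subrr //.
pose A : 'M[K]_3 := \matrix_(a, j) [:: u 0 j; (j == k)%:R; v 0 j]`_a.
exists A; split; try by apply/rowP => j; rewrite !mxE.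
rewrite unitmxE unitfE; apply/negP => /det0P [w w0 wA]; case/eqP: w0.
have E j : w 0 0 * u 0 j + w 0 1 * (j == k)%:R + w 0 2%:R * v 0 j = 0.
  by have /rowP/(_ j) := wA; rewrite !mxE sum3 !mxE.
have [w0 w2] : w 0 0 = 0 /\ w 0 2%:R = 0.
  apply: (lin2 mi); first by have := E m; rewrite eq_sym (negPf km) mulr0 addr0.
  by have := E i; rewrite eq_sym (negPf ki) mulr0 addr0.
have w1 : w 0 1 = 0 by have := E k; rewrite w0 w2 !mul0r eqxx mulr1 add0r addr0.
by apply/rowP => j; rewrite mxE; case: (ord3P j) => ->.
Qed.

Lemma lin3_line A (x y a b : K) j : lin3 A 1 (x%:P + a *: 'X) (y%:P + b *: 'X) j =
  (aff A x y 0 j)%:P + ((\row_(i < 3) [:: 0; a; b]`_i) *m A) 0 j *: 'X.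
Proof.
rewrite /lin3 /aff !mxE !sum3 !mxE /mon3 /=.
move: (A 0 j) (A 1 j) (A 2%:R j) => s t w; rewrite -!mul_polyC !rmorphD !rmorphM /=.
by rewrite rmorph1 rmorph0; ring.
Qed.

Lemma pullback_line_coef1 A F (x y a b : K) :
  (pullback A F 1 (x%:P + a *: 'X) (y%:P + b *: 'X))`_1 =
  \sum_j meval (aff A x y 0) (mderiv j F) * ((\row_(i < 3) [:: 0; a; b]`_i) *m A) 0 j.
Proof.
rewrite pullback_coef1; apply: eq_bigr => j _; apply: congr2.
  by apply: meval_ext => i; rewrite /aff !coefD !coefC !coefZ !coefX /= !mulr0 !addr0.
by rewrite !coefD !coefC !coefZ !coefX /= !add0r !mulr1.
Qed.

End Frames.

(** * Points of the plane, and the Hessian at points without inflection *)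

Section Points.
Variable R : realType.
Notation C := R[i].
Implicit Types (F : mpoly 3 C) (A : 'M[C]_3) (O : CP2 R) (u v : 'rV[C]_3).

Lemma point_of u : u != 0 -> exists O : CP2 R, sval O = <[u]>%VS.
Proof.
move=> u0; have d : \dim <[u]>%VS == 1%N by rewrite dim_vline u0.
by exists (exist (fun L : {vspace 'rV[C]_3} => \dim L == 1%N) _ d).
Qed.

Lemma point_vec O : exists2 u, u != 0 & sval O = <[u]>%VS.
Proof.
case: O => L /= /eqP dL; have := vbasisP L; rewrite /basis_of => /andP[/eqP sp fr].
exists (vpick L); first by rewrite vpick0 -dimv_eq0 dL.
apply/eqP; rewrite eq_sym eqEdim dim_vline vpick0 -dimv_eq0 dL /= leqnn andbT.
by rewrite -memvE memv_pick.
Qed.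

Lemma aff_neq0 A x y : A \in unitmx -> aff A x y != 0.
Proof.
move=> Au; apply/eqP => /(congr1 (fun v => v *m invmx A)).
rewrite mulmxK // mul0mx => /rowP/(_ 0); rewrite !mxE /= => /eqP.
by rewrite oner_eq0.
Qed.

Lemma derivE_not_singular A F O x y : sval O = <[aff A x y]>%VS ->
  ev2 (deriv (dehomog A F)) x y != 0 -> ~ singular_point F O.
Proof.
move=> OE + [_ H]; rewrite ev2_derivE big1 ?eqxx // => j _.
by rewrite H ?mul0r // OE memv_line.
Qed.

(** If the Hessian vanishes, acceleration along the flow is proportional to velocity, so the 2-jet
    of the curve is that of its tangent line and the contact is at least 3. *)
Lemma hessian_neq0 d A F (e : C) x y O : A \in unitmx -> F \is ishomog1 d mdeg -> e != 0 ->
  ev2 (e%:P *: dehomog A F) x y = 0 -> ev2 (deriv (e%:P *: dehomog A F)) x y != 0 ->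
  sval O = <[aff A x y]>%VS -> ~ inflection_point F O ->
  ev2 (hessian (e%:P *: dehomog A F)) x y != 0.
Proof.
move=> Au hF e0 P0 Py OE ninf; set P := _ *: _ in P0 Py *.
have dP0 : ev2 (dehomog A F) x y = 0.
  by move: P0 => /eqP; rewrite ev2Z hornerC mulf_eq0 (negPf e0) => /eqP.
have dPy : ev2 (deriv (dehomog A F)) x y != 0.
  by move: Py; rewrite derivZ ev2Z hornerC mulf_eq0 negb_or => /andP[].
apply/eqP; rewrite (ev2_hessian P x y (N := 3)) // => /eqP.
set X := ejet P x y 3 'X%:P; set Y := ejet P x y 3 'X.
rewrite mulf_eq0 (negPf (facts_neq0 _ _)) w3_1 /= => /eqP W.
have X1 : X`_1 != 0 by rewrite /X ejet_x1.
apply: ninf; split.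
  split; last exact: derivE_not_singular OE dPy.
  by apply/(zero_locus_line hF OE); rewrite -ev2_dehomog.
pose u := aff A x y; pose v := (\row_(i < 3) [:: 0; X`_1; Y`_1]`_i) *m A.
(* This change of parameter kills the second coefficients of both coordinates, which stand in the
   same ratio to the first ones. *)
pose r : {poly C} := 'X - (X`_2 / X`_1) *: 'X^2.
have r0 : r`_0 = 0 by rewrite coefB coefX coefZ coefXn mulr0 subr0.
have rjet (Z : {poly C}) : Z`_2 = Z`_1 * (X`_2 / X`_1) ->
    jeq 3 (Z \Po r) ((Z`_0)%:P + Z`_1 *: 'X).
  move=> Z2; have ZE : jeq 3 Z ((Z`_0)%:P + Z`_1 *: 'X + Z`_2 *: 'X^2).
    case=> [|[|[|//]]] _; rewrite !coefD !coefZ coefX coefXn coefC /=;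
    by rewrite ?mulr0 ?mulr1 ?addr0 ?add0r.
  apply: jeq_trans (jeq_comp r0 ZE) _; apply/jeqP.
  rewrite !comp_polyD !comp_polyZ comp_polyC comp_polyX comp_Xn_poly Z2 /r.
  move: (X`_2 / X`_1) => s; rewrite -!mul_polyC polyCM.
  apply/dvdpP; exists ((Z`_1)%:P * s%:P * (s%:P ^+ 2 * 'X - 2 * s%:P)).
  by ring.
have H : jeq 3 (pullback A F 1 (x%:P + X`_1 *: 'X) (y%:P + Y`_1 *: 'X)) 0.
  have X0 : X`_0 = x by rewrite /X ejet_x0.
  have Y0 : Y`_0 = y by rewrite /Y ejet_y0.
  rewrite pullback_subst2 -X0 -Y0.
  have Y2 : Y`_2 = Y`_1 * (X`_2 / X`_1).
    apply: (mulfI X1); move/eqP: W; rewrite subr_eq0 => /eqP ->.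
    by field; rewrite X1.
  have Xr : jeq 3 (X \Po r) ((X`_0)%:P + X`_1 *: 'X) by apply: rjet; field; rewrite X1.
  apply: jeq_trans (subst2_jeq _ (jeq_sym Xr) (jeq_sym (rjet _ Y2))) _.
  rewrite -subst2_comp -[0](comp_poly0 r); apply: jeq_comp => //.
  have := @ejet_curve _ _ _ _ 3 P0; rewrite -/X -/Y /P -mul_polyC subst2M subst2C comp_polyC.
  by apply: jeq_cancel; rewrite coefC.
have rE : restrict_to_line F u v = pullback A F 1 (x%:P + X`_1 *: 'X) (y%:P + Y`_1 *: 'X).
  rewrite /restrict_to_line /pullback; congr mmap; apply/funext => j.
  exact/esym/lin3_line.
exists u, v; split => //.
- rewrite OE; apply/negP => /vlineP[k] /(congr1 (fun w => w *m invmx A)).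
  rewrite -scalemxAl !mulmxK // => /rowP E; have := E 0; have := E 1.
  rewrite !mxE /= => E1 /eqP; rewrite eq_sym mulr1 => /eqP k0.
  by move: X1; rewrite E1 k0 mul0r eqxx.
- have E := H 1%N isT.
  rewrite coef0 in E.
  rewrite pullback_line_coef1 in E.
  exact: E.
by move/jeqP: H; rewrite subr0 -rE.
Qed.

End Points.

Lemma affE (K : numClosedFieldType) (B : 'M[K]_3) x y j :
  aff B x y 0 j = B 0 j + x * B 1 j + y * B 2%:R j.
Proof. by rewrite /aff mxE sum3 !mxE /= mul1r. Qed.

(** * The function [psi] and its computation along arcs *)

Section InvariantFunction.
Variable K : numClosedFieldType.
Variables (d : nat) (F : mpoly 3 K) (A : 'M[K]_3) (e : K) (L : 'cV[K]_3).
Hypothesis hF : F \is ishomog1 d mdeg.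
Hypothesis Au : A \in unitmx.
Let P := e%:P *: dehomog A F.

Definition linval (v : 'rV[K]_3) : K := (v *m L) 0 0.

Lemma linvalZ k v : linval (k *: v) = k * linval v.
Proof. by rewrite /linval -scalemxAl mxE. Qed.

Lemma linval_aff B x y : linval (aff B x y) =
  linval (row 0 B) + x * linval (row 1 B) + y * linval (row 2%:R B).
Proof.
rewrite /linval ![(_ *m L) 0 0]mxE !sum3 !affE ![row _ B 0 _]mxE.
by ring.
Qed.

Lemma linval_row i : (A *m L) i 0 = linval (row i A).
Proof. by rewrite /linval !mxE; apply: eq_bigr => k _; rewrite mxE. Qed.

Definition line_poly : {poly {poly K}} := (linval (row 0 A))%:P%:P +
  (linval (row 1 A))%:P%:P * 'X%:P + (linval (row 2%:R A))%:P%:P * 'X.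

Lemma ev2_line_poly x y : ev2 line_poly x y = linval (aff A x y).
Proof.
rewrite linval_aff !ev2D !ev2M !ev2C !hornerC hornerX ev2X; congr (_ + _ + _); exact: mulrC.
Qed.

Lemma line_poly_neq0 : L != 0 -> line_poly != 0.
Proof.
apply: contraNneq => l0; apply/eqP.
have E x y : linval (aff A x y) = 0 by rewrite -ev2_line_poly l0 ev2_0.
have e0 : linval (row 0 A) = 0 by rewrite -(E 0 0) linval_aff; ring.
have e1 : linval (row 1 A) = 0 by rewrite -(E 1 0) linval_aff e0; ring.
have e2 : linval (row 2%:R A) = 0 by rewrite -(E 0 1) linval_aff e0; ring.
have AL : A *m L = 0.
  apply/matrixP => i j; rewrite ord1 [RHS]mxE.
  by rewrite linval_row; case: (ord3P i) => ->.
by rewrite -(mulKmx Au L) AL mulmx0.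
Qed.

Lemma size_line_poly : (size line_poly <= 2)%N.
Proof.
rewrite /line_poly -addrA; apply: leq_trans (size_polyD _ _) _; rewrite geq_max.
rewrite (leq_trans (size_polyC_leq1 _)) //=; apply: leq_trans (size_polyD _ _) _.
rewrite geq_max -polyCM (leq_trans (size_polyC_leq1 _)) //= mul_polyC.
by apply: leq_trans (size_scale_leq _ _) _; rewrite size_polyX.
Qed.

Definition psi x y :=
  ev2 (sextactic P) x y * linval (aff A x y) ^+ 3 / ev2 (hessian P) x y ^+ 5.

Lemma psi_eq0 x y : psi x y = 0 -> ev2 (sextactic P) x y != 0 ->
  ev2 (hessian P) x y != 0 -> linval (aff A x y) = 0.
Proof.
rewrite /psi => /eqP + S0 H0.
by rewrite mulf_eq0 invr_eq0 (negPf (expf_neq0 5 H0)) orbF mulf_eq0 (negPf S0) expf_eq0 /= => /eqP.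
Qed.

(** Computes [psi] from an arc written in another frame, where the point under study may sit at the
    origin even if it is at infinity for [A]. The constant [c0] depends on the frame but not on the
    arc, so bounds are transported uniformly. *)
Lemma psi_pullback B : B \in unitmx -> exists c0 : K, forall (a b c : {poly K}) x y k,
  ev2 P x y = 0 -> ev2 (deriv P) x y != 0 -> ev2 (hessian P) x y != 0 -> k != 0 ->
  (\row_(i < 3) [:: a`_0; b`_0; c`_0]`_i) *m B = k *: aff A x y ->
  jeq 6 (pullback B F a b c) 0 ->
  psi x y * w3 a b c ^+ 5 = c0 * w6 a b c * linval (k *: aff A x y) ^+ 3.
Proof.
move=> Bu; pose D := B *m invmx A; have [S HS] := w6_lin D.
have D0 : \det D != 0.
  by rewrite -unitfE -unitmxE unitmx_mul Bu unitmx_inv.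
exists (facts K 6 * S / (facts K 3 ^+ 5 * \det D ^+ 5)) => a b c x y k P0 Py H0 k0 rowE H.
have E : (\row_(i < 3) [:: a`_0; b`_0; c`_0]`_i) *m D = k *: \row_(i < 3) [:: 1; x; y]`_i.
  by rewrite /D mulmxA rowE -scalemxAl mulmxK.
have c_0 j : (lin3 D a b c j)`_0 = k * [:: 1; x; y]`_j.
  by rewrite lin3_coef E !mxE.
have := arc_formula (a := lin3 D a b c 0) (b := lin3 D a b c 1) (c := lin3 D a b c 2%:R)
  hF (erefl P) P0 Py k0.
rewrite !c_0 /= mulr1 => /(_ erefl erefl erefl); rewrite pullback_frame // => /(_ H).
rewrite w3_lin HS linvalZ /psi; have f0 := facts_neq0 K 3.
move: (w3 _ _ _) (w6 _ _ _) (ev2 _ _ _) (ev2 _ _ _) (linval _) (facts K 3) (facts K 6) (\det D)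
  H0 f0 D0 => w w' s h l f f' D' h0 f0 D0 E'.
have f50 : f ^+ 5 != 0 by rewrite expf_neq0.
have D50 : D' ^+ 5 != 0 by rewrite expf_neq0.
have h50 : h ^+ 5 != 0 by rewrite expf_neq0.
apply: (mulfI (mulf_neq0 f50 (mulf_neq0 D50 h50))).
transitivity (s * f ^+ 5 * (D' * w) ^+ 5 * l ^+ 3); first by field.
by rewrite E'; field; rewrite f0 D0.
Qed.

End InvariantFunction.

(** * Uniform estimates near a point and changes of frame *)

Section Bounds.
Variable R : realType.
Local Notation C := R[i].
Implicit Types (P Q : {poly {poly C}}) (A B : 'M[C]_3) (x y : C) (u v : 'rV[C]_3).

Definition lipschitz2 Q := forall r : R, 0 <= r -> exists2 M : R, 0 <= M &
  forall x y x' y', cabs x <= r -> cabs y <= r -> cabs x' <= r -> cabs y' <= r ->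
    cabs (ev2 Q x y - ev2 Q x' y') <= M * (cabs (x - x') + cabs (y - y')).

Lemma lipschitz2_bounded Q : lipschitz2 Q -> forall r : R, 0 <= r ->
  exists2 M : R, 0 <= M & forall x y, cabs x <= r -> cabs y <= r -> cabs (ev2 Q x y) <= M.
Proof.
move=> lQ r r0; have [M M0 H] := lQ r r0.
exists (M * (r + r) + cabs (ev2 Q 0 0)).
  by rewrite addr_ge0 ?cabs_ge0 // mulr_ge0 // addr_ge0.
move=> x y xr yr; have := H x y 0 0 xr yr; rewrite cabs0 => /(_ r0 r0).
have := cabs_lowerB (ev2 Q x y) (ev2 Q 0 0); rewrite !subr0.
have : M * (cabs x + cabs y) <= M * (r + r) by rewrite ler_wpM2l // lerD.
by lra.
Qed.

Lemma lipschitz2P Q : lipschitz2 Q.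
Proof.
have lC (c : C) : lipschitz2 c%:P%:P.
  move=> r r0; exists 0 => // x y x' y' _ _ _ _.
  by rewrite !ev2C !hornerC subrr cabs0 mul0r.
have lD Q1 Q2 : lipschitz2 Q1 -> lipschitz2 Q2 -> lipschitz2 (Q1 + Q2).
  move=> l1 l2 r r0; have [M M0 H] := l1 r r0; have [N N0 H'] := l2 r r0.
  exists (M + N); first exact: addr_ge0.
  move=> x y x' y' xr yr xr' yr'; rewrite !ev2D.
  have -> : ev2 Q1 x y + ev2 Q2 x y - (ev2 Q1 x' y' + ev2 Q2 x' y') =
    (ev2 Q1 x y - ev2 Q1 x' y') + (ev2 Q2 x y - ev2 Q2 x' y') by ring.
  by apply: le_trans (cabsD _ _) _; rewrite mulrDl lerD ?H ?H'.
have lM Q1 Q2 : lipschitz2 Q1 -> lipschitz2 Q2 -> lipschitz2 (Q1 * Q2).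
  move=> l1 l2 r r0; have [M M0 H] := l1 r r0; have [N N0 H'] := l2 r r0.
  have [m m0 b1] := lipschitz2_bounded l1 r0; have [n n0 b2] := lipschitz2_bounded l2 r0.
  exists (M * n + m * N); first by rewrite addr_ge0 ?mulr_ge0.
  move=> x y x' y' xr yr xr' yr'; rewrite !ev2M.
  have -> : ev2 Q1 x y * ev2 Q2 x y - ev2 Q1 x' y' * ev2 Q2 x' y' =
    (ev2 Q1 x y - ev2 Q1 x' y') * ev2 Q2 x y +
    ev2 Q1 x' y' * (ev2 Q2 x y - ev2 Q2 x' y') by ring.
  apply: le_trans (cabsD _ _) _; rewrite !cabsM mulrDl; apply: lerD.
    by rewrite mulrAC ler_pM ?cabs_ge0 ?H ?b2.
  by rewrite -mulrA ler_pM ?cabs_ge0 ?H' ?b1.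
have lX : lipschitz2 'X.
  move=> r r0; exists 1 => // x y x' y' _ _ _ _; rewrite !ev2X mul1r.
  by have := cabs_ge0 (x - x'); lra.
have lx : lipschitz2 'X%:P.
  move=> r r0; exists 1 => // x y x' y' _ _ _ _; rewrite !ev2C !hornerX mul1r.
  by have := cabs_ge0 (y - y'); lra.
elim/poly_ind: Q => [|f c IH]; first exact: (lC 0).
apply: (lD); first exact: (lM).
elim/poly_ind: c => [|c a IHc]; first exact: (lC 0).
by rewrite polyCD polyCM; apply: (lD) => //; exact: (lM).
Qed.

Lemma ev2_near Q (e : R) : 0 < e -> exists2 d : R, 0 < d & forall x y,
  cabs x < d -> cabs y < d -> cabs (ev2 Q x y - ev2 Q 0 0) < e.
Proof.
move=> e0; have [M M0 H] := lipschitz2P Q ler01.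
exists (Num.min 1 (e / (2 * (M + 1)))).
  by rewrite lt_min ltr01 divr_gt0 //; lra.
move=> x y; rewrite !lt_min => /andP[x1 xe] /andP[y1 ye].
have := H x y 0 0 (ltW x1) (ltW y1); rewrite cabs0 => /(_ ler01 ler01); rewrite !subr0.
move/le_lt_trans; apply.
apply: (@le_lt_trans _ _ ((M + 1) * (cabs x + cabs y))).
  by apply: ler_wpM2r; [rewrite addr_ge0 ?cabs_ge0|lra].
have M1 : 0 < M + 1 by lra.
have -> : e = (M + 1) * (e / (2 * (M + 1)) + e / (2 * (M + 1))) by field; lra.
by rewrite ltr_pM2l //; lra.
Qed.

Lemma aff_near B (e : R) : 0 < e -> exists2 d : R, 0 < d & forall x y,
  cabs x < d -> cabs y < d -> forall j, cabs (aff B x y 0 j - B 0 j) < e.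
Proof.
move=> e0; pose S := \sum_i \sum_j cabs (B i j).
have S0 : 0 <= S by apply: sumr_ge0 => i _; apply: sumr_ge0 => j _; exact: cabs_ge0.
have SB i j : cabs (B i j) <= S.
  rewrite /S (bigD1 i) //= (bigD1 j) //= -addrA lerDl addr_ge0 //.
    by apply: sumr_ge0 => k _; exact: cabs_ge0.
  by apply: sumr_ge0 => k _; apply: sumr_ge0 => l _; exact: cabs_ge0.
exists (e / (2 * (S + 1))); first by rewrite divr_gt0 //; lra.
move=> x y xd yd j; rewrite affE.
have -> : B 0 j + x * B 1 j + y * B 2%:R j - B 0 j = x * B 1 j + y * B 2%:R j by ring.
apply: le_lt_trans (cabsD _ _) _; rewrite !cabsM.
have -> : e = e / (2 * (S + 1)) * (S + 1) + e / (2 * (S + 1)) * (S + 1) by field; lra.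
apply: ltrD; apply: (@le_lt_trans _ _ (e / (2 * (S + 1)) * S));
  rewrite ?ler_pM ?cabs_ge0 ?SB ?(ltW xd) ?(ltW yd) // ltr_pM2l ?divr_gt0 //; lra.
Qed.

(** Such a vector has its first coordinate in the frame close to 1 and the others close to 0; divide
    by the first. *)
Lemma near_frame B (e : R) : B \in unitmx -> 0 < e -> exists2 d : R, 0 < d & forall v,
  (forall j, cabs (v 0 j - B 0 j) < d) ->
  exists k x y, [/\ k != 0, cabs x < e, cabs y < e & v = k *: aff B x y].
Proof.
move=> Bu e0; pose S := \sum_i \sum_j cabs (invmx B i j).
have S0 : 0 <= S by apply: sumr_ge0 => i _; apply: sumr_ge0 => j _; exact: cabs_ge0.
have SB i j : cabs (invmx B i j) <= S.
  rewrite /S (bigD1 i) //= (bigD1 j) //= -addrA lerDl addr_ge0 //.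
    by apply: sumr_ge0 => k _; exact: cabs_ge0.
  by apply: sumr_ge0 => k _; apply: sumr_ge0 => l _; exact: cabs_ge0.
pose m := Num.min (1 / 2) (e / 2).
have m0 : 0 < m by rewrite lt_min !divr_gt0.
exists (m / (3 * (S + 1))); first by rewrite divr_gt0 //; lra.
move=> v vB; pose w := v *m invmx B.
have wE j : cabs (w 0 j - (j == 0)%:R) < m.
  have -> : w 0 j - (j == 0)%:R = \sum_i (v 0 i - B 0 i) * invmx B i j.
    under eq_bigr do rewrite mulrBl.
    rewrite sumrB; congr (_ - _); first by rewrite mxE.
    have := mulmxV Bu => /matrixP/(_ 0 j); rewrite !mxE eq_sym => ->.
    by case: eqP.
  apply: le_lt_trans (cabs_sum _ _ _) _; rewrite sum3 !cabsM.
  have -> : m = m / (3 * (S + 1)) * (S + 1) + m / (3 * (S + 1)) * (S + 1)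
     + m / (3 * (S + 1)) * (S + 1) by field; lra.
  have H i : cabs (v 0 i - B 0 i) * cabs (invmx B i j) < m / (3 * (S + 1)) * (S + 1).
    apply: (@le_lt_trans _ _ (m / (3 * (S + 1)) * S)).
      by apply: ler_pM; rewrite ?cabs_ge0 // ltW.
    by rewrite ltr_pM2l ?divr_gt0 //; lra.
  by rewrite !ltrD.
have m2 : m <= 1 / 2 by rewrite ge_min lexx.
have me : m <= e / 2 by rewrite ge_min lexx orbT.
have w0 : 1 / 2 < cabs (w 0 0).
  have := wE 0; rewrite eqxx cabsBC => h.
  by have := cabs_lowerB 1 (w 0 0); rewrite cabs1; lra.
have w00 : w 0 0 != 0 by rewrite -cabs_gt0; lra.
have small j : j != 0 -> cabs (w 0 j / w 0 0) < e.
  move=> j0; have := wE j; rewrite (negPf j0) subr0 => h.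
  rewrite cabsM cabsV ltr_pdivrMr ?cabs_gt0 //.
  have : e * (1 / 2) <= e * cabs (w 0 0) by rewrite ler_pM2l // ltW.
  by lra.
exists (w 0 0), (w 0 1 / w 0 0), (w 0 2%:R / w 0 0); split; rewrite ?small //.
have vE : v = w *m B by rewrite /w mulmxKV.
rewrite vE; clearbody w; apply/rowP => j; rewrite !mxE !sum3 !mxE /=; field.
by rewrite w00.
Qed.

Lemma transition B B' (l : C) (e : R) : B \in unitmx -> B' \in unitmx -> l != 0 ->
  row 0 B' = l *: row 0 B -> 0 < e -> exists2 d : R, 0 < d & forall x y,
  cabs x < d -> cabs y < d -> exists k x' y',
    [/\ k != 0, cabs x' < e, cabs y' < e & aff B' x y = k *: aff B x' y'].
Proof.
move=> Bu B'u l0 rE e0; have [d d0 Hd] := near_frame Bu e0.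
have l0' : 0 < cabs l by rewrite cabs_gt0.
have [d' d'0 Hd'] := aff_near B' (e := d * cabs l) ltac:(exact: mulr_gt0).
exists d' => // x y xd yd; have [j|k [x' [y' [k0 xe ye E]]]] := Hd (l^-1 *: aff B' x y).
  have := Hd' x y xd yd j; rewrite -ltr_pdivrMr // -cabsV -cabsM; congr (cabs _ < _).
  have -> : B' 0 j = l * B 0 j by have /rowP/(_ j) := rE; rewrite !mxE.
  by rewrite [X in _ = X - _]mxE; field.
exists (l * k), x', y'; split; rewrite ?mulf_neq0 //.
by rewrite -scalerA -E scalerA divff // scale1r.
Qed.

End Bounds.

(** * Boundedness of [psi] near smooth points *)

Section SmoothPoints.
Variable R : realType.
Local Notation C := R[i].
Variables (d : nat) (F : mpoly 3 C) (A : 'M[C]_3) (e : C) (L : 'cV[C]_3).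
Hypothesis hF : F \is ishomog1 d mdeg.
Hypothesis Au : A \in unitmx.
Let P := e%:P *: dehomog A F.
Implicit Types (B : 'M[C]_3) (u v : 'rV[C]_3) (O : CP2 R) (x y k : C).

Definition regular x y :=
  [/\ ev2 P x y = 0, ev2 (deriv P) x y != 0 & ev2 (hessian P) x y != 0].

Definition psi_bounded_near (u : 'rV[C]_3) := exists2 r : R, 0 < r & exists m : R,
  forall x y k, k != 0 -> regular x y ->
    (forall j, cabs ((k *: aff A x y) 0 j - u 0 j) < r) -> cabs (psi F A e L x y) <= m.

Lemma psi_bounded_frame B (r m : R) : B \in unitmx -> 0 < r ->
  (forall X Y x y k, cabs X < r -> cabs Y < r -> k != 0 -> regular x y ->
     aff B X Y = k *: aff A x y -> cabs (psi F A e L x y) <= m) ->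
  psi_bounded_near (row 0 B).
Proof.
move=> Bu r0 H; have [r' r'0 H'] := near_frame Bu r0.
exists r' => //; exists m => x y k k0 reg near.
have [j|k' [X [Y [k'0 Xr Yr E]]]] := H' (k *: aff A x y).
  by have := near j; rewrite [row 0 B 0 j]mxE.
apply: (H X Y x y (k'^-1 * k)) => //; first by rewrite mulf_neq0 ?invr_eq0.
by rewrite -scalerA E scalerA mulVf // scale1r.
Qed.

Lemma linval_bounded B : exists2 m : R, 0 <= m & forall x y,
  cabs x <= 1 -> cabs y <= 1 -> cabs (linval L (aff B x y)) <= m.
Proof.
exists (cabs (linval L (row 0 B)) + cabs (linval L (row 1 B)) + cabs (linval L (row 2%:R B))).
  by rewrite !addr_ge0 ?cabs_ge0.
move=> x y x1 y1; rewrite linval_aff.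
apply: le_trans (cabsD _ _) _; rewrite lerD //; last first.
  by rewrite cabsM ler_piMl ?cabs_ge0.
apply: le_trans (cabsD _ _) _; rewrite lerD //.
by rewrite cabsM ler_piMl ?cabs_ge0.
Qed.

Lemma not_singular_mderiv O u : sval O = <[u]>%VS -> zero_locus F O ->
  ~ singular_point F O -> exists j, meval (u 0) (mderiv j F) != 0.
Proof.
move=> Ou FO nsing; apply: contrapT => H; apply: nsing; split=> // u'.
rewrite Ou => /vlineP[k ->] j; rewrite (meval_homog _ _ (mderiv_homog j hF)).
by have [->|nz] := eqVneq (meval (u 0) (mderiv j F)) 0; [rewrite mulr0|case: H; exists j].
Qed.

Lemma aff00 B : aff B 0 0 = row 0 B.
Proof. by apply/rowP => j; rewrite affE !mul0r !addr0 mxE. Qed.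

(** Some partial derivative of [F] is nonzero at [u]; the corresponding basis vector is off the
    tangent line, whereas [u] is on it by Euler's relation, so the two are independent. *)
Lemma smooth_frame O u : u != 0 -> sval O = <[u]>%VS -> zero_locus F O ->
  ~ singular_point F O -> exists B, [/\ B \in unitmx, row 0 B = u &
    ev2 (deriv (dehomog B F)) 0 0 != 0].
Proof.
move=> u0 Ou FO nsing; have [j0 Fj] := not_singular_mderiv Ou FO nsing.
have Fu : meval (u 0) F = 0 by apply/(zero_locus_line hF Ou).
pose v : 'rV[C]_3 := delta_mx 0 j0.
have sv : \sum_j meval (u 0) (mderiv j F) * v 0 j = meval (u 0) (mderiv j0 F).
  rewrite (bigD1 j0) //= big1 => [|j jj]; rewrite mxE !eqxx ?mulr1 ?addr0 //=.
  by rewrite (negPf jj) mulr0.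
have [k|B [Bu B0 B2]] := @complete_frame _ u v u0.
  apply: contraNneq Fj => vE; rewrite -sv vE.
  under eq_bigr do rewrite [(k *: u) 0 _]mxE mulrCA.
  by rewrite -mulr_sumr (euler hF Fu) mulr0.
exists B; split=> //; rewrite ev2_derivE aff00 B0.
rewrite -sv in Fj; apply: contraNneq Fj => E; apply/eqP; rewrite -[RHS]E; apply: eq_bigr => j _.
rewrite -B2 [row _ _ _ _]mxE; congr (_ * B _ _); exact: val_inj.
Qed.

(** In a frame centred at the point the Hessian is nonzero at the origin, hence stays above half its
    modulus nearby, while the sextactic polynomial and the linear form are bounded. The arc used is
    the Hamiltonian flow in that frame. *)
Lemma psi_bounded_smooth O u : u != 0 -> sval O = <[u]>%VS -> zero_locus F O ->
  ~ singular_point F O -> ~ inflection_point F O -> psi_bounded_near u.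
Proof.
move=> u0 Ou FO nsing ninf; have [B [Bu B0 BY]] := smooth_frame u0 Ou FO nsing.
have Fu : meval (u 0) F = 0 by apply/(zero_locus_line hF Ou).
(* The factor 1 only gives the shape to which [hessian_neq0] applies. *)
pose Q := 1%:P *: dehomog B F; have QE : Q = dehomog B F by rewrite /Q scale1r.
have H0 : ev2 (hessian Q) 0 0 != 0.
  apply: (hessian_neq0 Bu hF (oner_neq0 _) _ _ _ ninf).
  - by rewrite -/Q QE ev2_dehomog aff00 B0.
  - by rewrite -/Q QE.
  - by rewrite aff00 B0.
have [c0 Hc] := psi_pullback e L hF Au Bu.
have h0 : 0 < cabs (ev2 (hessian Q) 0 0) / 2 by rewrite divr_gt0 ?cabs_gt0.
have [r1 r10 H1] := ev2_near (hessian Q) h0.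
have [r2 r20 H2] := ev2_near (sextactic Q) ltr01.
have [m m0 Hm] := linval_bounded B.
pose h := cabs (ev2 (hessian Q) 0 0) / 2.
pose s := cabs (ev2 (sextactic Q) 0 0) + 1.
have f3 : 0 < cabs (facts C 3) by rewrite cabs_gt0 facts_neq0.
have f6 : 0 < cabs (facts C 6) by rewrite cabs_gt0 facts_neq0.
rewrite -B0; apply: (@psi_bounded_frame B (Num.min 1 (Num.min r1 r2))
  (cabs c0 * (s / cabs (facts C 6)) * m ^+ 3 / (h / cabs (facts C 3)) ^+ 5)) => //.
  by rewrite !lt_min ltr01 r10.
move=> X Y x y k; rewrite !lt_min => /and3P[X1 Xr1 Xr2] /and3P[Y1 Yr1 Yr2] k0 [P0 Py Ph] E.
have Q0 : ev2 Q X Y = 0.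
  move: P0; rewrite QE /P !(ev2_dehomog, ev2Z, hornerC) E (meval_homog _ _ hF).
  have e0 : e != 0.
    by apply: contraNneq Py => e0; rewrite /P e0 scale0r deriv0 ev2_0.
  by move=> /eqP; rewrite mulf_eq0 (negPf e0) => /eqP ->; rewrite mulr0.
have J : jeq 6 (pullback B F 1 (ejet Q X Y 6 'X%:P) (ejet Q X Y 6 'X)) 0.
  by rewrite pullback_subst2 -QE; exact: ejet_curve.
have := Hc 1 (ejet Q X Y 6 'X%:P) (ejet Q X Y 6 'X) x y k P0 Py Ph k0.
rewrite ejet_x0 ejet_y0 coefC /= => /(_ E J) /(congr1 (@cabs R)).
have w3E : w3 1 (ejet Q X Y 6 'X%:P) (ejet Q X Y 6 'X) = ev2 (hessian Q) X Y / facts C 3.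
  by rewrite (ev2_hessian Q X Y (N := 6)) // mulrC mulKf ?facts_neq0.
have w6E : w6 1 (ejet Q X Y 6 'X%:P) (ejet Q X Y 6 'X) = ev2 (sextactic Q) X Y / facts C 6.
  by rewrite (ev2_sextactic Q X Y (N := 6)) // mulrC mulKf ?facts_neq0.
rewrite w3E w6E -E cabsM cabsX [RHS]cabsM cabsX (cabsM c0) !(cabsM (ev2 _ _ _)) !cabsV => E'.
have hh : h <= cabs (ev2 (hessian Q) X Y).
  by have := H1 X Y Xr1 Yr1; rewrite cabsBC => t; have := cabs_lowerB (ev2 (hessian Q) 0 0) (ev2 (hessian Q) X Y); rewrite /h; lra.
have ss : cabs (ev2 (sextactic Q) X Y) <= s.
  by have := H2 X Y Xr2 Yr2 => t; have := cabs_lowerB (ev2 (sextactic Q) X Y) (ev2 (sextactic Q) 0 0); rewrite /s; lra.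
have h0' : 0 < h by [].
have q0 : 0 < (h / cabs (facts C 3)) ^+ 5 by rewrite exprn_gt0 // divr_gt0.
rewrite ler_pdivlMr //.
apply: (@le_trans _ _ (cabs (psi F A e L x y) * (cabs (ev2 (hessian Q) X Y) / cabs (facts C 3)) ^+ 5)).
  rewrite ler_wpM2l ?cabs_ge0 // lerXn2r ?nnegrE ?divr_ge0 ?cabs_ge0 ?(ltW h0') //.
  by rewrite ler_pM2r ?invr_gt0.
rewrite E' ler_pM ?exprn_ge0 ?mulr_ge0 ?invr_ge0 ?cabs_ge0 //.
  by rewrite ler_wpM2l ?cabs_ge0 // ler_pM2r ?invr_gt0.
by rewrite lerXn2r ?nnegrE ?cabs_ge0 // Hm ?(ltW X1) ?(ltW Y1).
Qed.

End SmoothPoints.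

(** * Estimates on jets and their determinants *)

Section JetBounds.
Variable R : realType.
Local Notation C := R[i].
Implicit Types (p X Y : {poly C}) (t z : C).

Lemma det_bound n (m : R) : 0 <= m -> exists2 k : R, 0 <= k &
  forall M : 'M[C]_n, (forall i j, cabs (M i j) <= m) -> cabs (\det M) <= k.
Proof.
move=> m0; elim: n => [|n [k k0 H]].
  by exists 1 => // M _; rewrite det_mx00 cabs1.
exists (\sum_(j < n.+1) m * k); first by apply: sumr_ge0 => j _; exact: mulr_ge0.
move=> M HM; rewrite (expand_det_row _ ord0); apply: le_trans (cabs_sum _ _ _) _.
apply: ler_sum => j _; rewrite cabsM; apply: ler_pM; rewrite ?cabs_ge0 //.
rewrite /cofactor cabsM cabsX cabsN cabs1 expr1n mul1r; apply: H => i l.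
by rewrite !mxE.
Qed.

Lemma coef_mul_bound X Y (m : R) : 0 <= m ->
  (forall j, (j < 6)%N -> cabs X`_j <= m) -> (forall j, (j < 6)%N -> cabs Y`_j <= m) ->
  forall j, (j < 6)%N -> cabs (X * Y)`_j <= 6 * m ^+ 2.
Proof.
move=> m0 HX HY j j6; rewrite coefM; apply: le_trans (cabs_sum _ _ _) _.
apply: (@le_trans _ _ (\sum_(i < j.+1) m ^+ 2)).
  apply: ler_sum => i _; rewrite cabsM expr2.
  by apply: ler_pM; rewrite ?cabs_ge0 ?HX ?HY //; have := ltn_ord i; lia.
rewrite sumr_const card_ord -[X in X <= _]mulr_natl ler_wpM2r ?exprn_ge0 //.
by rewrite ler_nat.
Qed.

Lemma w6_bound (m : R) : 0 <= m -> exists2 k : R, 0 <= k & forall X Y,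
  (forall j, (j < 6)%N -> cabs X`_j <= m) -> (forall j, (j < 6)%N -> cabs Y`_j <= m) ->
  cabs (w6 1 X Y) <= k.
Proof.
move=> m0; pose k := 1 + m + 6 * m ^+ 2.
have m2 : 0 <= m ^+ 2 by exact: exprn_ge0.
have k0 : 0 <= k by rewrite /k; lra.
have [K K0 HK] := det_bound 6 k0; exists K => // X Y HX HY.
apply: HK => i j; rewrite mxE.
have j6 := ltn_ord j; have HXj := HX j j6; have HYj := HY j j6.
have H2 := coef_mul_bound m0 HX HX j6; have H3 := coef_mul_bound m0 HX HY j6.
have H4 := coef_mul_bound m0 HY HY j6.
rewrite /mon6; case: i => -[|[|[|[|[|[|//]]]]]] ? /=; rewrite ?mul1r /k; try lra.
by rewrite coefC; case: eqP => _; rewrite ?cabs1 ?cabs0; lra.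
Qed.

Lemma subst2_horner (f : {poly {poly C}}) (u v : {poly C}) t :
  (subst2 f u v).[t] = ev2 f u.[t] v.[t].
Proof.
elim/poly_ind: f => [|f c IH]; first by rewrite /subst2 rmorph0 !horner0 ev2_0.
rewrite subst2D subst2M subst2X subst2C hornerD hornerM IH horner_comp.
by rewrite ev2D ev2M ev2X ev2C.
Qed.

Lemma vanish_of_small (f : C -> C) a (M d : R) N : 0 < d -> ccont f a ->
  (forall w, 0 < cabs (w - a) < d -> cabs (f w) <= M * cabs (w - a) ^+ N.+1) -> f a = 0.
Proof.
move=> d0 cf H; apply/eqP/negPn/negP => fa.
have [d' d'0 H'] := ccont_neq0 cf fa.
pose M' := `|M|; have M'0 : 0 <= M' by exact: normr_ge0.
pose r := Num.min (Num.min (d / 2) (d' / 2)) (Num.min 1 (cabs (f a) / (2 * (M' + 1)))).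
have fa0 : 0 < cabs (f a) by rewrite cabs_gt0.
have r0 : 0 < r.
  by rewrite !lt_min ltr01 !divr_gt0 //; lra.
have rd : r <= d / 2 by rewrite /r !ge_min lexx.
have rd' : r <= d' / 2 by rewrite /r !ge_min lexx !orbT.
have r1 : r <= 1 by rewrite /r !ge_min lexx !orbT.
have rf : r <= cabs (f a) / (2 * (M' + 1)) by rewrite /r !ge_min lexx !orbT.
have wr : cabs (a + r%:C - a) = r by rewrite addrC addKr cabsR gtr0_norm.
have h1 : cabs (f a) / 2 < cabs (f (a + r%:C)) by apply: H'; rewrite wr; lra.
have h2 : cabs (f (a + r%:C)) <= M * r ^+ N.+1.
  by have := H (a + r%:C); rewrite wr; apply; rewrite r0; lra.
have h3 : M * r ^+ N.+1 <= (M' + 1) * r.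
  apply: (@le_trans _ _ (M' * r ^+ N.+1)).
    by rewrite ler_pM2r ?exprn_gt0 //; exact: ler_norm.
  apply: ler_pM => //; rewrite ?exprn_ge0 ?(ltW r0) //; first by lra.
  by rewrite exprS ler_piMr ?(ltW r0) // exprn_ile1 ?(ltW r0).
have h4 : (M' + 1) * r <= cabs (f a) / 2.
  have -> : cabs (f a) / 2 = (M' + 1) * (cabs (f a) / (2 * (M' + 1))) by field; lra.
  by rewrite ler_pM2l //; lra.
by lra.
Qed.

Lemma poly_order N p (M d : R) : 0 < d ->
  (forall t, 0 < cabs t < d -> cabs p.[t] <= M * cabs t ^+ N) -> jeq N p 0.
Proof.
elim: N p => [//|N IH] p d0 H.
have p0 : p.[0] = 0.
  apply: (vanish_of_small (M := M) (d := d) (N := N) (f := fun t => p.[t])) => //.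
    exact: ccont_horner (ccont_id _).
  by move=> w; rewrite subr0; exact: H.
have /factor_theorem[q pE] : root p 0 by apply/rootP.
rewrite subr0 in pE; rewrite pE in H *.
case=> [|j]; rewrite coefMX coef0 //= ltnS => jN.
rewrite (IH q d0) ?coef0 // => t td.
have := H t td; rewrite hornerM hornerX cabsM exprSr mulrA ler_pM2r //.
by case/andP: td.
Qed.

Lemma w3_scale (a b : C) X Y : w3 1 (a *: X) (b *: Y) = a * b * w3 1 X Y.
Proof. by rewrite !w3_1 !coefZ; ring. Qed.

(** The six monomials have total degree 4 in each of the two coordinates. *)
Lemma w6_scale (a b : C) X Y : w6 1 (a *: X) (b *: Y) = a ^+ 4 * b ^+ 4 * w6 1 X Y.
Proof.
pose s (i : 'I_6) : C := [:: 1; a; b; a ^+ 2; a * b; b ^+ 2]`_i.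
have sc : \det (diag_mx (\row_i s i)) = a ^+ 4 * b ^+ 4.
  rewrite det_diag; under eq_bigr do rewrite mxE.
  by rewrite !big_ord_recr big_ord0 /s /=; ring.
rewrite -sc /w6 -wr_linear; apply: wr_ext => i.
rewrite (bigD1 i) //= big1 => [|k ki]; rewrite !mxE; last first.
  by rewrite (negPf ki) mulr0n scale0r.
rewrite eqxx mulr1n addr0 /mon6 /s; case: i => -[|[|[|[|[|[|//]]]]]] ? /=;
  by rewrite -!mul_polyC ?polyC1 ?rmorphXn ?rmorphM /=; ring.
Qed.

Lemma coef_X1n n j : (('X + 1 : {poly C}) ^+ n)`_j = 'C(n, j)%:R.
Proof.
rewrite exprDn; under eq_bigr do rewrite expr1n mulr1.
rewrite coef_sum; have [jn|nj] := leqP j n; last first.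
  rewrite bin_small // big1 // => i _; rewrite coefMn coefXn.
  case: eqP => [E|_]; last by rewrite mul0rn.
  by have := ltn_ord (rev_ord i); rewrite /= subSS -E; lia.
have jn' : (n - j < n.+1)%N by rewrite ltnS leq_subr.
rewrite (bigD1 (Ordinal jn')) //= big1 => [|i ij].
  by rewrite addr0 coefMn coefXn subKn // eqxx bin_sub.
rewrite coefMn coefXn; case: eqP => [E|_]; last by rewrite mul0rn.
by case/eqP: ij; apply: val_inj; rewrite /= E; have := ltn_ord i; lia.
Qed.

End JetBounds.

(** * The jet of a Puiseux parametrization at a nearby parameter *)

Section BranchBound.
Variable R : realType.
Local Notation C := R[i].

(** This is the Wronskian of [1], [(1 + s) ^ q] and [c (1 + s) ^ (2 q)] with errors [e1] and [e2] in
    the last function; the main term [c q ^ 3] does not vanish. *)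
Lemma bin_wronskian (q : nat) (c e1 e2 : C) :
  'C(q, 1)%:R * (c * 'C(2 * q, 2)%:R + e2) - 'C(q, 2)%:R * (c * 'C(2 * q, 1)%:R + e1) =
  c * q%:R ^+ 3 + (q%:R * e2 - 'C(q, 2)%:R * e1).
Proof.
have two : 2 != 0 :> C by rewrite pnatr_eq0.
have b2 n : 'C(n, 2)%:R * 2 = n%:R * (n%:R - 1) :> C.
  rewrite -natrM; case: n => [|n]; first by rewrite mul0r.
  have -> : ('C(n.+1, 2) * 2 = n.+1 * n)%N.
    by rewrite bin2 -[RHS]odd_double_half -muln2 oddM /= andNb.
  by rewrite natrM -[n.+1%:R]natr1 addrK.
have := b2 q; have := b2 (2 * q)%N; rewrite !bin1 natrM.
move: ('C(q, 2)%:R) ('C(2 * q, 2)%:R) (q%:R : C) => u v w Ev Eu.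
apply: (mulfI two).
have -> : 2 * (w * (c * v + e2) - u * (c * (2 * w) + e1)) =
  c * w * (v * 2 - 2 * (u * 2)) + 2 * (w * e2 - u * e1) by ring.
by rewrite Eu Ev; ring.
Qed.

Section Jets.
Variables (B : 'M[C]_3) (F : mpoly 3 C) (g : C -> C) (q : nat) (c : C) (rho : R).
Hypothesis rho0 : 0 < rho.
Hypothesis dg : forall t, cabs t < rho -> cdiff g t.
Hypothesis Fg : forall t, cabs t < rho -> meval (aff B (t ^+ q) (g t) 0) F = 0.

Definition branch_rest t := g t - c * t ^+ (2 * q).

(* The radius [r] of the Cauchy estimates stays free: [cabs t1 / 2] controls
   [w3], while for [q = 1] the bound on [w6] needs a radius independent of [t1]. *)
Lemma branch_jet : exists2 T : R, 0 <= T & forall t1, 0 < cabs t1 < rho -> exists hc : nat -> C,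
  let Y := c *: ('X + t1%:P) ^+ (2 * q) + \poly_(j < 6) hc j in
  [/\ forall r m : R, 0 < r -> 0 <= m -> r <= rho - cabs t1 - r ->
        (forall w, cabs (w - t1) <= r -> cabs (branch_rest w) <= m) ->
        forall j, (j < 6)%N -> cabs (hc j) * r ^+ j <= T * m,
      Y`_0 = g t1 &
      jeq 6 (pullback B F 1 (('X + t1%:P) ^+ q) Y) 0].
Proof.
have [T T0 HT] := taylor R 6; exists T => // t1 /andP[t10 t1r].
have dh t : cabs t < rho -> cdiff branch_rest t.
  move=> tr; apply: cdiffB; first exact: dg.
  by apply: cdiffM; [exact: cdiff_cst|apply: cdiffX; exact: cdiff_id].
have ins w r : cabs (w - t1) <= r -> r <= rho - cabs t1 - r -> 0 < r -> cabs w < rho.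
  by move=> h h' h''; have := cabs_lowerB w t1; lra.
have [r0 [m0 [r00 m00 hp0]]] : exists r0 m0, [/\ 0 < r0, 0 <= m0 & holo_punctured branch_rest t1 r0 m0].
  have [dd dd0 Hd] := ccont_bounded (cdiff_cont (dh t1 t1r)).
  exists (Num.min (dd / 2) ((rho - cabs t1) / 2)), (cabs (branch_rest t1) + 1); split.
  - by rewrite lt_min !divr_gt0 // subr_gt0.
  - by rewrite addr_ge0 ?cabs_ge0.
  move=> w /andP[_]; rewrite le_min => /andP[w1 w2]; split; last by apply/ltW/Hd; lra.
  by apply: dh; have := cabs_lowerB w t1; lra.
have [hc [Hc [dl dl0 [M HM]]]] := HT _ t1 r0 m0 r00 m00 hp0.
exists hc => Y.
have Yt t : Y.[t] = c * (t + t1) ^+ (2 * q) + \sum_(j < 6) hc j * t ^+ j.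
  by rewrite hornerD hornerZ horner_exp hornerD hornerX hornerC horner_poly.
split.
- move=> r m r_0 m_0 rr Hm j j6; apply: Hc => // w /andP[w0 wr]; split; last exact: Hm.
  by apply: dh; apply: ins wr rr r_0.
- rewrite -horner_coef0 Yt add0r.
  pose f w := branch_rest w - \sum_(j < 6) hc j * (w - t1) ^+ j.
  have z : f t1 = 0.
    apply: (vanish_of_small (f := f) (M := M) (d := dl) (N := 5)) => //.
      apply: cdiff_cont. apply: (@cdiffB R branch_rest (fun w => \sum_(j < 6) hc j * (w - t1) ^+ j));
        first exact: dh.
      pose p := \poly_(j < 6) hc j.
      apply: (cdiff_near (d := 1) (f := fun w => p.[w - t1])) => //.
        by move=> w _; rewrite horner_poly.
      elim/poly_ind: p => [|p a IH].
        by apply: (cdiff_near (d := 1) (f := fun=> 0)) (cdiff_cst _ _) => // w _; rewrite horner0.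
      apply: (cdiff_near (d := 1) (f := fun w => p.[w - t1] * (w - t1) + a)) => //.
        by move=> w _; rewrite hornerMXaddC.
      apply: cdiffD; last exact: cdiff_cst.
      by apply: cdiffM => //; apply: cdiffB; [exact: cdiff_id|exact: cdiff_cst].
    by move=> w /andP[w0 wd]; apply: HM; rewrite w0 ltW.
  rewrite /f subrr in z; move/eqP: z; rewrite subr_eq0 => /eqP <-.
  by rewrite /branch_rest addrC subrK.
rewrite pullback_subst2; set D := dehomog B F.
pose S := cabs t1 + 1 + \sum_(j < size Y) cabs Y`_j.
pose X := ('X + t1%:P : {poly C}) ^+ q.
have [rr rr0 Hr] : exists2 rr : R, 0 <= rr & forall t, cabs t <= 1 -> 
   [/\ cabs X.[t] <= rr, cabs Y.[t] <= rr & cabs t ^+ 6 <= rr].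
  have pb (p : {poly C}) : exists2 m : R, 0 <= m & forall t, cabs t <= 1 -> cabs p.[t] <= m.
    exists (\sum_(j < size p) cabs p`_j); first by apply: sumr_ge0 => j _; exact: cabs_ge0.
    move=> t t_1; rewrite horner_coef; apply: le_trans (cabs_sum _ _ _) _.
    apply: ler_sum => j _; rewrite cabsM cabsX ler_piMr ?cabs_ge0 //.
    by rewrite exprn_ile1 ?cabs_ge0.
  have [a a0 Ha] := pb X; have [b b0 Hb] := pb Y.
  exists (a + b + 1); first by lra.
  move=> t t_1; have := Ha t t_1; have := Hb t t_1.
  have : cabs t ^+ 6 <= 1 by rewrite exprn_ile1 ?cabs_ge0.
  by move=> *; split; lra.
have rM : 0 <= rr + `|M| * 1 by rewrite addr_ge0 ?mulr_ge0.
(* [F] vanishes along the true branch, from which [Y] differs by [O(t ^ 6)]; a Lipschitz bound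
   passes this order to [F] along the jet. *)
have [K K0 HK] := lipschitz2P D (r := rr + `|M| * 1) rM.
apply: (poly_order (M := K * `|M|) (d := Num.min 1 (Num.min dl (rho - cabs t1)))).
  by rewrite !lt_min ltr01 dl0 subr_gt0.
move=> t; rewrite !lt_min => /and4P[t0 t_1 tdl trho].
have [Xr Yr _] := Hr t (ltW t_1).
have tw : t1 + t - t1 = t by rewrite addrC addKr.
have err : cabs (g (t1 + t) - Y.[t]) <= `|M| * cabs t ^+ 6.
  have := HM (t1 + t); rewrite tw t0 (ltW tdl) => /(_ isT).
  rewrite Yt /branch_rest [t + t1]addrC => h.
  rewrite opprD addrA; apply: le_trans h _.
  by rewrite ler_wpM2r ?exprn_ge0 ?cabs_ge0 ?ler_norm.
have z : ev2 D X.[t] (g (t1 + t)) = 0.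
  rewrite ev2_dehomog /X horner_exp hornerD hornerX hornerC [t + t1]addrC; apply: Fg.
  by have := cabsD t1 t; lra.
rewrite subst2_horner -[ev2 _ _ _]subr0 -z -/X.
have t6 : cabs t ^+ 6 <= 1 by rewrite exprn_ile1 ?cabs_ge0 // ltW.
have M6 : `|M| * cabs t ^+ 6 <= `|M| * 1 by rewrite ler_wpM2l.
have Mn : 0 <= `|M| by exact: normr_ge0.
have gr : cabs (g (t1 + t)) <= rr + `|M| * 1.
  by have := cabs_lowerB (g (t1 + t)) Y.[t]; lra.
apply: le_trans (HK _ _ _ _ _ _ _ gr) _; try lra.
by rewrite subrr cabs0 add0r -mulrA ler_wpM2l // cabsBC.
Qed.

End Jets.
End BranchBound.

Section ShiftCoefs.
Variable K : numClosedFieldType.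

Lemma coef_Xt (t : K) j : ('X + t%:P)`_j = t \/ ('X + t%:P)`_j = 1 \/ ('X + t%:P)`_j = 0.
Proof.
rewrite coefD coefX coefC; case: j => [|[|j]] /=; rewrite ?add0r ?addr0; by [left|right; left|right; right].
Qed.

Lemma coef_Xt2 (t : K) j : [\/ (('X + t%:P) ^+ 2)`_j = t ^+ 2, (('X + t%:P) ^+ 2)`_j = 2 * t,
  (('X + t%:P) ^+ 2)`_j = 1 | (('X + t%:P) ^+ 2)`_j = 0].
Proof.
have -> : ('X + t%:P) ^+ 2 = 'X^2 + (2 * t)%:P * 'X + (t ^+ 2)%:P :> {poly K}.
  by rewrite polyCM polyC_exp rmorph_nat; ring.
rewrite !coefD coefXn coefCM coefX coefC; case: j => [|[|[|j]]] /=;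
  rewrite ?mulr0 ?mulr1 ?add0r ?addr0.
- exact: Or41.
- exact: Or42.
- exact: Or43.
exact: Or44.
Qed.

End ShiftCoefs.

(** * Boundedness of [psi] on a quadratic branch *)

Section BranchPsi.
Variable R : realType.
Local Notation C := R[i].
Variables (d : nat) (F : mpoly 3 C) (A : 'M[C]_3) (e : C) (L : 'cV[C]_3).
Hypothesis hF : F \is ishomog1 d mdeg.
Hypothesis Au : A \in unitmx.
Let P := e%:P *: dehomog A F.

Lemma comp_X1 (t : C) n : (('X + t%:P) ^+ n : {poly C}) \Po (t *: 'X) = t ^+ n *: ('X + 1) ^+ n.
Proof.
rewrite !(rmorphXn, rmorphD) /= comp_polyX comp_polyC -exprZn; congr (_ ^+ n).
by rewrite scalerDr alg_polyC.
Qed.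

Lemma comp_poly_scale n (h : nat -> C) (t : C) :
  (\poly_(j < n) h j) \Po (t *: 'X) = \poly_(j < n) (h j * t ^+ j).
Proof.
rewrite !poly_def raddf_sum; apply: eq_bigr => j _ /=.
by rewrite comp_polyZ comp_Xn_poly exprZn scalerA.
Qed.

Section Rescaling.
Variables (q : nat) (c t : C) (h : nat -> C).
Hypothesis t0 : t != 0.
Let X : {poly C} := ('X + t%:P) ^+ q.
Let Y := c *: ('X + t%:P) ^+ (2 * q) + \poly_(j < 6) h j.
Let U : {poly C} := ('X + 1) ^+ q.
Let V := c *: ('X + 1) ^+ (2 * q) + \poly_(j < 6) (h j * t ^+ j / t ^+ (2 * q)).

(** In the parameter [t (1 + s)] the arc becomes [t ^ q U], [t ^ (2 q) V], where [V] is close to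
    [c (1 + s) ^ (2 q)]; the estimates on [U] and [V] are uniform as [t] tends to 0. *)
Lemma rescaled_jet : Y \Po (t *: 'X) = t ^+ (2 * q) *: V.
Proof.
have tq : t ^+ (2 * q) != 0 by rewrite expf_neq0.
rewrite comp_polyD comp_polyZ comp_X1 comp_poly_scale scalerDr !scalerA [c * _]mulrC.
congr (_ + _); apply/polyP => j; rewrite coefZ !coef_poly; case: ifP => _; last by rewrite mulr0.
by rewrite [RHS]mulrC divfK.
Qed.

Let t1 : (t *: 'X : {poly C})`_1 = t. Proof. by rewrite coefZ coefX mulr1. Qed.
Let tc0 : (t *: 'X : {poly C})`_0 = 0. Proof. by rewrite coefZ coefX mulr0. Qed.

Lemma w3_rescaled : t ^+ 3 * w3 1 X Y = (t ^+ q) ^+ 3 * w3 1 U V.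
Proof.
rewrite -t1 -w3_comp // comp_polyC t1 comp_X1 rescaled_jet w3_scale mulnC exprM.
by ring.
Qed.

Lemma w6_rescaled : t ^+ 15 * w6 1 X Y = (t ^+ q) ^+ 12 * w6 1 U V.
Proof.
rewrite -t1 -w6_comp // comp_polyC t1 comp_X1 rescaled_jet w6_scale mulnC exprM.
by ring.
Qed.

Lemma w3_rescaled_cabs : cabs t ^+ 3 * cabs (w3 1 X Y) = (cabs t ^+ q) ^+ 3 * cabs (w3 1 U V).
Proof. by rewrite -!cabsX -!cabsM w3_rescaled. Qed.

Lemma w6_rescaled_cabs : cabs t ^+ 15 * cabs (w6 1 X Y) = (cabs t ^+ q) ^+ 12 * cabs (w6 1 U V).
Proof. by rewrite -!cabsX -!cabsM w6_rescaled. Qed.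

(** The main term of [bin_wronskian] has modulus at least [|c|], and the hypothesis on [E] keeps the
    error below half of it. *)
Lemma w3_rescaled_ge (E : R) : (forall j, (j < 6)%N -> cabs (h j * t ^+ j / t ^+ (2 * q)) <= E) ->
  (0 < q)%N -> (q + 'C(q, 2))%:R * E <= cabs c / 2 -> cabs c / 2 <= cabs (w3 1 U V).
Proof.
move=> HE q0 hE; rewrite w3_1 /U /V !(coefD, coefZ) !coef_X1n !coef_poly /=.
have := HE 2%N isT; have := HE 1%N isT.
move: (_ / _) (_ / _) => e2 e1 e1E e2E.
have nR n : cabs (n%:R : C) = n%:R by rewrite -(rmorph_nat (@real_complex R)) cabsR normr_nat.
have -> : 'C(q, 1)%:R * (c * 'C(2 * q, 2)%:R + e2) - 'C(q, 2)%:R * (c * 'C(2 * q, 1)%:R + e1) =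
  c * q%:R ^+ 3 - ('C(q, 2)%:R * e1 - q%:R * e2) by rewrite bin_wronskian; ring.
apply: le_trans (cabs_lowerB _ _).
have h1 : cabs ('C(q, 2)%:R * e1 - q%:R * e2) <= (q + 'C(q, 2))%:R * E.
  apply: le_trans (cabsD _ _) _; rewrite cabsN !cabsM !nR natrD mulrDl addrC.
  by apply: lerD; rewrite ler_wpM2l.
have h2 : cabs c <= cabs (c * q%:R ^+ 3).
  by rewrite cabsM cabsX nR ler_peMr ?cabs_ge0 // exprn_ege1 // ler1n.
by lra.
Qed.

End Rescaling.
(** Cauchy's estimate on the disc of radius [|t| / 2]. There [|w| <= 2 |t|], whence [4 ^ q]; and
    [2 ^ j <= 32] for [j < 6] compensates the halved radius. *)
Lemma rescaled_coef_bound (f : C -> C) (hc : nat -> C) q (T eta r1 rho : R) t :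
  0 <= T -> 0 < eta -> 0 < cabs t -> cabs t < r1 / 4 -> cabs t < rho / 4 ->
  (forall r m : R, 0 < r -> 0 <= m -> r <= rho - cabs t - r ->
     (forall w, cabs (w - t) <= r -> cabs (f w) <= m) ->
     forall j, (j < 6)%N -> cabs (hc j) * r ^+ j <= T * m) ->
  (forall w, 0 < cabs w < r1 -> cabs (f w) <= eta * cabs w ^+ (2 * q)) ->
  forall j, (j < 6)%N -> cabs (hc j * t ^+ j / t ^+ (2 * q)) <= T * eta * 32 * 4 ^+ q.
Proof.
move=> T0 eta0 t0 tr1 trho Hhc rest j j6.
have h : cabs (hc j) * (cabs t / 2) ^+ j <= T * (eta * (4 ^+ q * cabs t ^+ (2 * q))).
  apply: (Hhc (cabs t / 2)) => //; first by rewrite divr_gt0.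
  - by rewrite !mulr_ge0 ?exprn_ge0 ?cabs_ge0 //; exact: ltW.
  - by lra.
  move=> w wt; have w1 := cabs_lowerB w t; have w2 := cabs_lowerB t w.
  rewrite cabsBC in w2.
  apply: le_trans (rest w _) _; first by apply/andP; split; lra.
  rewrite ler_wpM2l ?(ltW eta0) // [4 ^+ q](_ : _ = 2 ^+ (2 * q)); last first.
    by rewrite exprM expr2; congr (_ ^+ _); lra.
  rewrite -exprMn lerXn2r ?nnegrE ?mulr_ge0 ?cabs_ge0 //.
  by lra.
have t2 : 0 < cabs t ^+ (2 * q) by rewrite exprn_gt0.
rewrite !cabsM cabsV !cabsX ler_pdivrMr //.
have two : cabs t ^+ j = 2 ^+ j * (cabs t / 2) ^+ j.
  by rewrite -exprMn; congr (_ ^+ _); field.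
have two32 : 2 ^+ j <= 32 :> R by rewrite -natrX ler_nat (@leq_pexp2l 2 j 5).
rewrite two mulrCA; apply: (@le_trans _ _ (32 * (T * (eta * (4 ^+ q * cabs t ^+ (2 * q)))))).
  by apply: ler_pM => //; rewrite ?mulr_ge0 ?exprn_ge0 ?cabs_ge0 ?divr_ge0 ?cabs_ge0.
by rewrite le_eqVlt; apply/orP; left; apply/eqP; ring.
Qed.

(** Cauchy's estimate at a radius independent of [t]; the exponent 5 is the worst one since
    [s / 4 <= 1]. It bounds [w6] itself when [q = 1]. *)
Lemma fixed_coef_bound (f : C -> C) (hc : nat -> C) q (T eta s rho : R) t :
  0 <= T -> 0 < eta -> cabs t < s / 4 -> 0 < s -> s <= 1 -> s <= rho -> f 0 = 0 ->
  (forall r m : R, 0 < r -> 0 <= m -> r <= rho - cabs t - r ->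
     (forall w, cabs (w - t) <= r -> cabs (f w) <= m) ->
     forall j, (j < 6)%N -> cabs (hc j) * r ^+ j <= T * m) ->
  (forall w, 0 < cabs w < s -> cabs (f w) <= eta * cabs w ^+ (2 * q)) ->
  forall j, (j < 6)%N -> cabs (hc j) <= T * eta / (s / 4) ^+ 5.
Proof.
move=> T0 eta0 ts s0 s1 srho f0 Hhc rest j j6.
have s4 : 0 < s / 4 by rewrite divr_gt0.
have h : cabs (hc j) * (s / 4) ^+ j <= T * eta.
  apply: Hhc => //; first exact: ltW.
    by lra.
  move=> w wt; have w1 := cabs_lowerB w t.
  have ws : cabs w < s by lra.
  have [->|w0] := eqVneq w 0; first by rewrite f0 cabs0 ltW.
  apply: le_trans (rest w _) _; first by rewrite cabs_gt0 w0.
  rewrite ler_piMr ?(ltW eta0) // exprn_ile1 ?cabs_ge0 //.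
  exact: ltW (lt_le_trans ws s1).
rewrite ler_pdivlMr ?exprn_gt0 //; apply: le_trans h; rewrite ler_wpM2l ?cabs_ge0 //.
by rewrite ler_wiXn2l ?(ltW s4) //; lra.
Qed.

Lemma growth_bound (g c t : C) q (eta : R) : 0 < eta -> cabs t <= 1 ->
  cabs (g - c * t ^+ (2 * q)) <= eta * cabs t ^+ (2 * q) ->
  cabs g <= (cabs c + eta) * cabs t ^+ q.
Proof.
move=> eta0 t1 h; have := cabs_lowerB g (c * t ^+ (2 * q)); rewrite cabsM cabsX.
have : cabs t ^+ (2 * q) <= cabs t ^+ q.
  by rewrite ler_wiXn2l ?cabs_ge0 // mul2n -addnn leq_addr.
move: (cabs t ^+ _) (cabs t ^+ q) h => b a h ba.
have : (cabs c + eta) * b <= (cabs c + eta) * a.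
  by rewrite ler_wpM2l // addr_ge0 ?cabs_ge0 //; exact: ltW.
by lra.
Qed.

Lemma linval_branch (B : 'M[C]_3) (g t : C) q (D : R) : cabs g <= D * cabs t ^+ q ->
  cabs (linval L (aff B (t ^+ q) g)) <= cabs (linval L (row 0 B)) +
    (cabs (linval L (row 1 B)) + D * cabs (linval L (row 2%:R B))) * cabs t ^+ q.
Proof.
rewrite linval_aff -cabsX; move: (linval _ _) (linval _ _) (linval _ _) (t ^+ q) => l0 l1 l2 u h.
apply: le_trans (cabsD _ _) _; apply: le_trans (lerD (cabsD _ _) (lexx _)) _.
rewrite !cabsM -addrA lerD2l mulrDl [cabs u * _]mulrC lerD2l mulrAC.
by rewrite ler_wpM2r ?cabs_ge0.
Qed.

(** With [s = |t|] and [a = |t| ^ q], the powers of [s] cancel between [w ^ 5] and [v], and those of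
    [a] between [a ^ 15] on one side and [a ^ 12] times the cube of [l <= C1 a] on the other. *)
Lemma final_rescaled (p w v l c1 a s K C1 gam W V : R) :
  0 < a -> 0 < s -> 0 < gam -> 0 <= c1 -> 0 <= v -> 0 <= l -> 0 <= p -> 0 <= V ->
  p * w ^+ 5 = c1 * v * l ^+ 3 -> s ^+ 3 * w = a ^+ 3 * W -> s ^+ 15 * v = a ^+ 12 * V ->
  gam <= W -> V <= K -> l <= C1 * a -> p <= c1 * K * C1 ^+ 3 / gam ^+ 5.
Proof.
move=> a0 s0 g0 c10 v0 l0 p0 V0 E Ew Ev gW VK lC.
have C10 : 0 <= C1 by rewrite -(pmulr_lge0 _ a0); exact: le_trans lC.
rewrite ler_pdivlMr ?exprn_gt0 // -(ler_pM2r (exprn_gt0 15 a0)).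
apply: (@le_trans _ _ (p * W ^+ 5 * a ^+ 15)).
  rewrite ler_pM2r ?exprn_gt0 // ler_wpM2l // lerXn2r ?nnegrE ?(ltW g0) //.
  exact: le_trans (ltW g0) gW.
have -> : p * W ^+ 5 * a ^+ 15 = c1 * (a ^+ 12 * V) * l ^+ 3.
  rewrite -Ev; have -> : p * W ^+ 5 * a ^+ 15 = p * (a ^+ 3 * W) ^+ 5 by ring.
  rewrite -Ew; have -> : p * (s ^+ 3 * w) ^+ 5 = s ^+ 15 * (p * w ^+ 5) by ring.
  by rewrite E; ring.
have -> : c1 * K * C1 ^+ 3 * a ^+ 15 = c1 * (a ^+ 12 * K) * (C1 * a) ^+ 3 by ring.
apply: ler_pM; rewrite ?mulr_ge0 ?exprn_ge0 ?(ltW a0) //.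
  by rewrite ler_wpM2l // ler_wpM2l ?exprn_ge0 ?(ltW a0).
by rewrite lerXn2r ?nnegrE ?mulr_ge0 ?(ltW a0).
Qed.

Lemma final_fixed (p w v l c1 K l1 gam : R) :
  0 < gam -> 0 <= c1 -> 0 <= v -> 0 <= l -> 0 <= p ->
  p * w ^+ 5 = c1 * v * l ^+ 3 -> gam <= w -> v <= K -> l <= l1 ->
  p <= c1 * K * l1 ^+ 3 / gam ^+ 5.
Proof.
move=> g0 c10 v0 l0 p0 E gw vK ll; rewrite ler_pdivlMr ?exprn_gt0 //.
apply: (@le_trans _ _ (p * w ^+ 5)).
  rewrite ler_wpM2l // lerXn2r ?nnegrE ?(ltW g0) //; exact: le_trans (ltW g0) gw.
rewrite E; apply: ler_pM; rewrite ?mulr_ge0 ?exprn_ge0 //; first by rewrite ler_wpM2l.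
by rewrite lerXn2r ?nnegrE // (le_trans l0).
Qed.

Lemma cabs_equation (p w c v l : C) : p * w ^+ 5 = c * v * l ^+ 3 ->
  cabs p * cabs w ^+ 5 = cabs c * cabs v * cabs l ^+ 3.
Proof. by move=> E; rewrite -!cabsX -!cabsM E. Qed.

Lemma eta_choice (c T N q4 : R) : 0 <= c -> 0 <= T -> 1 <= N -> 0 < q4 ->
  N * (T * (c / (2 * N * 32 * (T + 1) * q4)) * 32 * q4) <= c / 2.
Proof.
move=> c0 T0 N1 q0.
have -> : N * (T * (c / (2 * N * 32 * (T + 1) * q4)) * 32 * q4) = c / 2 * (T / (T + 1)).
  by field; rewrite !gt_eqF //; lra.
by rewrite ler_piMr ?divr_ge0 // ler_pdivrMr; lra.
Qed.

Lemma coef_shift_bound (c t h : C) j : cabs t <= 1 ->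
  cabs (('X + t%:P) ^+ 1 : {poly C})`_j <= 1 /\
  cabs ((c *: ('X + t%:P) ^+ 2 : {poly C})`_j + h) <= 3 * cabs c + cabs h.
Proof.
move=> t1; split.
  by rewrite expr1; case: (coef_Xt t j) => [|[]] ->; rewrite ?cabs1 ?cabs0 ?ler01.
apply: le_trans (cabsD _ _) _; rewrite lerD2r coefZ cabsM mulrC ler_wpM2r ?cabs_ge0 //.
have nR n : cabs (n%:R : C) = n%:R by rewrite -(rmorph_nat (@real_complex R)) cabsR normr_nat.
have t2 : cabs t ^+ 2 <= 1 by rewrite exprn_ile1 ?cabs_ge0.
by case: (coef_Xt2 t j) => ->; rewrite ?cabs1 ?cabs0 ?cabsX ?cabsM ?nR; lra.
Qed.

(** If the line passes through the centre, the linear form is [O(t ^ q)] and its cube absorbs the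
    pole of order [3 q]. If [q = 1] there is no pole: [w3] is bounded below, and [w6] above by
    estimates at a fixed radius. *)
Lemma psi_bounded_on_branch (B : 'M[C]_3) (g : C -> C) (q : nat) (c : C) (rho : R) :
  B \in unitmx -> (0 < q)%N -> c != 0 -> 0 < rho ->
  (forall t, cabs t < rho -> cdiff g t) -> g 0 = 0 ->
  (forall t, cabs t < rho -> meval (aff B (t ^+ q) (g t) 0) F = 0) ->
  (forall n : R, 0 < n -> exists2 r : R, 0 < r & forall t, 0 < cabs t < r ->
     cabs (g t - c * t ^+ (2 * q)) <= n * cabs t ^+ (2 * q)) ->
  q = 1%N \/ linval L (row 0 B) = 0 ->
  exists2 r : R, 0 < r & exists m : R, forall t x y k, 0 < cabs t < r -> k != 0 ->
    regular F A e x y -> aff B (t ^+ q) (g t) = k *: aff A x y ->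
    cabs (psi F A e L x y) <= m.
Proof.
move=> Bu q0 c0 rho0 dg g0 Fg asym hq.
have [T T0 jet] := branch_jet c dg Fg.
have [c1 Hc1] := psi_pullback e L hF Au Bu.
have [N NE] : exists N : R, N = (q + 'C(q, 2))%:R by exists (q + 'C(q, 2))%:R.
have N1 : 1 <= N by rewrite NE ler1n; lia.
have q4 : 0 < (4 : R) ^+ q by rewrite exprn_gt0.
(* Small enough for [w3_rescaled_ge]: [N] is the weight of the errors there, and [32 * 4 ^ q] comes
   from [rescaled_coef_bound]. *)
have [eta etaE] : exists eta, eta = cabs c / (2 * N * 32 * (T + 1) * 4 ^+ q) by eexists.
have eta0 : 0 < eta.
  rewrite etaE divr_gt0 ?cabs_gt0 //.
  by do ![apply: mulr_gt0 => //]; lra.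
have [r1 r10 Hr1] := asym eta eta0.
have [s0 [s00 s0r s0rho s01]] : exists s0 : R, [/\ 0 < s0, s0 <= r1, s0 <= rho & s0 <= 1].
  exists (Num.min (Num.min r1 rho) 1).
  by rewrite !lt_min r10 rho0 ltr01 !ge_min !lexx !orbT.
have rest0 : branch_rest g q c 0 = 0.
  by rewrite /branch_rest g0 expr0n muln_eq0 /= (gtn_eqF q0) mulr0 subrr.
have b1 : exists2 m : R, 0 <= m & forall j, (j < 6)%N ->
    cabs ('C(q, j)%:R : C) <= m /\ cabs (c * 'C(2 * q, j)%:R) + cabs c / 2 <= m.
  have c2 : 0 <= cabs c / 2 by rewrite divr_ge0 ?cabs_ge0.
  have p1 : 0 <= \sum_(j < 6) cabs ('C(q, j)%:R : C) by apply: sumr_ge0 => *; exact: cabs_ge0.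
  have p2 : 0 <= \sum_(j < 6) cabs (c * 'C(2 * q, j)%:R) by apply: sumr_ge0 => *; exact: cabs_ge0.
  exists (\sum_(j < 6) cabs ('C(q, j)%:R : C) +
    (\sum_(j < 6) cabs (c * 'C(2 * q, j)%:R) + cabs c / 2)); first by rewrite !addr_ge0.
  move=> j j6; split.
    apply: ler_wpDr; first exact: addr_ge0.
    by rewrite (bigD1 (Ordinal j6)) //= lerDl sumr_ge0 // => *; exact: cabs_ge0.
  apply: ler_wpDl => //; rewrite lerD2r.
  by rewrite (bigD1 (Ordinal j6)) //= lerDl sumr_ge0 // => *; exact: cabs_ge0.
have [m1 m10 Hm1] := b1; have [K K0 HK] := w6_bound m10.
have [m2 [m20 m21 m22]] : exists m2 : R,
    [/\ 0 <= m2, 1 <= m2 & 3 * cabs c + T * eta / (s0 / 4) ^+ 5 <= m2].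
  exists (1 + (3 * cabs c + T * eta / (s0 / 4) ^+ 5)).
  have h : 0 <= 3 * cabs c + T * eta / (s0 / 4) ^+ 5.
    rewrite addr_ge0 ?mulr_ge0 ?cabs_ge0 ?(ltW eta0) // invr_ge0 exprn_ge0 //.
    by rewrite divr_ge0 ?(ltW s00).
  by rewrite addr_ge0 // lerDl lerDr h ler01.
have [K' K'0 HK'] := w6_bound m20.
have [C1 C1E] : exists C1, C1 =
  cabs (linval L (row 1 B)) + (cabs c + eta) * cabs (linval L (row 2%:R B)) by eexists.
have C10 : 0 <= C1 by rewrite C1E addr_ge0 ?mulr_ge0 ?addr_ge0 ?cabs_ge0 ?(ltW eta0).
have [gam gamE] : exists gam, gam = cabs c / 2 by eexists.
have gam0 : 0 < gam by rewrite gamE divr_gt0 ?cabs_gt0.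
have g5 : 0 <= gam ^+ 5 by rewrite exprn_ge0 // ltW.
have [l0 l0E] : exists l0, l0 = cabs (linval L (row 0 B)) by eexists.
have l00' : 0 <= l0 by rewrite l0E cabs_ge0.
exists (s0 / 4); first by rewrite divr_gt0.
exists (cabs c1 * K * C1 ^+ 3 / gam ^+ 5 + cabs c1 * K' * (l0 + C1) ^+ 3 / gam ^+ 5).
have n1 : 0 <= cabs c1 * K * C1 ^+ 3 / gam ^+ 5.
  by rewrite divr_ge0 // mulr_ge0 ?exprn_ge0 // mulr_ge0 ?cabs_ge0.
have n2 : 0 <= cabs c1 * K' * (l0 + C1) ^+ 3 / gam ^+ 5.
  by rewrite divr_ge0 // mulr_ge0 ?exprn_ge0 ?addr_ge0 // mulr_ge0 ?cabs_ge0.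
move=> t x y k /andP[t0 ts] k0 [P0 Py Ph] E.
have tnz : t != 0 by rewrite -cabs_gt0.
have quarter (s : R) : 0 < s -> s / 4 <= s.
  by move=> s_0; rewrite ler_piMr ?(ltW s_0) // invf_le1 ?ler1n.
have trho' : 0 < cabs t < rho by rewrite t0 (lt_le_trans ts) // (le_trans (quarter _ s00)).
have t_1 : cabs t <= 1 by apply: le_trans (ltW ts) _; exact: le_trans (quarter _ s00) s01.
have [hc [Hhc Y0 J]] := jet t trho'.
have rest' w : 0 < cabs w < s0 -> cabs (branch_rest g q c w) <= eta * cabs w ^+ (2 * q).
  by move=> /andP[w0 ws]; apply: Hr1; rewrite w0 (lt_le_trans ws).
have t14 : cabs t < r1 / 4 by apply: lt_le_trans ts _; rewrite ler_pM2r ?invr_gt0.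
have trho : cabs t < rho / 4 by apply: lt_le_trans ts _; rewrite ler_pM2r ?invr_gt0.
have eps := rescaled_coef_bound T0 eta0 t0 t14 trho Hhc Hr1.
have Eb : N * (T * eta * 32 * 4 ^+ q) <= cabs c / 2.
  by rewrite etaE; apply: eta_choice => //; exact: cabs_ge0.
have E1 : T * eta * 32 * 4 ^+ q <= cabs c / 2.
  apply: le_trans Eb; rewrite ler_peMl // mulr_ge0 ?(ltW q4) // mulr_ge0 // mulr_ge0 //.
  exact: ltW.
rewrite NE in Eb; have w3ge := w3_rescaled_ge eps q0 Eb.
have W3 := w3_rescaled_cabs q c hc tnz; have W6 := w6_rescaled_cabs q c hc tnz.
have W6le : cabs (w6 1 (('X + 1) ^+ q) (c *: ('X + 1) ^+ (2 * q) +
    \poly_(j < 6) (hc j * t ^+ j / t ^+ (2 * q)))) <= K.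
  apply: HK => j j6; have [h1 h2] := Hm1 j j6; first by rewrite coef_X1n.
  rewrite coefD coefZ coef_X1n coef_poly j6; apply: le_trans (cabsD _ _) _.
  by apply: le_trans h2; rewrite lerD2l (le_trans (eps j j6)).
have t_r1 : 0 < cabs t < r1 by rewrite t0; apply: lt_le_trans t14 (quarter r1 r10).
have gt := growth_bound eta0 t_1 (Hr1 t t_r1).
have lval := linval_branch B gt; rewrite -C1E -l0E in lval.
rewrite -gamE in w3ge.
have fixed j : q = 1%N -> (j < 6)%N -> cabs ((('X + t%:P) ^+ q : {poly C})`_j) <= m2 /\
    cabs ((c *: ('X + t%:P) ^+ (2 * q) + \poly_(j < 6) hc j)`_j) <= m2.
  move=> q1 j6; have h := fixed_coef_bound T0 eta0 ts s00 s01 s0rho rest0 Hhc rest' j6.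
  have [h1 h2] := coef_shift_bound c (hc j) j t_1.
  rewrite coefD coef_poly j6 q1 muln1; split; first exact: le_trans h1 m21.
  by apply: le_trans h2 _; apply: le_trans m22; rewrite lerD2l.
have row0 : (\row_(i < 3) [:: (1 : {poly C})`_0; (('X + t%:P) ^+ q)`_0;
    (c *: ('X + t%:P) ^+ (2 * q) + \poly_(j < 6) hc j)`_0]`_i) *m B = k *: aff A x y.
  by rewrite -E Y0 /aff coefC -horner_coef0 horner_exp hornerD hornerX hornerC add0r.
have {row0} := Hc1 1 _ _ x y k P0 Py Ph k0 row0 J.
have {fixed}fixed : q = 1%N -> cabs (w6 1 (('X + t%:P) ^+ q)
    (c *: ('X + t%:P) ^+ (2 * q) + \poly_(j < 6) hc j)) <= K'.
  by move=> q1; apply: HK' => j j6; case: (fixed j q1 j6).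
rewrite -E => /cabs_equation main.
have a0 : 0 < cabs t ^+ q by rewrite exprn_gt0.
case: hq => [q1|l00]; last first.
  apply: (@le_trans _ _ (cabs c1 * K * C1 ^+ 3 / gam ^+ 5)); last by rewrite lerDl.
  rewrite l0E l00 cabs0 add0r in lval.
  by apply: (final_rescaled a0 t0 gam0 _ _ _ _ _ main W3 W6 w3ge W6le lval); exact: cabs_ge0.
apply: (@le_trans _ _ (cabs c1 * K' * (l0 + C1) ^+ 3 / gam ^+ 5)); last by rewrite lerDr.
have lv : cabs (linval L (aff B (t ^+ q) (g t))) <= l0 + C1.
  apply: le_trans lval _; rewrite lerD2l; apply: ler_piMr; first exact: C10.
  exact: exprn_ile1 (cabs_ge0 _) t_1.
apply: (final_fixed gam0 (cabs_ge0 _) (cabs_ge0 _) (cabs_ge0 _) (cabs_ge0 _) main _ (fixed q1) lv).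
(* For [q = 1] the two rescaling factors of [w3] coincide, so the lower bound holds for [w3]
   itself. *)
have tq : cabs t ^+ q = cabs t by rewrite q1 expr1.
rewrite tq in W3; have t3 : cabs t ^+ 3 != 0 := expf_neq0 3 (lt0r_neq0 t0).
by rewrite (mulfI t3 W3).
Qed.

End BranchPsi.

(** * Boundedness of [psi] near singular points *)

Section SingularPoints.
Variable R : realType.
Local Notation C := R[i].
Variables (d : nat) (F : mpoly 3 C) (A : 'M[C]_3) (e : C) (L : 'cV[C]_3).
Hypothesis hF : F \is ishomog1 d mdeg.
Hypothesis Au : A \in unitmx.
Let P := e%:P *: dehomog A F.
Implicit Types (M N : affine_chart R) (O : CP2 R) (b : set (CP2 R)).

Lemma irreducible_neq0 (G : mpoly 3 C) : mpoly_irreducible G -> G != 0.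
Proof.
move=> [_ irr]; apply/eqP => G0.
by case: (irr 0 0); rewrite ?mulr0 ?unitr0.
Qed.

Lemma vlineZ (k : C) (v : 'rV[C]_3) : k != 0 -> <[k *: v]>%VS = <[v]>%VS.
Proof.
move=> k0; apply/eqP; rewrite eqEsubv -!memvE memvZ ?memv_line //=.
by rewrite -[X in X \in _](scale1r v) -(mulVf k0) -scalerA memvZ ?memv_line.
Qed.

Lemma CP2_inj O O' : sval O = sval O' -> O = O'.
Proof. by move=> E; apply: val_inj. Qed.

Lemma chart_eq M N (X Y X' Y' k : C) : k != 0 ->
  aff (frame M) X Y = k *: aff (frame N) X' Y' -> chart M (X, Y) = chart N (X', Y').
Proof. by move=> k0 E; apply: CP2_inj; rewrite /= !chart_vecE E vlineZ. Qed.

Lemma centeredE M O : centered M O <-> sval O = <[row 0%R (frame M)]>%VS.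
Proof.
have E : sval (chart M 0) = <[row 0%R (frame M)]>%VS by rewrite /= chart_vecE aff00.
by split=> [<-//|OE]; apply: CP2_inj; rewrite OE.
Qed.

Lemma centered_transition M N O (r : R) : centered M O -> centered N O -> 0 < r ->
  exists2 r' : R, 0 < r' & forall X Y, cabs X < r' -> cabs Y < r' -> exists k X' Y',
    [/\ k != 0, cabs X' < r, cabs Y' < r & aff (frame M) X Y = k *: aff (frame N) X' Y'].
Proof.
move=> /centeredE OM /centeredE ON r0.
have : row 0 (frame M) \in <[row 0%R (frame N)]>%VS by rewrite -ON OM memv_line.
move=> /vlineP[l lE]; apply: (transition (frame_unit N) (frame_unit M) _ lE r0).
apply: contraTneq (frame_unit M) => l0; rewrite unitmxE unitfE (expand_det_row _ 0) big1 ?eqxx //.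
by move=> j _; have /rowP/(_ j) := lE; rewrite l0 scale0r !mxE => ->; rewrite mul0r.
Qed.

Lemma puiseux_asymptotics (g : R[i]^o -> R[i]^o) (c : R[i]^o) p :
  (fun t : R[i]^o => g t / t ^+ p) @ (0 : R[i]^o)^' --> c ->
  forall n : R, 0 < n -> exists2 r : R, 0 < r & forall t : C, 0 < cabs t < r ->
    cabs (g t - c * t ^+ p) <= n * cabs t ^+ p.
Proof.
move=> lim n n0; have nc : (0 : C) < n%:C by rewrite ltcR.
have /cvgr_dist_lt/(_ _ nc) := lim.
rewrite near_withinE => /near_CP[r r0 H]; exists r => // t /andP[t0 tr].
have tnz : t != 0 by rewrite -cabs_gt0.
have := H t ltac:(by rewrite subr0) tnz; rewrite cabsE ltcR => h.
have -> : g t - c * t ^+ p = - ((c - g t / t ^+ p) * t ^+ p).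
  by rewrite mulrBl divfK ?expf_neq0 // opprB.
by rewrite cabsN cabsM cabsX ler_wpM2r ?exprn_ge0 ?cabs_ge0 // ltW.
Qed.

(** Three charts centred at [O] are compared: [M0], where [b] is a component of the germ of the
    curve, [N], where it is parametrized, and [M], where the bound is wanted. *)
Lemma psi_bounded_one_branch gamma O b M : gamma = zero_locus F -> singular_point F O ->
  local_branch gamma O b -> quadratic_branch b O ->
  (singular_branch b O -> linval L (row 0 (frame M)) = 0) -> centered M O ->
  exists2 r : R, 0 < r & exists m : R, forall X Y x y k, cabs X < r -> cabs Y < r ->
    b (chart M (X, Y)) -> k != 0 -> regular F A e x y ->
    aff (frame M) X Y = k *: aff A x y -> cabs (psi F A e L x y) <= m.
Proof.
move=> gE Osing [M0 [cM0 [_ bg _]]] [q [p [degs pq]]] Lsing cM.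
have [/andP[q0 qp] [N [[cN _] [c [g [U [c0 U0 dU lim [inj geq]]]]]]]] := degs.
have pE : p = (2 * q)%N.
  have qQ : (q%:R : rat) != 0 by rewrite pnatr_eq0 -lt0n.
  by apply/eqP; rewrite -(eqr_nat rat) natrM pq divfK.
have [rho1 rho10 HU] := (near_CP _ _).1 U0.
have asym := puiseux_asymptotics lim; rewrite pE in asym.
have dg t : cabs t < rho1 -> cdiff g t.
  by move=> t1; apply/cdiffP/dU/HU; rewrite subr0.
(* The limit condition ignores the value at 0; it follows from continuity, since [g] is
   [O(t ^ (2 q))]. *)
have g0 : g 0 = 0.
  have [r r0 Hr] := asym 1 ltr01.
  apply: (vanish_of_small (M := cabs c + 1) (d := Num.min r 1) (N := (2 * q).-1)).
  - by rewrite lt_min r0 ltr01.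
  - by apply/cdiff_cont/dg; rewrite cabs0.
  move=> t; rewrite subr0 lt_min => /and3P[t0 tr t1].
  rewrite prednK ?muln_gt0 ?q0 //; have := Hr t; rewrite t0 tr => /(_ isT).
  have := cabs_lowerB (g t) (c * t ^+ (2 * q)); rewrite cabsM cabsX.
  by rewrite mulrDl; lra.
have [e1 e10 He1] := (near_CaffP _).1 geq.
have [e2 e20 He2] := (near_CaffP _).1 bg.
have [e3 e30 He3] := centered_transition cN cM0 e20.
have m13 : 0 < Num.min 1 (Num.min e1 e3) by rewrite !lt_min ltr01 e10.
have [rho2 rho20 Hg] := cdiff_cont (dg 0 ltac:(by rewrite cabs0)) m13.
rewrite g0 in Hg.
pose rho := Num.min (Num.min rho1 rho2) (Num.min 1 (Num.min e1 e3)).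
have rho0 : 0 < rho by rewrite !lt_min rho10 rho20 ltr01 e10.
have tq (t : C) : cabs t < rho -> cabs (t ^+ q) <= cabs t.
  rewrite !lt_min => /and3P[_ t1 _]; rewrite cabsX -[X in _ <= X]expr1.
  by rewrite ler_wiXn2l ?cabs_ge0 // ltW.
have Fg t : cabs t < rho -> meval (aff (frame N) (t ^+ q) (g t) 0) F = 0.
  move=> tr; have tqt := tq t tr; move: tr; rewrite !lt_min => /and3P[/andP[tr1 tr2] t1 /andP[te1 te3]].
  have := Hg t; rewrite !subr0 => /(_ tr2); rewrite !lt_min => /and3P[_ ge1 ge3].
  have bt : b (chart N (t ^+ q, g t)).
    apply/(He1 (t ^+ q) (g t) (le_lt_trans tqt te1) ge1); exists t => //.
    by apply: HU; rewrite subr0.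
  have [k [X' [Y' [k0 X'e Y'e E]]]] := He3 _ _ (le_lt_trans tqt te3) ge3.
  have : gamma (chart M0 (X', Y')).
    by apply: He2 => //; rewrite /preimage /= -(chart_eq k0 E).
  rewrite gE (zero_locus_line hF (v := aff (frame M0) X' Y')) // => z.
  by rewrite E (meval_homog _ _ hF) z mulr0.
have hq : q = 1%N \/ linval L (row 0 (frame N)) = 0.
  have [->|q1] := eqVneq q 1%N; [by left|right].
  have Ls : linval L (row 0 (frame M)) = 0.
    by apply: Lsing; exists q, p; split=> //; apply/eqP.
  have : row 0 (frame N) \in <[row 0%R (frame M)]>%VS.
    by rewrite -((centeredE M O).1 cM) ((centeredE N O).1 cN) memv_line.
  by move=> /vlineP[l ->]; rewrite linvalZ Ls mulr0.
have dg' t : cabs t < rho -> cdiff g t.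
  by rewrite !lt_min => /andP[/andP[t1 _] _]; exact: dg.
have [r r0 [m Hm]] := psi_bounded_on_branch e hF Au (frame_unit N) q0 c0 rho0 dg' g0 Fg asym hq.
have rq0 : 0 < Num.min (r ^+ q) e1 by rewrite lt_min e10 exprn_gt0.
have [r' r'0 Hr'] := centered_transition cM cN rq0.
exists r' => //; exists m => X Y x y k Xr Yr bXY k0 reg E.
have [k' [X' [Y' [k'0 + + E']]]] := Hr' X Y Xr Yr; rewrite !lt_min => /andP[X'r X'e] /andP[Y'r Y'e].
have [t Ut [tX tY]] : ((fun t : R[i]^o => (t ^+ q, g t) : Caff R) @` U) ((X', Y') : Caff R).
  by apply/(He1 X' Y' X'e Y'e); rewrite /preimage /= -(chart_eq k'0 E').
have E2 : aff (frame N) (t ^+ q) (g t) = (k'^-1 * k) *: aff A x y.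
  by rewrite tX tY -scalerA -E E' scalerA mulVf // scale1r.
have kk : k'^-1 * k != 0 by rewrite mulf_neq0 ?invr_eq0.
have tr : cabs t < r.
  by rewrite ltNge; apply/negP => rt; move: X'r; rewrite -tX cabsX ltNge lerXn2r ?nnegrE ?cabs_ge0 ?(ltW r0).
(* The parameter 0 gives the singular point [O], which is not [regular]. *)
have t0 : 0 < cabs t.
  rewrite cabs_gt0; apply/eqP => t0; case: reg => P0 Py _.
  have dPy : ev2 (deriv (dehomog A F)) x y != 0.
    by move: Py; rewrite /P derivZ ev2Z hornerC mulf_eq0 negb_or => /andP[].
  apply: (derivE_not_singular (O := O) _ dPy Osing).
  rewrite ((centeredE N O).1 cN) -[RHS](vlineZ _ kk) -E2 t0 g0 expr0n (gtn_eqF q0) /=.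
  by rewrite aff00.
by apply: (Hm t x y _ _ kk reg E2); rewrite t0.
Qed.

(** In a frame with origin at [O] and last vector off the curve, finitely many branches cover a
    neighborhood, and the bounds on them have a maximum. *)
Lemma psi_bounded_singular gamma O u : mpoly_irreducible F -> gamma = zero_locus F ->
  singular_point F O -> u != 0 -> sval O = <[u]>%VS ->
  (forall b, local_branch gamma O b -> quadratic_branch b O) ->
  (forall b, local_branch gamma O b -> singular_branch b O -> linval L u = 0) ->
  psi_bounded_near F A e L u.
Proof.
move=> Firr gE Osing u0 Ou quad Ls.
have [v Fv] : exists v : 'rV[C]_3, meval (v 0) F != 0.
  by apply: meval_neq0; exact: irreducible_neq0.
have Fu : meval (u 0) F = 0 by apply/(zero_locus_line hF Ou); case: Osing.
have [k|B [Bu B0 B2]] := complete_frame (v := v) u0.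
  by apply: contraNneq Fv => ->; rewrite (meval_homog _ _ hF) Fu mulr0.
pose M := AffineChart Bu; have cM : centered M O by apply/centeredE; rewrite B0.
have FM : meval (row ord_max (frame M) 0) F != 0 by rewrite /= B2.
have [n [b [br [e0 e00 cover]]]] := local_branches_cover hF Firr gE FM cM.
have [r r0 [m Hm]] : exists2 r : R, 0 < r & exists m : R, forall j, (j < n)%N ->
    forall X Y x y k, cabs X < r -> cabs Y < r -> b j (chart M (X, Y)) -> k != 0 ->
    regular F A e x y -> aff (frame M) X Y = k *: aff A x y -> cabs (psi F A e L x y) <= m.
  elim: {cover} n br => [|n IH] br; first by exists 1 => //; exists 0.
  have [r r0 [m Hm]] := IH (fun j jn => br j (leqW jn)).
  have brn := br n (ltnSn n).
  have [|r' r'0 [m' Hm']] := psi_bounded_one_branch gE Osing brn (quad _ brn) _ cM.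
    by move=> /(Ls _ brn); rewrite -B0.
  exists (Num.min r r'); first by rewrite lt_min r0.
  exists (Num.max m m') => j; rewrite ltnS leq_eqVlt => /orP[/eqP ->|jn] X Y x y k.
    rewrite !lt_min => /andP[_ Xr] /andP[_ Yr] bX k0 reg E.
    by rewrite le_max (Hm' X Y x y k) // orbT.
  rewrite !lt_min => /andP[Xr _] /andP[Yr _] bX k0 reg E.
  by rewrite le_max (Hm j jn X Y x y k).
rewrite -B0; apply: (@psi_bounded_frame _ _ _ _ _ _ (Num.min r e0) m) => //.
  by rewrite lt_min r0.
move=> X Y x y k; rewrite !lt_min => /andP[Xr Xe] /andP[Yr Ye] k0 reg E.
have [|j jn bj] := cover X Y Xe Ye; last exact: Hm jn X Y x y k Xr Yr bj k0 reg E.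
case: (reg) => P0 Py _; rewrite /= E (meval_homog _ _ hF).
have e_0 : e != 0.
  by apply: contraNneq Py => e_0; rewrite /P e_0 scale0r deriv0 ev2_0.
move: P0; rewrite /P ev2Z hornerC ev2_dehomog => /eqP.
by rewrite mulf_eq0 (negPf e_0) => /eqP ->; rewrite mulr0.
Qed.

End SingularPoints.

(** * The global argument *)

Section Fibers.
Variable R : realType.
Local Notation C := R[i].
Variables (d : nat) (F : mpoly 3 C) (A : 'M[C]_3) (L : 'cV[C]_3).
Hypothesis hF : F \is ishomog1 d mdeg.
Hypothesis Au : A \in unitmx.
Hypothesis Fe : meval (row ord_max A 0) F != 0.
Let e := (meval (row ord_max A 0) F)^-1.
Hypothesis bnd : forall u : 'rV[C]_3, u != 0 -> meval (u 0) F = 0 -> psi_bounded_near F A e L u.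

Lemma aff_near_at (B : 'M[C]_3) (x0 y0 : C) (r : R) : 0 < r -> exists2 s : R, 0 < s &
  forall x y, cabs (x - x0) < s -> cabs (y - y0) < s ->
    forall j, cabs (aff B x y 0 j - aff B x0 y0 0 j) < r.
Proof.
pose B' : 'M[C]_3 := \matrix_(i, j) if i == 0 then aff B x0 y0 0 j else B i j.
move=> /(aff_near B')[s s0 Hs]; exists s => // x y xs ys j.
have := Hs _ _ xs ys j; congr (cabs _ < _); rewrite !affE !mxE /= sum3 !mxE /=.
by ring.
Qed.

(** A fiber is finite and, by continuity of the roots, nearby fibers stay close to it; finitely many
    local bounds suffice. The frame [B] is free so that the fiber at infinity is covered as well. *)
Lemma psi_bounded_fiber (B : 'M[C]_3) (x0 : C) :
  B \in unitmx -> meval (row ord_max B 0) F != 0 ->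
  exists2 r : R, 0 < r & exists2 m : R, 0 <= m & forall xi eta k x y, cabs (xi - x0) < r ->
    k != 0 -> regular F A e x y -> k *: aff A x y = aff B xi eta ->
    cabs (psi F A e L x y) <= m.
Proof.
move=> Bu FB; set P := curve_poly B F; have [sz Pm] := curve_poly_degree hF FB.
have loc (s : seq C) : (forall y, y \in s -> meval (aff B x0 y 0) F = 0) ->
    exists2 r : R, 0 < r & exists2 m : R, 0 <= m & forall y0, y0 \in s ->
    forall xi eta k x y, cabs (xi - x0) < r -> cabs (eta - y0) < r ->
    k != 0 -> regular F A e x y -> k *: aff A x y = aff B xi eta ->
    cabs (psi F A e L x y) <= m.
  elim: s => [|y1 s IH] Hs; first by exists 1 => //; exists 0.
  have [|r r0 [m m0 Hm]] := IH; first by move=> y ys; apply: Hs; rewrite inE ys orbT.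
  have [r1 r10 [m1 Hm1]] := bnd (aff_neq0 x0 y1 Bu) (Hs _ (mem_head _ _)).
  have [r2 r20 Hr2] := aff_near_at B x0 y1 r10.
  exists (Num.min r r2); first by rewrite lt_min r0.
  exists (Num.max m m1); first by rewrite le_max m0.
  move=> y0; rewrite inE => /orP[/eqP ->|ys] xi eta k x y.
    rewrite !lt_min => /andP[_ h1] /andP[_ h2] k0 reg E.
    by rewrite le_max (Hm1 x y k) ?orbT // => j; rewrite E; exact: Hr2.
  rewrite !lt_min => /andP[h1 _] /andP[h2 _] k0 reg E.
  by rewrite le_max (Hm y0 ys xi eta k x y).
have rootE x y : (y \in rts P x) = (meval (aff B x y 0) F == 0).
  by rewrite mem_rts // ev2_curve_poly_eq0.
have [|r r0 [m m0 Hm]] := loc (rts P x0).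
  by move=> y; rewrite rootE => /eqP.
have [r' r'0 Hr'] := root_near x0 Pm r0.
exists (Num.min r r'); first by rewrite lt_min r0.
exists m => // xi eta k x y; rewrite lt_min => /andP[h h'] k0 reg E.
have [|y0 y0r eta0] := Hr' xi h' eta; last exact: (Hm y0 y0r xi eta k x y).
rewrite rootE -E (meval_homog _ _ hF); case: reg => P0 _ _.
move/eqP: P0; rewrite -/(curve_poly A F) ev2_curve_poly_eq0 // => /eqP ->.
by rewrite mulr0.
Qed.

Let P := curve_poly A F.

(** Exchanging the first two frame vectors replaces [(x, y)] by [(1 / x, y / x)]: the fiber at
    infinity becomes the fiber over 0, and the projection keeps its centre. *)
Lemma psi_bounded_infinity : exists2 r : R, 0 < r & exists2 m : R, 0 <= m &
  forall x y, r <= cabs x -> regular F A e x y -> cabs (psi F A e L x y) <= m.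
Proof.
pose B : 'M[C]_3 := \matrix_(i, j) A (if i == 0 then 1 else if i == 1 then 0 else i) j.
have BE x y : aff B x y = (x *: row 0 A + row 1 A) + y *: row ord_max A.
  apply/rowP => j; rewrite affE !mxE /=.
  have -> : ord_max = 2%:R :> 'I_3 by apply: val_inj.
  by ring.
have Bu : B \in unitmx.
  have -> : B = xrow 0 1 A.
    apply/matrixP => i j; rewrite !mxE; congr (A _ _).
    by case: (ord3P i) => ->; rewrite ?perm.tpermL ?perm.tpermR // perm.tpermD.
  by rewrite unitmxE xrowE det_mulmx unitrM -!unitmxE Au unitmx_perm.
have FB : meval (row ord_max B 0) F != 0.
  rewrite (_ : row ord_max B = row ord_max A) //.
  by apply/rowP => j; rewrite !mxE.
have [r r0 [m m0 Hm]] := psi_bounded_fiber 0 Bu FB.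
exists (r^-1 + 1); first by rewrite addr_gt0 ?invr_gt0.
exists m => // x y xr reg.
have xr' : r^-1 < cabs x by apply: lt_le_trans xr; rewrite ltrDl.
have x0 : x != 0 by rewrite -cabs_gt0; apply: lt_trans xr'; rewrite invr_gt0.
apply: (Hm x^-1 (x^-1 * y) x^-1 x y) => //; rewrite ?invr_eq0 //.
  by rewrite subr0 cabsV -[r]invrK ltf_pV2 ?posrE ?invr_gt0 ?cabs_gt0.
rewrite BE; apply/rowP => j; rewrite mxE affE !mxE.
have -> : ord_max = 2%:R :> 'I_3 by apply: val_inj.
by field; rewrite x0.
Qed.

End Fibers.

(** * Symmetric functions over the fibers and the bound on the degree *)

Section Global.
Variable R : realType.
Local Notation C := R[i].
Variables (d : nat) (F : mpoly 3 C) (A : 'M[C]_3) (L : 'cV[C]_3).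
Hypothesis hF : F \is ishomog1 d mdeg.
Hypothesis Firr : mpoly_irreducible F.
Hypothesis Au : A \in unitmx.
Hypothesis Fe : meval (row ord_max A 0) F != 0.
Hypothesis ninf : forall O : CP2 R, ~ inflection_point F O.
Let e := (meval (row ord_max A 0) F)^-1.
Let P := curve_poly A F.
Hypothesis bnd : forall u : 'rV[C]_3, u != 0 -> meval (u 0) F = 0 ->
  psi_bounded_near F A e L u.

Lemma regular_off_finite : exists s : seq C, forall x y, x \notin s -> ev2 P x y = 0 ->
  regular F A e x y.
Proof.
have [sz Pm] := curve_poly_degree hF Fe.
have sP : (1 < size P)%N by rewrite sz ltnS (curve_degree_gt0 hF Firr Au Fe).
have [s Hs] := separable_roots (curve_poly_irr hF Firr Au Fe) Pm sP.
exists s => x y xs P0; have Py := Hs x y xs P0; split=> //.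
have [O OE] := point_of (aff_neq0 x y Au).
by apply: (hessian_neq0 Au hF _ P0 Py OE (ninf (O := O))); rewrite invr_eq0.
Qed.

Lemma cdiff_ev2 (Q : {poly {poly C}}) (s : C -> C) x : cdiff s x ->
  cdiff (fun z => ev2 Q z (s z)) x.
Proof.
move=> ds; apply: (@cdiff_section R (fun p : Caff R => ev2 Q p.1 p.2) s x) => //.
exact: differentiable_ev2.
Qed.

Lemma cdiff_psi (s : C -> C) x : cdiff s x -> regular F A e x (s x) ->
  cdiff (fun z => psi F A e L z (s z)) x.
Proof.
move=> ds [_ _ H0].
apply: cdiffM; last first.
  by apply: cdiffV; [rewrite expf_neq0|apply: cdiffX; exact: cdiff_ev2].
apply: cdiffM; first exact: cdiff_ev2.
apply: cdiffX.
apply: (cdiff_near (d := 1) (f := fun z => linval L (row 0 A) + z * linval L (row 1 A) +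
  s z * linval L (row 2%:R A))) => // [w _|]; first by rewrite linval_aff.
apply: cdiffD; last by apply: cdiffM => //; exact: cdiff_cst.
apply: cdiffD; first exact: cdiff_cst.
by apply: cdiffM; [exact: cdiff_id|exact: cdiff_cst].
Qed.

(** By Liouville's theorem each coefficient of the monic polynomial with roots the values of [psi]
    on the fiber is constant; 0 is a root over [x1], hence over every [x] off the finite set. *)
Lemma psi_zero_everywhere (s : seq C) x1 y1 :
  (forall x y, x \notin s -> ev2 P x y = 0 -> regular F A e x y) ->
  x1 \notin s -> ev2 P x1 y1 = 0 -> psi F A e L x1 y1 = 0 ->
  forall x, x \notin s -> exists2 y, ev2 P x y = 0 & psi F A e L x y = 0.
Proof.
move=> reg x1s P1 psi1 x xs; have [sz Pm] := curve_poly_degree hF Fe.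
pose c k z := (root_poly P (psi F A e L) z)`_k.
have coefb (m : R) : 0 <= m -> forall z,
    (forall y, y \in rts P z -> cabs (psi F A e L z y) <= m) ->
    forall k, cabs (c k z) <= (1 + m) ^+ (size P).-1.
  by move=> m0 z Hz k; rewrite -(size_rts z Pm); exact: coef_prod_bound.
have rt z y : z \notin s -> y \in rts P z -> regular F A e z y.
  by move=> zs; rewrite mem_rts // => /eqP; exact: reg.
have cE k : c k x = c k x1.
  have [r r0 [m m0 Hinf]] := psi_bounded_infinity hF Au Fe bnd.
  apply: (@liouville R (c k) r ((1 + m) ^+ (size P).-1) s) => //.
  - by rewrite exprn_ge0 // addr_ge0.
  - move=> z zs; apply: cdiff_root_poly => //.
      by move=> y Py; case: (reg z y zs Py).
    by move=> t dt Pt; apply: cdiff_psi dt _; exact: reg.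
  - move=> z zs; have [r' r'0 [m' m'0 Hm']] := psi_bounded_fiber hF Fe bnd z Au Fe.
    have [r1 r10 sep] := separation s.
    exists (Num.min r' r1); first by rewrite lt_min r'0.
    exists ((1 + m') ^+ (size P).-1) => w /andP[w0]; rewrite lt_min => /andP[wr' wr1].
    have ws : w \notin s.
      apply/negP => ws; have wz : w != z by rewrite -subr_eq0 -cabs_gt0.
      by have := sep w z ws zs wz; lra.
    apply: coefb => // y yr.
    by apply: (Hm' w y 1 w y); rewrite ?oner_neq0 ?scale1r //; exact: rt.
  - move=> w wr ws; apply: coefb => // y yr; apply: Hinf => //; exact: rt.
have root0 : root (root_poly P (psi F A e L) x) 0.
  have -> : root_poly P (psi F A e L) x = root_poly P (psi F A e L) x1.
    by apply/polyP => k; exact: cE.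
  rewrite /root_poly rootE horner_prod prodf_seq_eq0; apply/hasP.
  by exists y1; rewrite ?mem_rts ?P1 ?eqxx // psi1 hornerXsubC subrr eqxx.
move: root0; rewrite /root_poly rootE horner_prod prodf_seq_eq0 => /hasP[y yr /=].
rewrite hornerXsubC sub0r oppr_eq0 => /eqP psi0.
by exists y => //; apply/eqP; rewrite -mem_rts.
Qed.

(** A zero of [psi] at a regular point is a zero of the sextactic polynomial or of the linear form.
    If the former occurs over infinitely many abscissae, [P] divides the sextactic polynomial and
    [conic_of_sextactic] applies; otherwise [P] divides the linear form and the degree is at most
    1. *)
Lemma curve_degree_le2 (s : seq C) x1 y1 : L != 0 ->
  (forall x y, x \notin s -> ev2 P x y = 0 -> regular F A e x y) ->
  x1 \notin s -> ev2 P x1 y1 = 0 -> linval L (aff A x1 y1) = 0 -> (d <= 2)%N.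
Proof.
move=> L0 reg x1s P1 L1; have [sz Pm] := curve_poly_degree hF Fe.
have Pirr := curve_poly_irr hF Firr Au Fe.
have psi1 : psi F A e L x1 y1 = 0 by rewrite /psi L1 expr0n mulr0 mul0r.
have zero := psi_zero_everywhere reg x1s P1 psi1.
suff : (size P <= 3)%N by rewrite sz ltnS.
have [H|nH] := pselect (forall t : seq C, exists x y,
    [/\ x \notin t, ev2 P x y = 0 & ev2 (sextactic P) x y = 0]).
  have [B PB] := dvd_of_common_zeros Pirr Pm H.
  by have [_ Py H0] := reg x1 y1 x1s P1; exact: conic_of_sextactic P1 Py H0 B Pirr Pm PB.
have [t Ht] : exists t : seq C, forall x y, x \notin t -> ev2 P x y = 0 ->
    ev2 (sextactic P) x y != 0.
  apply: contrapT => nt; apply: nH => t; apply: contrapT => nt'; apply: nt; exists t.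
  by move=> x y xt Pxy; apply/eqP => S0; apply: nt'; exists x, y.
have [|B lB] := @dvd_of_common_zeros _ P (line_poly A L) Pirr Pm.
  move=> t'; have [x] := exists_notin (t' ++ t ++ s).
  rewrite !mem_cat !negb_or => /and3P[xt' xt xs].
  have [y Pxy psi0] := zero x xs; exists x, y; split=> //.
  have [_ _ H0] := reg x y xs Pxy; have S0 := Ht x y xt Pxy.
  by rewrite ev2_line_poly; exact: psi_eq0 psi0 S0 H0.
have l0 := line_poly_neq0 Au L0.
have B0 : B != 0 by apply: contraNneq l0 => B0; rewrite lB B0 mul0r.
apply: (@leq_trans (size (line_poly A L))); last exact: leq_trans (size_line_poly A L) _.
rewrite lB size_Mmonic //.
move: B0; rewrite -size_poly_gt0; move: (size B) (size P) => [//|n] p _.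
by rewrite addSn /= leq_addl.
Qed.

End Global.

(** Two linear conditions on three unknowns; the vectors may be dependent or zero. *)
Lemma common_annihilator (K : numClosedFieldType) (u v : 'rV[K]_3) :
  exists2 L : 'cV[K]_3, L != 0 & linval L u = 0 /\ linval L v = 0.
Proof.
pose M : 'M[K]_3 := \matrix_(i, j) [:: u 0 j; v 0 j; 0]`_i.
have /det0P [w w0 wM] : \det M^T == 0.
  rewrite det_tr (expand_det_row _ 2%:R) big1 ?eqxx // => j _.
  by rewrite mxE /= mul0r.
exists w^T; first by apply: contraNneq w0 => /(congr1 trmx); rewrite trmxK trmx0 => ->.
have E i : \sum_j w 0 j * M i j = 0.
  have /rowP/(_ i) := wM; rewrite [LHS]mxE [RHS]mxE => E; rewrite -[RHS]E.
  by apply: eq_bigr => j _; rewrite [M^T _ _]mxE.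
split; rewrite /linval mxE.
  by rewrite -[RHS](E 0); apply: eq_bigr => j _; rewrite !mxE mulrC.
by rewrite -[RHS](E 1); apply: eq_bigr => j _; rewrite !mxE mulrC.
Qed.

Theorem theorem1p38 (R : realType) (gamma : set (CP2 R)) (F : mpoly 3 R[i])
  (gamma_curve : irreducible_curve F gamma)
  (gamma_nonlinear : ~ is_line gamma)
  (no_inflection : forall O : CP2 R, ~ inflection_point F O)
  (branches_quadratic : forall (O : CP2 R) (b : set (CP2 R)),
     singular_point F O -> local_branch gamma O b -> quadratic_branch b O)
  (unique_singular : forall O1 O2 : CP2 R,
     singular_point F O1 ->
     (exists b1, local_branch gamma O1 b1 /\ singular_branch b1 O1) ->
     singular_point F O2 ->
     (exists b2, local_branch gamma O2 b2 /\ singular_branch b2 O2) ->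
     O1 = O2) :
  is_conic gamma.
Proof.
have [[d hF] Firr gE] := gamma_curve; have F0 := irreducible_neq0 Firr.
(* A point where [F] times the first coordinate is nonzero is off the curve and not a multiple of
   the second basis vector, so it can be the last vector of a frame. *)
have [A [Au FA]] : exists A : 'M[R[i]]_3, A \in unitmx /\ meval (row ord_max A 0) F != 0.
  have X0 : mpolyX R[i] (mnm1 (0 : 'I_3)) != 0.
    by apply/eqP => /(congr1 (meval (fun=> 1))); rewrite mevalXU meval0 => /eqP; rewrite oner_eq0.
  have [v] := meval_neq0 (mulf_neq0 F0 X0); rewrite mevalM mevalXU mulf_eq0 negb_or => /andP[Fv v0].
  have u0 : delta_mx 0 1 != 0 :> 'rV[R[i]]_3.
    by apply/eqP => /rowP/(_ 1); rewrite !mxE !eqxx => /eqP; rewrite oner_eq0.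
  have [k|A [Au _ A2]] := complete_frame (v := v) u0; last by exists A; rewrite A2.
  by apply: contraNneq v0 => ->; rewrite !mxE mulr0.
have [sz Pm] := curve_poly_degree hF FA; have d0 := curve_degree_gt0 hF Firr Au FA.
have [s Hs] := regular_off_finite hF Firr Au FA no_inflection.
have [x1 x1s] := exists_notin s.
have [y1 P1] : exists y1, ev2 (curve_poly A F) x1 y1 = 0.
  have : size (rts (curve_poly A F) x1) != 0%N by rewrite size_rts // sz -lt0n.
  case E : (rts _ _) => [//|y r] _; exists y.
  by apply/eqP; rewrite -mem_rts // E mem_head.
(* [u] spans the only point with a singular branch; if there is none, [u = 0] imposes no condition
   on the line. *)
have [u Hu] : exists u : 'rV[R[i]]_3, forall O b, singular_point F O -> local_branch gamma O b ->
    singular_branch b O -> sval O = <[u]>%VS.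
  have [[O [b [Os Ob bs]]]|none] := pselect (exists O b,
    [/\ singular_point F O, local_branch gamma O b & singular_branch b O]).
    have [u _ OE] := point_vec O; exists u => O' b' O's O'b' b's; rewrite -OE.
    by congr sval; apply: unique_singular => //; [exists b'|exists b].
  by exists 0 => O b Os Ob bs; case: none; exists O, b.
have [L L0 [L1 Lu]] := common_annihilator (aff A x1 y1) u.
suff d2 : (d <= 2)%N.
  (* Degree 0 is excluded by [d0], and degree 1 would make [gamma] a line. *)
  case: d d2 d0 hF {sz} => [|[|[|//]]] // _ _ hF.
    by case: gamma_nonlinear; exists F.
  by exists F.
apply: (curve_degree_le2 hF Firr Au FA _ L0 Hs x1s P1 L1) => v v0 Fv.
have [O OE] := point_of v0; have FO : zero_locus F O by apply/(zero_locus_line hF OE).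
have [Os|Ons] := pselect (singular_point F O); last first.
  exact (psi_bounded_smooth _ _ hF Au v0 OE FO Ons (@no_inflection O)).
apply: (psi_bounded_singular _ hF Au Firr gE Os v0 OE) => b Ob; first exact: branches_quadratic.
move=> bs; have : v \in <[u]>%VS by rewrite -(Hu O b) // OE memv_line.
by move=> /vlineP[k ->]; rewrite linvalZ Lu mulr0.
Qed.
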